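(* Let $\bar u\in U_{ad}$ be a local solution of $(S)$, with state $\bar y=S(\bar u)$ and adjoint state $\bar p=p_{\bar u}$, such that the first-order optimality condition (FO), the second-order condition (SSC 2) and the active set condition (ASC 2), with set $I$, $A=\Omega\setminus I$, function $w$ and exponent $\kappa>0$, are satisfied. Let $(u_\alpha)_{\alpha>0}$ be a family such that each $u_\alpha$ is a stationary point of $(S_\alpha)$ and $u_\alpha\rightharpoonup\bar u$ weakly in $L^2(\Omega)$ for $\alpha\searrow0$. Then, with $d:=\min(\kappa,1)$ and $z_{u_\alpha-\bar u}:=S'(\bar u)(u_\alpha-\bar u)$, it holds for $\alpha\searrow0$ \[ \|z_{u_\alpha-\bar u}\|_{L^2(\Omega)}=\mathcal O\big(\alpha^{\frac{d+1}{2}}\big),\qquad \|u_\alpha-\bar u\|_{L^1(A)}=\mathcal O\big(\alpha^{\frac{\kappa(d+1)}{\kappa+1}}\big),\qquad \|u_\alpha-\bar u\|_{L^2(\Omega)}=\mathcal O\big(\alpha^{d/2}\big). \] If $w=0$ or $A=\Omega$, these convergence rates hold with $d:=\kappa$.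
   Context: Setting. $\Omega\subseteq\mathbb R^n$, $n\le 3$, is a bounded Lipschitz domain. $\mathcal A y=-\sum_{i,j=1}^n\partial_{x_j}[a_{ij}\partial_{x_i}y]$ with $a_{ij}\in C(\bar\Omega)$ and, for some $\lambda_{\mathcal A}>0$, $\lambda_{\mathcal A}|\zeta|^2\le\sum_{i,j}a_{ij}(x)\zeta_i\zeta_j$ for all $\zeta\in\mathbb R^n$ and a.a. $x\in\Omega$; $\mathcal A^*$ is its formal adjoint. $f:\Omega\times\mathbb R\to\mathbb R$ is measurable in $x$ and $C^2$ in $y$; $f',f''$ denote its first and second partial derivatives with respect to $y$, and $f(y)$ means $f(\cdot,y(\cdot))$. Assume: $f(\cdot,0)\in L^{q}(\Omega)$ with $q>n/2$, $q\ge1$; $f'(x,y)\ge0$ for all $y\in\mathbb R$ and a.a. $x$; for every $M>0$ there is $C_{f,M}>0$ with $|f'(x,y)|+|f''(x,y)|\le C_{f,M}$ for a.a. $x$ and $|y|\le M$; for every $M>0,\varepsilon>0$ there is $\delta>0$ with $|f''(x,y_2)-f''(x,y_1)|\le\varepsilon$ for a.a. $x$ whenever $|y_1|,|y_2|\le M$, $|y_2-y_1|\le\delta$. Further $y_d\in L^2(\Omega)\cap L^{q}(\Omega)$, $u_a,u_b\in L^\infty(\Omega)$ with $u_a\le0\le u_b$ a.e., $\beta>0$, and $U_{ad}:=\{u\in L^2(\Omega):u_a\le u\le u_b\text{ a.e.}\}$; $P_{U_{ad}}(v)=\max(u_a,\min(v,u_b))$ pointwise. Let $Y:=H^1_0(\Omega)\cap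 C(\bar\Omega)$. For $u\in L^2(\Omega)$, $y_u=S(u)\in Y$ is the unique weak solution of $\mathcal A y+f(y)=u$ in $\Omega$, $y=0$ on $\partial\Omega$; the map $S:L^2(\Omega)\to Y$ is $C^2$, and $z=S'(u)v$ solves $\mathcal A z+f'(y_u)z=v$ in $\Omega$, $z=0$ on $\partial\Omega$. $S'(u)^*$ is the adjoint of $S'(u)$ as an operator $L^2(\Omega)\to L^2(\Omega)$. The adjoint state $p_u$ is the weak solution of $\mathcal A^*p+f'(y_u)p=y_u-y_d$ in $\Omega$, $p=0$ on $\partial\Omega$. Let $J(u)=\frac12\|y_u-y_d\|_{L^2(\Omega)}^2$; then $J'(u)v=\int_\Omega p_u v\,dx$ and $J''(u)(v_1,v_2)=\int_\Omega(1-f''(x,y_u)p_u)\,(S'(u)v_1)(S'(u)v_2)\,dx$, $J''(u)v^2:=J''(u)(v,v)$. Let $j(u)=\|u\|_{L^1(\Omega)}$, with directional derivative $j'(u;v)=\int_{\{u\neq0\}}\operatorname{sign}(u)v\,dx+\int_{\{u=0\}}|v|\,dx$. $(S)$: minimize $F(u)=J(u)+\beta j(u)$ over $u\in U_{ad}$. Local solutions are understood with respect to the $L^2(\Omega)$ norm. $(S_\alpha)$, $\alpha>0$: minimize $F_\alpha(u)=J(u)+\beta j(u)+\frac\alpha2\|u\|_{L^2(\Omega)}^2$ over $u\in U_{ad}$. A stationary point of $(S_\alpha)$ is $u_\alpha\in U_{ad}$ with $(p_{u_\alpha}+\alpha u_\alpha,u-u_\alpha)_{L^2(\Omega)}+\beta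 j'(u_\alpha;u-u_\alpha)\ge0$ for all $u\in U_{ad}$. (FO): there is $\bar\lambda\in\partial\|\bar u\|_{L^1(\Omega)}$ (convex subdifferential) with $\int_\Omega(\bar p+\beta\bar\lambda)(u-\bar u)\,dx\ge0$ for all $u\in U_{ad}$. (SSC 2): there exist $\delta>0$, $\tau>0$ such that $J''(\bar u)v^2\ge\delta\|S'(\bar u)v\|_{L^2(\Omega)}^2$ for all $v\in\tilde C^\tau_{\bar u}$, where $\tilde C^\tau_{\bar u}$ is the set of $v\in L^2(\Omega)$ with $v(x)\ge0$ if $\bar u(x)=u_a(x)$, $v(x)\le0$ if $\bar u(x)=u_b(x)$ (a.e.), and $J'(\bar u)v+\beta j'(\bar u;v)\le\tau\|S'(\bar u)v\|_{L^2(\Omega)}$. (ASC 2) for a local solution $\bar u$ of $(S)$: there exist a (measurable) set $I\subseteq\Omega$, a function $w\in Y$ and constants $\kappa,c>0$ such that (1) $I\supset\{x\in\Omega:|\bar p(x)|=\beta\}$ and $\chi_I\bar u=\chi_IP_{U_{ad}}(S'(\bar u)^*w)$; (2) with $A:=\Omega\setminus I$, for all $\varepsilon>0$, $\operatorname{meas}(\{x\in A:0<\big||\bar p(x)|-\beta\big|<\varepsilon\})\le c\,\varepsilon^\kappa$; (3) $S'(\bar u)^*w\in L^\infty(\Omega)$. *)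

(* Defs.v *)
From HB Require Import structures.
From mathcomp Require Import all_boot all_order all_algebra.
From mathcomp Require Import all_classical all_reals all_analysis.
Set Implicit Arguments. Unset Strict Implicit. Unset Printing Implicit Defensive.
Import Order.TTheory GRing.Theory Num.Def Num.Theory.
Import numFieldNormedType.Exports.
Local Open Scope classical_set_scope.
Local Open Scope ring_scope.

(* The product sigma-algebra, i.e. the Borel sets, on R^n seen as 'rV[R]_n. *)
Definition rV_display : measure_display.
Proof. exact: default_measure_display. Qed.

Section rV_measurable.
Context (R : realType) (n : nat).

Let coord (i : 'I_n) (x : 'rV[R]_n) : R := x ord0 i.

Let rV_set0 : g_sigma_preimage coord set0.
Proof. exact: sigma_algebra0. Qed.

Let rV_setC A : g_sigma_preimage coord A -> g_sigma_preimage coord (~` A).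
Proof. exact: sigma_algebraC. Qed.

Let rV_bigcup (F : (set 'rV[R]_n)^nat) :
  (forall i, g_sigma_preimage coord (F i)) ->
  g_sigma_preimage coord (\bigcup_i (F i)).
Proof. exact: sigma_algebra_bigcup. Qed.

HB.instance Definition _ := @isMeasurable.Build rV_display 'rV[R]_n
  (g_sigma_preimage coord) rV_set0 rV_setC rV_bigcup.

Lemma measurable_coord (i : 'I_n) :
  measurable_fun [set: 'rV[R]_n] (fun x => x ord0 i : R).
Proof.
move=> _ Y mY; apply: sub_sigma_algebra.
rewrite (bigD1 i)//=; left; exists Y => //.
Qed.

Lemma measurable_fun_rV d (T : measurableType d) (f : T -> 'rV[R]_n) :
  (forall i, measurable_fun [set: T] (fun t => f t ord0 i : R)) ->
  measurable_fun [set: T] f.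
Proof.
move=> mf; apply: (@measurability _ _ _ _ _ _
  (\big[setU/set0]_(i < n) preimage_set_system setT (coord i) measurable)) => //.
move=> _ [Y + <-]; elim/big_ind : _ => //.
- by move=> A B hA hB [/hA|/hB].
- move=> i _ [Z mZ <-]; rewrite !setTI -comp_preimage.
  by rewrite -[X in measurable X]setTI; apply: mf.
Qed.

End rV_measurable.

Section lebesgue_rV.
Context (R : realType).

Definition rV_cons n (p : R * 'rV[R]_n) : 'rV[R]_n.+1 :=
  row_mx (const_mx p.1 : 'rV_1) p.2.

Definition rV_uncons n (x : 'rV[R]_n.+1) : R * 'rV[R]_n :=
  (x ord0 ord0, \row_j x ord0 (lift ord0 j)).

Lemma rV_cons0 n p : @rV_cons n p ord0 ord0 = p.1.
Proof.
have := row_mxEl (const_mx p.1 : 'rV[R]_1) p.2 ord0 ord0; rewrite [RHS]mxE => <-.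
by congr (row_mx _ _ _ _); exact/val_inj.
Qed.

Lemma rV_consS n p j : @rV_cons n p ord0 (lift ord0 j) = p.2 ord0 j.
Proof.
rewrite -(row_mxEr (const_mx p.1 : 'rV_1) p.2).
by congr (row_mx _ _ _ _); exact/val_inj.
Qed.

Lemma rV_consK n : cancel (@rV_cons n) (@rV_uncons n).
Proof.
move=> [a x]; rewrite /rV_uncons rV_cons0/=; congr pair.
by apply/rowP => j; rewrite mxE rV_consS.
Qed.

Lemma measurable_rV_cons n : measurable_fun [set: R * 'rV[R]_n] (@rV_cons n).
Proof.
apply: measurable_fun_rV => i; case: (unliftP ord0 i) => [j ->|->].
- under eq_fun do rewrite rV_consS.
  exact: (measurableT_comp (measurable_coord (R:=R) j) measurable_snd).
- under eq_fun do rewrite rV_cons0; exact: measurable_fst.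
Qed.

Lemma measurable_rV_uncons n :
  measurable_fun [set: 'rV[R]_n.+1] (@rV_uncons n).
Proof.
apply/measurable_fun_pairP; split; first exact: measurable_coord.
apply: measurable_fun_rV => j; under eq_fun do rewrite /= mxE.
exact: measurable_coord.
Qed.

Section lebesgue_rVS.
Context n (mu : {sigma_finite_measure set 'rV[R]_n -> \bar R}).

Let nu : {measure set (measurableTypeR R * 'rV[R]_n)%type -> \bar R} :=
  (@lebesgue_measure R \x mu)%E.

Definition lebesgue_rVS : set 'rV[R]_n.+1 -> \bar R :=
  pushforward nu (@rV_cons n).

Let lebesgue_rVS0 : lebesgue_rVS set0 = 0%E.
Proof. by rewrite /lebesgue_rVS /pushforward preimage_set0 measure0. Qed.

Let lebesgue_rVS_ge0 A : (0 <= lebesgue_rVS A)%E.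
Proof. exact: (measure_ge0 nu). Qed.

Let lebesgue_rVS_sigma_additive : semi_sigma_additive lebesgue_rVS.
Proof.
move=> F mF tF mUF; rewrite /lebesgue_rVS /pushforward preimage_bigcup.
apply: measure_semi_sigma_additive.
- by move=> k; rewrite -[X in measurable X]setTI; exact: measurable_rV_cons.
- apply/trivIsetP => /= i j _ _ ij; rewrite -preimage_setI.
  by move/trivIsetP : tF => /(_ _ _ _ _ ij) ->//; rewrite preimage_set0.
- rewrite -preimage_bigcup -[X in measurable X]setTI.
  exact: measurable_rV_cons.
Qed.

HB.instance Definition _ := isMeasure.Build _ _ _ lebesgue_rVS
  lebesgue_rVS0 lebesgue_rVS_ge0 lebesgue_rVS_sigma_additive.

Let lebesgue_rVS_sigma_finite : sigma_finite setT lebesgue_rVS.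
Proof.
have /sigma_finiteP[F [TF ndF Foo]] := sigma_finiteT (@lebesgue_measure R).
have /sigma_finiteP[G [TG ndG Goo]] := sigma_finiteT mu.
exists (fun k => @rV_uncons n @^-1` (F k `*` G k)).
  rewrite -preimage_bigcup (_ : \bigcup_k _ = setT) ?preimage_setT//.
  apply/seteqP; split => // -[x y] _.
  have [i _ Fix] : (\bigcup_i F i) x by rewrite -TF.
  have [j _ Gjy] : (\bigcup_j G j) y by rewrite -TG.
  exists (maxn i j) => //; split => /=.
  - by move: x Fix; exact/subsetPset/ndF/leq_maxl.
  - by move: y Gjy; exact/subsetPset/ndG/leq_maxr.
move=> k; have [mF Fk] := Foo k; have [mG Gk] := Goo k; split.
  rewrite -[X in measurable X]setTI; apply: measurable_rV_uncons => //.
  exact: measurableX.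
rewrite /lebesgue_rVS /pushforward -comp_preimage.
rewrite (_ : _ \o _ = id); last by apply/funext; exact: rV_consK.
by rewrite preimage_id/= product_measure1E// lte_mul_pinfty// ge0_fin_numE.
Qed.

HB.instance Definition _ := Measure_isSigmaFinite.Build _ _ _ lebesgue_rVS
  lebesgue_rVS_sigma_finite.

End lebesgue_rVS.

(* n-dimensional Lebesgue measure on the Borel sets, as an iterated product. *)
Fixpoint lebesgue_rV n : {sigma_finite_measure set 'rV[R]_n -> \bar R} :=
  match n with
  | 0%N => \d_(0 : 'rV[R]_0)
  | n'.+1 => lebesgue_rVS (lebesgue_rV n')
  end.

Lemma lebesgue_rV_box n (a b : 'rV[R]_n) : (forall i, a ord0 i <= b ord0 i) ->
  lebesgue_rV n [set x : 'rV[R]_n | forall i, a ord0 i < x ord0 i <= b ord0 i] =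
  (\prod_i (b ord0 i - a ord0 i))%:E.
Proof.
elim: n a b => [|n IH] a b ab.
  rewrite big_ord0 /= diracE mem_set//.
  by case.
rewrite big_ord_recl EFinM.
pose a' : 'rV[R]_n := \row_j a ord0 (lift ord0 j).
pose b' : 'rV[R]_n := \row_j b ord0 (lift ord0 j).
have -> : lebesgue_rV n.+1 [set x : 'rV[R]_n.+1 | forall i, a ord0 i < x ord0 i <= b ord0 i] =
  (@lebesgue_measure R \x lebesgue_rV n)%E (`]a ord0 ord0, b ord0 ord0] `*`
     [set x : 'rV[R]_n | forall i, a' ord0 i < x ord0 i <= b' ord0 i]).
  rewrite /= /lebesgue_rVS /pushforward; congr (_ _).
  apply/seteqP; split => -[t x] /=.
    move=> H; split => [|i]; first by have := H ord0; rewrite rV_cons0 in_itv.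
    by have := H (lift ord0 i); rewrite rV_consS !mxE.
  move=> [+ H] i; rewrite in_itv /=; case: (unliftP ord0 i) => [j ->|->].
    by have := H j; rewrite rV_consS !mxE.
  by rewrite rV_cons0.
rewrite product_measure1E//; first last.
  rewrite (_ : mkset _ = \bigcap_(i in [set: 'I_n])
     ((fun x : 'rV[R]_n => x ord0 i) @^-1` `]a' ord0 i, b' ord0 i])); last first.
    by apply/seteqP; split => x /= H i; have := H i; rewrite /= in_itv//= => /(_ I).
  apply: fin_bigcap_measurable => // i _.
  by rewrite -[X in measurable X]setTI; exact: measurable_coord.
congr (_ * _)%E.
  have := lebesgue_measure_itv `]a ord0 ord0, b ord0 ord0]; rewrite /= lte_fin.
  move=> ->; case: ltP => // ba; rewrite (_ : _ - _ = 0)//; apply/eqP.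
  by rewrite subr_eq0 eq_le ba ab.
rewrite IH; last by move=> i; rewrite !mxE.
by congr EFin; apply: eq_bigr => i _; rewrite !mxE.
Qed.

End lebesgue_rV.

Arguments lebesgue_rV : clear implicits.

Section domain.
Context (R : realType) (n : nat).

(* Near each boundary point, up to a rigid motion, Omega is the strict epigraph
   of a Lipschitz function of the n-1 coordinates other than the k-th. *)
Definition lipschitz_boundary (Omega : set 'rV[R]_n) :=
  forall x0, (closure Omega `\` Omega) x0 ->
  exists (Q : 'M[R]_n) (k : 'I_n) (g : 'rV[R]_n.-1 -> R) (L : R),
    [/\ Q *m Q^T = 1%:M,
        (forall s t, `|g s - g t| <= L * `|s - t|) &
        \forall x \near x0, Omega x <-> g (col' k (x *m Q)) < (x *m Q) ord0 k].

Definition bounded_lipschitz_domain (Omega : set 'rV[R]_n) :=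
  [/\ open Omega, connected Omega, Omega !=set0, bounded_set Omega &
      lipschitz_boundary Omega].

End domain.

(* A function on Omega is represented by a function on the whole of R^n of
   which only the values on Omega (or on its closure) matter. *)
Section spaces.
Context (R : realType) (n : nat).
Local Notation fct := ('rV[R]_n -> R).
Local Notation mu := (lebesgue_rV R n).
Implicit Types (u v y z phi : fct) (G : 'I_n -> fct) (p : \bar R).

Definition normL p (D : set 'rV[R]_n) u : R :=
  fine 'N[mu]_p[EFin \o (u \_ D)]%E.

Variable Omega : set 'rV[R]_n.

Definition inL p u : Prop := (u \_ Omega) \in Lfun mu p.

Definition dotL2 u v : R := \int[mu]_(x in Omega) (u x * v x).

Definition partial (i : 'I_n) phi : fct := 'D_(delta_mx ord0 i) phi.

(* All iterated partial derivatives exist and are continuous. *)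
Definition smooth phi := forall (s : seq 'I_n) x,
  let psi := foldr partial phi s in
  {for x, continuous psi} /\ forall i, derivable psi x (delta_mx ord0 i).

Definition test_function phi :=
  smooth phi /\
  exists K, [/\ compact K, K `<=` Omega & forall x, ~ K x -> phi x = 0].

Definition weak_gradient u G :=
  (forall i, inL 2%:E (G i)) /\
  forall phi, test_function phi -> forall i,
    dotL2 u (partial i phi) = - dotL2 (G i) phi.

Definition inH1 u := inL 2%:E u /\ exists G, weak_gradient u G.

(* An arbitrary choice among a.e. equal weak gradients; 0 if there is none. *)
Definition grad u : 'I_n -> fct :=
  xget (fun _ _ => 0) [set G | weak_gradient u G].

Definition normH1 u : R :=
  Num.sqrt (normL 2%:E Omega u ^+ 2 + \sum_i normL 2%:E Omega (grad u i) ^+ 2).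

(* closure of the test functions in H^1 *)
Definition inH10 u :=
  inH1 u /\ exists phi : nat -> fct, (forall k, test_function (phi k)) /\
    normH1 (u \- phi k) @[k --> \oo] --> (0 : R).

(* Y = H^1_0(Omega) cap C(closure Omega), with the sum of the two norms *)
Definition inY y := inH10 y /\ {within closure Omega, continuous y}.

Definition normY y : R := normH1 y + sup [set `|y x| | x in closure Omega].

(* T is the Frechet derivative at u of S : L^2(Omega) -> Y *)
Definition frechet_L2_Y (S : fct -> fct) u (T : fct -> fct) :=
  [/\ forall v, inL 2%:E v -> inY (T v),
      forall c v1 v2, inL 2%:E v1 -> inL 2%:E v2 ->
        {in closure Omega, T (c \*o v1 \+ v2) =1 c \*o T v1 \+ T v2},
      exists C : R, forall v, inL 2%:E v ->
        normY (T v) <= C * normL 2%:E Omega v &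
      forall e, 0 < e -> exists2 r, 0 < r & forall v, inL 2%:E v ->
        normL 2%:E Omega v < r ->
        normY (S (u \+ v) \- S u \- T v) <= e * normL 2%:E Omega v].

Definition adjoint_L2 (T T' : fct -> fct) := forall g, inL 2%:E g ->
  inL 2%:E (T' g) /\ forall v, inL 2%:E v -> dotL2 (T v) g = dotL2 v (T' g).

Definition weak_cvg_L2 T (F : set_system T) (u : T -> fct) ubar :=
  forall g, inL 2%:E g -> dotL2 (u t) g @[t --> F] --> dotL2 ubar g.

End spaces.

Section problem.
Context (R : realType) (n : nat) (Omega : set 'rV[R]_n).
Local Notation fct := ('rV[R]_n -> R).
Local Notation mu := (lebesgue_rV R n).
Local Notation L2 := (inL Omega 2%:E).
Local Notation norm2 := (normL 2%:E Omega).
Local Notation "'<<' u , v '>>'" := (dotL2 Omega u v).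

Definition elliptic (a : 'I_n -> 'I_n -> fct) (lambda : R) :=
  [/\ forall i j, {within closure Omega, continuous (a i j)}, 0 < lambda &
      \forall x \ae mu, Omega x -> forall zeta : 'rV[R]_n,
        lambda * \sum_i zeta ord0 i ^+ 2 <=
        \sum_i \sum_j a i j x * zeta ord0 i * zeta ord0 j].

(* derivatives in the second variable *)
Definition fy (f : 'rV[R]_n -> R -> R) x : R -> R := derive1 (f x).
Definition fyy (f : 'rV[R]_n -> R -> R) x : R -> R := derive1 (fy f x).

Definition admissible_nonlinearity (q : \bar R) (f : 'rV[R]_n -> R -> R) :=
  [/\ (forall s, measurable_fun Omega (f ^~ s)) /\
      (forall x, Omega x -> [/\ forall s, derivable (f x) s 1,
          forall s, derivable (fy f x) s 1 & continuous (fyy f x)]),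
      inL Omega q (f ^~ 0),
      \forall x \ae mu, Omega x -> forall s, 0 <= fy f x s,
      forall M, 0 < M -> exists2 C, 0 < C &
        \forall x \ae mu, Omega x -> forall s, `|s| <= M ->
          `|fy f x s| + `|fyy f x s| <= C &
      forall M e, 0 < M -> 0 < e -> exists2 r, 0 < r &
        \forall x \ae mu, Omega x -> forall s1 s2, `|s1| <= M -> `|s2| <= M ->
          `|s2 - s1| <= r -> `|fyy f x s2 - fyy f x s1| <= e].

(* weak form of  - sum_ij d_j (a_ij d_i y) + g(x, y) = u,  y = 0 on the
   boundary *)
Definition weak_solution (a : 'I_n -> 'I_n -> fct) (g : 'rV[R]_n -> R -> R)
    (u y : fct) :=
  inH10 Omega y /\ forall psi, inH10 Omega psi ->
    \int[mu]_(x in Omega)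
      (\sum_i \sum_j a i j x * grad Omega y i x * grad Omega psi j x)
    + \int[mu]_(x in Omega) (g x (y x) * psi x) = << u, psi >>.

Variables (a : 'I_n -> 'I_n -> fct) (f : 'rV[R]_n -> R -> R).

Definition control_to_state (S : fct -> fct) := forall u, L2 u ->
  inY Omega (S u) /\ weak_solution a f u (S u).

Variables (yd ua ub : fct) (beta : R) (S : fct -> fct).

(* The formal adjoint of the principal part has the transposed coefficients. *)
Definition adjoint_state (P : fct -> fct) := forall u, L2 u ->
  weak_solution (fun i j => a j i) (fun x s => fy f x (S u x) * s)
    (S u \- yd) (P u).

Definition Uad u := L2 u /\
  \forall x \ae mu, Omega x -> ua x <= u x <= ub x.

Definition projUad (v : fct) : fct :=
  fun x => Num.max (ua x) (Num.min (v x) (ub x)).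

Definition J u : R := 2^-1 * norm2 (S u \- yd) ^+ 2.

Definition jL1 (u : fct) : R := normL 1%:E Omega u.

(* directional derivative of jL1 at u in direction v *)
Definition jL1' (u v : fct) : R :=
  \int[mu]_(x in Omega `&` [set x | u x != 0]) (Num.sg (u x) * v x) +
  \int[mu]_(x in Omega `&` [set x | u x = 0]) `|v x|.

Definition F u : R := J u + beta * jL1 u.

Definition local_solution ubar := Uad ubar /\
  exists2 r, 0 < r & forall u, Uad u -> norm2 (u \- ubar) < r -> F ubar <= F u.

Variables (S' : fct -> fct -> fct) (P : fct -> fct).

(* J' and J'' are the first and second derivatives of J, written through the
   adjoint state P u and the derivative S' u of the control-to-state map. *)
Definition J' (u v : fct) : R := << P u, v >>.

Definition J'' (u v1 v2 : fct) : R :=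
  \int[mu]_(x in Omega)
    ((1 - fyy f x (S u x) * P u x) * (S' u v1 x * S' u v2 x)).

Definition stationary_point (alpha : R) (ualpha : fct) := Uad ualpha /\
  forall u, Uad u ->
    0 <= << P ualpha \+ alpha \*o ualpha, u \- ualpha >>
         + beta * jL1' ualpha (u \- ualpha).

(* the convex subdifferential of the L^1-norm as a functional on L^2(Omega) *)
Definition subdiff_jL1 (u lambda : fct) := L2 lambda /\
  forall v, L2 v -> jL1 u + << lambda, v \- u >> <= jL1 v.

Definition FO ubar := exists2 lambda, subdiff_jL1 ubar lambda &
  forall u, Uad u -> 0 <= << P ubar \+ beta \*o lambda, u \- ubar >>.

Definition critical_cone (ubar : fct) (tau : R) (v : fct) :=
  [/\ L2 v,
      \forall x \ae mu, Omega x -> (ubar x = ua x -> 0 <= v x) /\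
                                   (ubar x = ub x -> v x <= 0) &
      J' ubar v + beta * jL1' ubar v <= tau * norm2 (S' ubar v)].

Definition SSC2 ubar := exists delta tau : R, [/\ 0 < delta, 0 < tau &
  forall v, critical_cone ubar tau v ->
    delta * norm2 (S' ubar v) ^+ 2 <= J'' ubar v v].

(* S'adj u stands for the L^2-adjoint of S' u. *)
Definition ASC2 (S'adj : fct -> fct -> fct) (ubar : fct)
    (I : set 'rV[R]_n) (w : fct) (kappa : R) :=
  [/\ [/\ measurable I, I `<=` Omega, inY Omega w & 0 < kappa],
      [set x | Omega x /\ `|P ubar x| = beta] `<=` I,
      \forall x \ae mu, I x -> ubar x = projUad (S'adj ubar w) x,
      exists2 c, 0 < c & forall e, 0 < e ->
        (mu [set x | (Omega `\` I) x /\ (0 < `| `|P ubar x| - beta | < e)%R]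
          <= (c * e `^ kappa)%:E)%E &
      inL Omega +oo%E (S'adj ubar w)].

Definition convergence_rates (ubar : fct) (A : set 'rV[R]_n)
    (u : R -> fct) (kappa d : R) :=
  [/\ (fun alpha => norm2 (S' ubar (u alpha \- ubar)))
        =O_ (0^'+) (fun alpha => alpha `^ ((d + 1) / 2)),
      (fun alpha => normL 1%:E A (u alpha \- ubar))
        =O_ (0^'+) (fun alpha => alpha `^ (kappa * (d + 1) / (kappa + 1))) &
      (fun alpha => norm2 (u alpha \- ubar))
        =O_ (0^'+) (fun alpha => alpha `^ (d / 2))].

End problem.

(* Main.v *)
Require Import Defs.
From HB Require Import structures.
From mathcomp Require Import all_boot all_order all_algebra.
From mathcomp Require Import all_classical all_reals all_analysis.
From mathcomp Require Import measurable_realfun ess_sup_inf.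
From mathcomp Require Import ring lra.
Set Implicit Arguments.
Unset Strict Implicit.
Unset Printing Implicit Defensive.
Import Order.TTheory GRing.Theory Num.Def Num.Theory.
Import numFieldNormedType.Exports.
Local Open Scope classical_set_scope.
Local Open Scope ring_scope.

(* Let v = u_alpha - ubar, z = S'(ubar) v, let p be the difference of the adjoint
   states and G = J'(ubar) v + beta j'(ubar; v). Testing stationarity with ubar and
   using the monotonicity of j' gives
     (p, v) + G + alpha |v|^2 <= - alpha (ubar, v) <= alpha (|w| |z| + K |v|_{L1(A)}),
   the last step because ubar is a projection of S'(ubar)^* w on I. Read pointwise,
   (FO) yields G >= int ||pbar| - beta| |v|, so the measure condition gives
   G >= eps |v|_{L1(A)} - M eps^(kappa+1) for every eps > 0. Moreover
   (p, v) = J''(ubar) v^2 + o(|z|^2), so that (SSC 2) bounds (p, v) + G below by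
   G/2 + delta/2 |z|^2: outside of the cone, G > tau |z| dominates |z|^2. Young's
   inequality with eps ~ alpha, then eps = alpha^((d+1)/(kappa+1)), gives the rates.

   The asymptotics of (p, v) need uniform convergence of states and adjoint states.
   The state equation is tested with bounded functions only (f(., y) need not be
   square integrable); smooth truncations of the solution are admissible, and
   Stampacchia's iteration, fed by a Nash inequality obtained by averaging over
   translations, bounds |y|_infty. Convergence in L2 comes from compactness of
   S'(ubar): a bounded operator from L2 to L^infty sends weakly null bounded
   families to strongly null ones, since sum_i |T w_i (x)|^2 stays bounded along
   almost orthogonal w_i. *)

(** * Square integrable functions *)

(** The hypotheses give [S' ubar] only as a Frechet derivative from L2 to [Y]; the linearized
    equation has to be recovered from it. The circle to break: the expansion of (p, v) needs the
    difference y of the states to be uniformly small, while weak convergence of the controls says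
    nothing direct about the nonlinear map [S]. The exit is the exact identity y = S'(ubar)(v - r),
    with r the Taylor remainder of f. Monotonicity bounds |y|^2 by a multiple of (v, y) =
    (S'(ubar)^* v, v - r), where boundedness of r is enough, and the compact adjoint makes this
    small. Stampacchia turns smallness in L2 into smallness in the supremum norm; only then is r =
    o(y), which makes y and z comparable. The dimension enters in the iteration: on a level set of
    measure m the Poincare constant e may be of order m^(1/n), and the next level set has measure of
    order m^(1/2) e^2 = m^(1/2 + 2/n), a gain exactly when n < 4. The proof uses e of order m^(1/3)
    in all dimensions, hence the power 7/6. The restriction d <= 1 comes from the term alpha^2 |w|^2
    left by Young's inequality. *)

Section square_integrable.
Context d (T : measurableType d) (R : realType)
  (mu : {measure set T -> \bar R}) (D : set T).
Hypothesis mD : measurable D.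
Implicit Types (f g h : T -> R) (P Q : T -> Prop).

Definition aeD P := \forall x \ae mu, D x -> P x.
Definition L1 f := mu.-integrable D (EFin \o f).
Definition L2 f := measurable_fun D f /\ L1 (fun x => f x ^+ 2).
(** This is the finite part of an extended integral, so linearity and monotonicity need
    integrability, which the [L2] hypotheses below supply. *)
Definition ip f g : R := \int[mu]_(x in D) (f x * g x).
Definition n2 f : R := Num.sqrt (ip f f).

Lemma aeD_all P : (forall x, D x -> P x) -> aeD P.
Proof. by move=> h; apply: aeW => x; exact: h. Qed.

Lemma aeD_mp P Q : (forall x, D x -> P x -> Q x) -> aeD P -> aeD Q.
Proof. by move=> h; rewrite /aeD; apply: filterS => x Px Dx; apply: h => //; exact: Px. Qed.

Lemma aeD_mp2 P1 P2 Q : (forall x, D x -> P1 x -> P2 x -> Q x) ->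
  aeD P1 -> aeD P2 -> aeD Q.
Proof.
by move=> h; rewrite /aeD; apply: filterS2 => x P1x P2x Dx; apply: h => //; [exact: P1x|exact: P2x].
Qed.

Lemma L1_measurable f : L1 f -> measurable_fun D f.
Proof. by move=> /integrableP[/measurable_EFinP]. Qed.

Lemma L1_le f g : measurable_fun D f -> L1 g -> aeD (fun x => `|f x| <= g x) ->
  L1 f.
Proof.
move=> mf /[dup] ig /integrableP[mg goo] fg; apply/integrableP; split.
  exact/measurable_EFinP.
apply: le_lt_trans goo; apply: ae_ge0_le_integral => //.
- by apply: measurableT_comp => //; exact/measurable_EFinP.
- exact: measurableT_comp.
- apply: aeD_mp fg => x Dx fg /=; rewrite lee_fin.
  by apply: (le_trans fg); exact: ler_norm.
Qed.

Lemma L1D f g : L1 f -> L1 g -> L1 (fun x => f x + g x).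
Proof. by move=> lf lg; exact: (integrableD mD lf lg). Qed.

Lemma eq_L1 f g : (forall x, D x -> f x = g x) -> L1 f -> L1 g.
Proof.
by move=> fg; apply: eq_integrable => // x /[!inE] Dx /=; rewrite fg.
Qed.

Lemma L1Z (c : R) f : L1 f -> L1 (fun x => c * f x).
Proof. by move=> lf; exact: (integrableZl mD c lf). Qed.

Lemma L1N f : L1 f -> L1 (fun x => - f x).
Proof. by move=> /(L1Z (-1)); apply: eq_L1 => x _; rewrite mulN1r. Qed.

Lemma L1B f g : L1 f -> L1 g -> L1 (fun x => f x - g x).
Proof. by move=> lf lg; apply: L1D => //; exact: L1N. Qed.

Lemma L1_norm f : L1 f -> L1 (fun x => `|f x|).
Proof. exact: integrable_norm. Qed.

Lemma L1_sum (I : Type) (s : seq I) (F : I -> T -> R) :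
  (forall i, L1 (F i)) -> L1 (fun x => \sum_(i <- s) F i x).
Proof.
move=> hF; elim: s => [|i s IH].
  under eq_fun do rewrite big_nil; exact: (integrable0 mu D).
under eq_fun do rewrite big_cons; exact: L1D.
Qed.

Lemma eq_Int f g : (forall x, D x -> f x = g x) ->
  \int[mu]_(x in D) f x = \int[mu]_(x in D) g x.
Proof. by move=> fg; apply: eq_Rintegral => x /[!inE]; exact: fg. Qed.

Lemma Int_sum (I : Type) (s : seq I) (F : I -> T -> R) :
  (forall i, L1 (F i)) ->
  \int[mu]_(x in D) (\sum_(i <- s) F i x) =
  \sum_(i <- s) \int[mu]_(x in D) F i x.
Proof.
move=> hF; elim: s => [|i s IH].
  rewrite big_nil; under eq_Rintegral do rewrite big_nil.
  by rewrite Rintegral_cst// mul0r.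
rewrite big_cons -IH -RintegralD//; [|exact: hF|exact: L1_sum].
by apply: eq_Int => x _; rewrite big_cons.
Qed.

Lemma Int_eq_ae f g : measurable_fun D f -> measurable_fun D g ->
  aeD (fun x => f x = g x) ->
  \int[mu]_(x in D) f x = \int[mu]_(x in D) g x.
Proof.
move=> mf mg fg; congr fine; apply: ae_eq_integral => //.
- exact/measurable_EFinP.
- exact/measurable_EFinP.
- by apply: aeD_mp fg => x Dx /= ->.
Qed.

Lemma Int_le_ae f g : L1 f -> L1 g -> aeD (fun x => f x <= g x) ->
  \int[mu]_(x in D) f x <= \int[mu]_(x in D) g x.
Proof.
move=> lf lg fg; rewrite -subr_ge0 -RintegralB//.
(* [Rintegral_ge0] wants a sign at every point, so g - f is replaced by its absolute value, equal to
   it almost everywhere. *)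
rewrite (@Int_eq_ae _ (fun x => `|g x - f x|)).
- by apply: Rintegral_ge0.
- exact: L1_measurable (L1B lg lf).
- by apply/L1_measurable/L1_norm/L1B.
- by apply: aeD_mp fg => x Dx fg; rewrite ger0_norm// subr_ge0 fg.
Qed.

Lemma Int_ge0_ae f : L1 f -> aeD (fun x => 0 <= f x) ->
  0 <= \int[mu]_(x in D) f x.
Proof.
move=> lf f0; have := @Int_le_ae (cst 0) f (integrable0 mu D) lf f0.
by rewrite Rintegral_cst// mul0r.
Qed.

Lemma Int_eq0_ae f : L1 f -> aeD (fun x => 0 <= f x) ->
  \int[mu]_(x in D) f x <= 0 -> aeD (fun x => f x = 0).
Proof.
move=> lf f0 i0.
have i1 : \int[mu]_(x in D) `|f x| = 0.
  rewrite -(@Int_eq_ae f).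
  - by apply/eqP; rewrite eq_le i0 Int_ge0_ae.
  - exact: L1_measurable.
  - exact/L1_measurable/L1_norm.
  - by apply: aeD_mp f0 => x Dx fg; rewrite ger0_norm// fg.
have := @EFin_normr_Rintegral _ _ _ mu D (normr \o f) mD (L1_norm lf).
rewrite i1 normr0 => /esym /eqP; rewrite abse_eq0 => /eqP i2.
have /(ae_eq_integral_abs mu mD) : measurable_fun D (EFin \o f).
  by case/integrableP: lf.
move=> [+ _] => /(_ i2); rewrite /aeD; apply: filterS => x + Dx => /(_ Dx) /= [].
by [].
Qed.

Lemma L2_measurable f : L2 f -> measurable_fun D f.
Proof. by case. Qed.

Lemma eq_L2 f g : (forall x, D x -> f x = g x) -> L2 f -> L2 g.
Proof.
move=> fg [mf lf]; split.
  by apply: eq_measurable_fun mf => x /[!inE]; exact: fg.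
by apply: eq_L1 lf => x Dx; rewrite fg.
Qed.

Lemma L2M f g : L2 f -> L2 g -> L1 (fun x => f x * g x).
Proof.
move=> [mf lf] [mg lg]; apply: L1_le (L1D lf lg) _.
  exact: measurable_funM.
apply: aeD_all => x _; rewrite normrM.
rewrite -[f x ^+ 2]real_normK ?num_real// -[g x ^+ 2]real_normK ?num_real//.
have := sqr_ge0 (`|f x| - `|g x|); have := mulr_ge0 (normr_ge0 (f x)) (normr_ge0 (g x)).
nra.
Qed.

Lemma L2Z c f : L2 f -> L2 (fun x => c * f x).
Proof.
move=> [mf lf]; split; first exact: measurable_funM.
by apply: eq_L1 (L1Z (c ^+ 2) lf) => x _; rewrite exprMn.
Qed.

Lemma L2N f : L2 f -> L2 (fun x => - f x).
Proof. by move=> /(L2Z (-1)); apply: eq_L2 => x _; rewrite mulN1r. Qed.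

Lemma L2D f g : L2 f -> L2 g -> L2 (fun x => f x + g x).
Proof.
move=> l2f l2g; have lfg := L2M l2f l2g; case: l2f l2g => mf lf [mg lg].
split; first exact: measurable_funD.
by apply: eq_L1 (L1D (L1D lf (L1Z 2 lfg)) lg) => x _; ring.
Qed.

Lemma L2B f g : L2 f -> L2 g -> L2 (fun x => f x - g x).
Proof. by move=> lf lg; apply: L2D => //; exact: L2N. Qed.

Lemma L2_0 : L2 (fun=> 0).
Proof.
split; first exact: measurable_cst.
by under eq_fun do rewrite expr0n; exact: (integrable0 mu D).
Qed.

Lemma L2_sum (I : Type) (s : seq I) (F : I -> T -> R) :
  (forall i, L2 (F i)) -> L2 (fun x => \sum_(i <- s) F i x).
Proof.
move=> hF; elim: s => [|i s IH].
  under eq_fun do rewrite big_nil; exact: L2_0.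
under eq_fun do rewrite big_cons; exact: L2D.
Qed.

Lemma L2_le f g : measurable_fun D f -> L2 g ->
  aeD (fun x => `|f x| <= `|g x|) -> L2 f.
Proof.
move=> mf [mg lg] fg; split=> //; apply: L1_le lg _.
  exact: measurable_funX.
apply: aeD_mp fg => x Dx fg; rewrite normrX -[g x ^+ 2]real_normK ?num_real//.
by rewrite ler_pXn2r ?nnegrE.
Qed.

Lemma L2_norm f : L2 f -> L2 (fun x => `|f x|).
Proof.
move=> lf; apply: L2_le (lf) _ => //.
  by apply: measurableT_comp => //; exact: L2_measurable.
by apply: aeD_all => x _; rewrite normr_id.
Qed.

Lemma L2_bddM c f g : measurable_fun D f -> aeD (fun x => `|f x| <= c) ->
  L2 g -> L2 (fun x => f x * g x).
Proof.
move=> mf fc lg; apply: (@L2_le _ (fun x => c * g x)); first by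
  apply: measurable_funM => //; exact: L2_measurable.
  exact: L2Z.
apply: aeD_mp fc => x Dx fc; rewrite !normrM ler_wpM2r//.
by rewrite (le_trans fc)// ler_norm.
Qed.

Lemma L1_bddM c f g : measurable_fun D f -> aeD (fun x => `|f x| <= c) ->
  L1 g -> L1 (fun x => f x * g x).
Proof.
move=> mf fc lg; apply: (@L1_le _ (fun x => c * `|g x|)).
  by apply: measurable_funM => //; exact: L1_measurable.
  exact/L1Z/L1_norm.
apply: aeD_mp fc => x Dx fc; rewrite normrM ler_wpM2r//.
Qed.

Lemma ipC f g : ip f g = ip g f.
Proof. by apply: eq_Int => x _; rewrite mulrC. Qed.

Lemma ipDl f1 f2 g : L2 f1 -> L2 f2 -> L2 g ->
  ip (fun x => f1 x + f2 x) g = ip f1 g + ip f2 g.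
Proof.
move=> l1 l2 lg; rewrite /ip -RintegralD//; try exact: L2M.
by apply: eq_Int => x _; rewrite mulrDl.
Qed.

Lemma ipZl c f g : L2 f -> L2 g -> ip (fun x => c * f x) g = c * ip f g.
Proof.
move=> lf lg; rewrite /ip -RintegralZl//; last exact: L2M.
by apply: eq_Int => x _; rewrite mulrA.
Qed.

Lemma ipNl f g : L2 f -> L2 g -> ip (fun x => - f x) g = - ip f g.
Proof.
move=> lf lg; rewrite -mulN1r -ipZl//.
by apply: eq_Int => x _; rewrite mulN1r.
Qed.

Lemma ipBl f1 f2 g : L2 f1 -> L2 f2 -> L2 g ->
  ip (fun x => f1 x - f2 x) g = ip f1 g - ip f2 g.
Proof. by move=> l1 l2 lg; rewrite ipDl ?ipNl//; exact: L2N. Qed.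

Lemma ipDr f g1 g2 : L2 f -> L2 g1 -> L2 g2 ->
  ip f (fun x => g1 x + g2 x) = ip f g1 + ip f g2.
Proof. by move=> lf l1 l2; rewrite ipC ipDl// !(ipC _ f). Qed.

Lemma ipBr f g1 g2 : L2 f -> L2 g1 -> L2 g2 ->
  ip f (fun x => g1 x - g2 x) = ip f g1 - ip f g2.
Proof. by move=> lf l1 l2; rewrite ipC ipBl// !(ipC _ f). Qed.

Lemma ipZr c f g : L2 f -> L2 g -> ip f (fun x => c * g x) = c * ip f g.
Proof. by move=> lf lg; rewrite ipC ipZl// ipC. Qed.

Lemma ip_suml (I : Type) (s : seq I) (F : I -> T -> R) g :
  (forall i, L2 (F i)) -> L2 g ->
  ip (fun x => \sum_(i <- s) F i x) g = \sum_(i <- s) ip (F i) g.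
Proof.
move=> hF lg; rewrite /ip -Int_sum//; last by move=> i; exact: L2M.
by apply: eq_Int => x _; rewrite mulr_suml.
Qed.

Lemma ip_ge0 f : 0 <= ip f f.
Proof. by apply: Rintegral_ge0 => x _; rewrite -expr2 sqr_ge0. Qed.

Lemma n2_ge0 f : 0 <= n2 f. Proof. exact: sqrtr_ge0. Qed.

Lemma n2_sq f : n2 f ^+ 2 = ip f f.
Proof. by rewrite sqr_sqrtr// ip_ge0. Qed.

Lemma eq_n2 f g : (forall x, D x -> f x = g x) -> n2 f = n2 g.
Proof. by move=> fg; congr Num.sqrt; apply: eq_Int => x Dx; rewrite fg. Qed.

Lemma n2_eq_ae f g : measurable_fun D f -> measurable_fun D g ->
  aeD (fun x => f x = g x) -> n2 f = n2 g.
Proof.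
move=> mf mg fg; congr Num.sqrt; apply: Int_eq_ae.
- exact: measurable_funM.
- exact: measurable_funM.
- by apply: aeD_mp fg => x _ ->.
Qed.

Lemma n2_le f g : L2 f -> L2 g -> aeD (fun x => `|f x| <= `|g x|) ->
  n2 f <= n2 g.
Proof.
move=> lf lg fg; rewrite ler_wsqrtr// /ip.
apply: Int_le_ae; [exact: L2M|exact: L2M|].
apply: aeD_mp fg => x Dx fg; rewrite -!expr2 -[f x ^+ 2]real_normK ?num_real//.
by rewrite -[g x ^+ 2]real_normK ?num_real// ler_pXn2r ?nnegrE.
Qed.

Lemma n2Z c f : L2 f -> n2 (fun x => c * f x) = `|c| * n2 f.
Proof.
move=> lf; rewrite /n2 ipZl// ?ipZr//; last exact: L2Z.
by rewrite mulrA -expr2 sqrtrM ?sqr_ge0// sqrtr_sqr.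
Qed.

Lemma n2N f : n2 (fun x => - f x) = n2 f.
Proof. by congr Num.sqrt; apply: eq_Int => x _; rewrite mulrNN. Qed.

Lemma n2_abs f : n2 (fun x => `|f x|) = n2 f.
Proof.
by congr Num.sqrt; apply: eq_Int => x _; rewrite -!expr2 real_normK ?num_real.
Qed.

Lemma n2_eq0 f : L2 f -> n2 f = 0 -> aeD (fun x => f x = 0).
Proof.
move=> lf f0; have i0 : ip f f = 0 by rewrite -n2_sq f0 expr0n.
have : aeD (fun x => f x * f x = 0).
  apply: Int_eq0_ae; first exact: L2M.
  - by apply: aeD_all => x _; rewrite -expr2 sqr_ge0.
  - by move: i0; rewrite /ip => ->.
by apply: aeD_mp => x _ /eqP; rewrite mulf_eq0 orbb => /eqP.
Qed.

Lemma ip_CS f g : L2 f -> L2 g -> `|ip f g| <= n2 f * n2 g.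
Proof.
move=> lf lg.
(* The quadratic t |-> |f - t g|^2 is nonnegative; it is used at its minimum (f, g) / (g, g). *)
have key t : 0 <= ip f f - 2 * t * ip f g + t ^+ 2 * ip g g.
  have := ip_ge0 (fun x => f x - t * g x).
  have lt := L2Z t lg; have lb := L2B lf lt.
  rewrite ipBl// !ipBr// !ipZl// !ipZr// (ipC g f).
  by congr (_ <= _); ring.
rewrite -(@ler_pXn2r _ 2) ?nnegrE// ?mulr_ge0 ?n2_ge0//.
rewrite real_normK ?num_real// exprMn !n2_sq.
have [g0|g0] := ltP 0 (ip g g).
  have h := key (ip f g / ip g g); rewrite -subr_ge0.
  have -> : ip f f * ip g g - ip f g ^+ 2 =
    (ip f f - 2 * (ip f g / ip g g) * ip f g + (ip f g / ip g g) ^+ 2 * ip g g) * ip g g.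
    by field; rewrite gt_eqF.
  by apply: mulr_ge0 h _; exact: ltW.
(* Degenerate case: g vanishes almost everywhere, hence (f, g) = 0. *)
have g1 : ip g g = 0 by apply/eqP; rewrite eq_le g0 ip_ge0.
have : aeD (fun x => g x = 0) by apply: n2_eq0 => //; rewrite /n2 g1 sqrtr0.
move=> gae; have -> : ip f g = 0.
  rewrite -[RHS](_ : \int[mu]_(x in D) (cst 0 x : R) = 0); last first.
    by rewrite Rintegral_cst// mul0r.
  apply: Int_eq_ae.
  - by apply: measurable_funM; exact: L2_measurable.
  - exact: measurable_cst.
  - by apply: aeD_mp gae => x _ ->; rewrite mulr0.
by rewrite expr0n/= g1 mulr0.
Qed.

Lemma n2D f g : L2 f -> L2 g -> n2 (fun x => f x + g x) <= n2 f + n2 g.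
Proof.
move=> lf lg; rewrite -(@ler_pXn2r _ 2) ?nnegrE// ?addr_ge0 ?n2_ge0//.
have lfg := L2D lf lg.
rewrite n2_sq ipDl// !ipDr// (ipC g f) sqrrD !n2_sq.
have := ler_norm (ip f g); have := ip_CS lf lg; lra.
Qed.

Lemma n2B f g : L2 f -> L2 g -> n2 (fun x => f x - g x) <= n2 f + n2 g.
Proof. by move=> lf lg; rewrite -(n2N g); apply: n2D => //; exact: L2N. Qed.

Lemma n2_bddM c f g : 0 <= c -> measurable_fun D f ->
  aeD (fun x => `|f x| <= c) -> L2 g -> n2 (fun x => f x * g x) <= c * n2 g.
Proof.
move=> c0 mf fc lg; rewrite -[X in X * _](ger0_norm c0) -n2Z//.
apply: n2_le; [exact: (L2_bddM mf fc)|exact: L2Z|].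
by apply: aeD_mp fc => x Dx fc; rewrite !normrM ler_wpM2r// (le_trans fc)// ler_norm.
Qed.

Lemma n2_0 : n2 (fun=> 0) = 0.
Proof.
rewrite /n2 /ip; under eq_Rintegral do rewrite mulr0.
by rewrite Rintegral_cst// mul0r sqrtr0.
Qed.

Section finite.
Hypothesis Dfin : (mu D < +oo)%E.

Lemma L1_cst c : L1 (fun=> c).
Proof.
apply/integrableP; split; first exact: measurable_cst.
rewrite integral_cst//= lte_mul_pinfty//.
Qed.

Lemma L2_cst c : L2 (fun=> c).
Proof. by split; [exact: measurable_cst|exact: L1_cst]. Qed.

Lemma L2_bdd c f : measurable_fun D f -> aeD (fun x => `|f x| <= c) -> L2 f.
Proof.
move=> mf fc; apply: (@L2_le _ (fun=> c)) => //; first exact: L2_cst.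
by apply: aeD_mp fc => x Dx fc; rewrite (le_trans fc)// ler_norm.
Qed.

Lemma L2_L1 f : L2 f -> L1 f.
Proof.
by move=> lf; apply: eq_L1 (L2M lf (L2_cst 1)) => x _; rewrite mulr1.
Qed.

Lemma Int_norm_le f : L2 f ->
  \int[mu]_(x in D) `|f x| <= Num.sqrt (fine (mu D)) * n2 f.
Proof.
move=> lf; have la := L2_norm lf; have := ip_CS (L2_cst 1) la.
rewrite n2_abs {1}/ip; under eq_Rintegral do rewrite mul1r.
move=> h; apply: le_trans (ler_norm _) _; apply: (le_trans h).
by rewrite ler_wpM2r ?n2_ge0// {1}/n2 /ip mulr1 Rintegral_cst// mul1r.
Qed.

End finite.

End square_integrable.

(** * Borel sets and Lebesgue measure of R^n *)

Section rV_measure.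
Context (R : realType) (n : nat).
Local Notation mu := (lebesgue_rV R n).
Implicit Types (a b x h : 'rV[R]_n) (A D U : set 'rV[R]_n).

(** Half-open boxes form a pi-system that generates the Borel sets, and [lebesgue_rV_box] computes
    exactly their measure. *)
Definition box a b : set 'rV[R]_n :=
  [set x | forall i, a ord0 i < x ord0 i <= b ord0 i].

Lemma box_setI a b a' b' : box a b `&` box a' b' =
  box (\row_i Num.max (a ord0 i) (a' ord0 i))
      (\row_i Num.min (b ord0 i) (b' ord0 i)).
Proof.
apply/seteqP; split => x /=.
  move=> [h h'] i; rewrite !mxE gt_max le_min.
  by move: (h i) (h' i) => /andP[-> ->] /andP[-> ->].
move=> h; split => i; move: (h i); rewrite !mxE gt_max le_min.
  by move=> /andP[/andP[-> _] /andP[-> _]].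
by move=> /andP[/andP[_ ->] /andP[_ ->]].
Qed.

Lemma box_bigcap a b : box a b = \bigcap_(i in [set: 'I_n])
  ((fun x : 'rV[R]_n => x ord0 i) @^-1` `]a ord0 i, b ord0 i]).
Proof.
by apply/seteqP; split => x /= h i; have := h i; rewrite /= in_itv//= => /(_ I).
Qed.

Lemma measurable_box a b : measurable (box a b).
Proof.
rewrite box_bigcap; apply: fin_bigcap_measurable => // i _.
by rewrite -[X in measurable X]setTI; exact: measurable_coord.
Qed.

Lemma rV_norm_le x (e : R) : 0 <= e -> (`|x| <= e) <-> (forall i, `|x ord0 i| <= e).
Proof.
move=> e0; rewrite {1}/normr/= mx_normrE; split => [/bigmax_leP[_ h] i|h].
  exact: (h (ord0, i)).
by apply/bigmax_leP; split=> // -[i j] _ /=; rewrite ord1.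
Qed.

Lemma rV_norm_lt x (e : R) : 0 < e -> (`|x| < e) <-> (forall i, `|x ord0 i| < e).
Proof.
move=> e0; rewrite {1}/normr/= mx_normrE; split => [/bigmax_ltP[_ h] i|h].
  exact: (h (ord0, i)).
by apply/bigmax_ltP; split=> // -[i j] _ /=; rewrite ord1.
Qed.

Lemma rV_coord_le x i : `|x ord0 i| <= `|x|.
Proof. by have /(rV_norm_le x (normr_ge0 x)) := lexx `|x|. Qed.

Let ratv (p : 'rV[rat]_n) : 'rV[R]_n := map_mx ratr p.

(** Boxes with rational corners, indexed by a countable type. The margin e leaves room inside U for
    smooth functions that approximate the indicator of the box. *)
Lemma open_bigcup_box U : open U ->
  exists F : ('rV[rat]_n * 'rV[rat]_n) -> set 'rV[R]_n,
    [/\ U = \bigcup_p F p, forall p, F p `<=` U &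
        forall p, F p = set0 \/ exists a b e, [/\ F p = box a b, 0 < e &
         forall x, (forall i, a ord0 i - e < x ord0 i < b ord0 i + e) -> U x]].
Proof.
move=> oU.
pose P (p : 'rV[rat]_n * 'rV[rat]_n) := exists2 e, 0 < e &
  forall x, (forall i, ratv p.1 ord0 i - e < x ord0 i < ratv p.2 ord0 i + e) -> U x.
pose F (p : 'rV[rat]_n * 'rV[rat]_n) :=
  if `[< P p >] then box (ratv p.1) (ratv p.2) else set0.
have FU p : F p `<=` U.
  rewrite /F; case: asboolP => [[e e0 h] x xb|_ x []]; apply: h => i.
  move: (xb i) => /andP[h1 h2]; apply/andP; split.
    by rewrite (lt_trans _ h1)// gtrDl oppr_lt0.
  by rewrite (le_lt_trans h2)// ltrDl.
exists F; split => //; last first.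
  move=> p; rewrite /F; case: asboolP => [[e e0 h]|_]; last by left.
  by right; exists (ratv p.1), (ratv p.2), e.
apply/seteqP; split => [x Ux|x [p _]]; last exact: FU.
have /nbhs_ballP[e /= e0 xe] : nbhs x U by exact: open_nbhs_nbhs.
have e20 : 0 < e / 2 by rewrite divr_gt0.
have /all_sig[a ha] (i : 'I_n) : {q : rat | (x ord0 i - e / 2 < ratr q < x ord0 i)}.
  have := @rat_in_itvoo R (x ord0 i - e / 2) (x ord0 i).
  rewrite gtrBl => /(_ e20) /cid[q]; rewrite in_itv/= => h; exists q.
  exact: h.
have /all_sig[b hb] (i : 'I_n) : {q : rat | (x ord0 i < ratr q < x ord0 i + e / 2)}.
  have := @rat_in_itvoo R (x ord0 i) (x ord0 i + e / 2).
  rewrite ltrDl => /(_ e20) /cid[q]; rewrite in_itv/= => h; exists q.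
  exact: h.
exists (\row_i a i, \row_i b i) => //=.
rewrite /F; case: asboolP => [_ i|].
  by rewrite !mxE/=; move: (ha i) (hb i) => /andP[_ ->] /andP[/ltW ->].
case; exists (e / 2) => // y hy; apply: xe.
rewrite -ball_normE/=; apply/rV_norm_lt => // i; rewrite !mxE.
move: (hy i) (ha i) (hb i); rewrite !mxE/= ltr_norml => /andP[h1 h2] /andP[h3 h4] /andP[h5 h6].
by apply/andP; split; lra.
Qed.

Lemma open_measurable_rV U : open U -> measurable U.
Proof.
move=> /open_bigcup_box[F [-> _ hF]].
apply: countable_bigcupT_measurable => [|p]; first exact: countableP.
by have [->|[a [b [e [-> _ _]]]]] := hF p => //; exact: measurable_box.
Qed.

Lemma open_continuous_measurable_rV D (f : 'rV[R]_n -> R) : open D ->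
  {in D, continuous f} -> measurable_fun D f.
Proof.
move=> oD cf; apply: (measurability _ (RGenOpens.measurableE R)).
move=> /= _ [_ [a [b ->]] <-]; apply: open_measurable_rV.
rewrite openE => x [Dx fx]; apply: filterI; first exact: open_nbhs_nbhs.
by apply: (cf x); [rewrite inE|apply: open_nbhs_nbhs; split => //; exact: interval_open].
Qed.

Lemma continuous_measurable_rV (f : 'rV[R]_n -> R) : continuous f ->
  measurable_fun setT f.
Proof.
by move=> cf; apply: open_continuous_measurable_rV => [|x _]; [exact: openT|exact: cf].
Qed.

Lemma box_set0 a b : ~ (forall i, a ord0 i <= b ord0 i) -> box a b = set0.
Proof.
move=> /existsNP[i /negP ab]; apply/seteqP; split => // x /(_ i) /andP[h1 h2].
by move: ab; rewrite -ltNge ltNge (le_trans (ltW h1)).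
Qed.

Lemma lebesgue_rV_box_lty a b : (mu (box a b) < +oo)%E.
Proof.
have [ab|/box_set0 ->] := pselect (forall i, a ord0 i <= b ord0 i).
  by have := lebesgue_rV_box ab; rewrite -/(box a b) => ->; rewrite ltry.
by rewrite measure0.
Qed.

Let G := [set B | exists a b, B = box a b].

Let cube (k : nat) := box (const_mx (- k%:R)) (const_mx k%:R).

Let cube_cover : \bigcup_k cube k = setT.
Proof.
apply/seteqP; split => // x _.
exists (Num.truncn `|x|).+1 => // i; rewrite !mxE.
have := rV_coord_le x i; have := truncnS_gt `|x|.
move=> h1 h2; have := le_lt_trans h2 h1; rewrite ltr_norml => /andP[-> /ltW].
by [].
Qed.

Lemma rV_measurableE : @measurable _ 'rV[R]_n = <<s G>>.
Proof.
apply/seteqP; split; last first.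
  apply: smallest_sub; first exact: sigma_algebra_measurable.
  by move=> _ [a [b ->]]; exact: measurable_box.
pose T' := g_sigma_algebraType G.
have mc i : measurable_fun [set: T'] (fun x : T' => (x : 'rV[R]_n) ord0 i : R).
  apply: (measurability _ (RGenOInfty.measurableE R)).
  move=> /= _ [_ [r ->] <-]; rewrite setTI.
  rewrite (_ : _ @^-1` _ = \bigcup_k box
     (\row_j (if j == i then r else - k%:R)) (const_mx k%:R)).
    by apply: bigcupT_measurable => k; apply: sub_sigma_algebra; eexists; eexists.
  apply/seteqP; split => x /=; rewrite in_itv/= andbT.
    move=> rx; exists (Num.truncn `|x : 'rV[R]_n|).+1 => // j; rewrite !mxE.
    have := rV_coord_le x j; have := truncnS_gt `|x : 'rV[R]_n|.
    move=> h1 h2; have := le_lt_trans h2 h1; rewrite ltr_norml => /andP[h3 /ltW ->].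
    by rewrite andbT; case: ifPn => // /eqP ->.
  by move=> [k _ /(_ i)]; rewrite !mxE eqxx => /andP[].
apply: smallest_sub; first exact: smallest_sigma_algebra.
elim/big_ind : _ => //.
- by move=> A B hA hB C [/hA|/hB].
- by move=> i _ _ [Y mY <-]; rewrite setTI -[X in <<s G>> X]setTI; exact: mc.
Qed.

(** Uniqueness on a pi-system, with the growing cubes as an exhaustion of finite measure. *)
Lemma rV_measure_unique (m1 m2 : {measure set 'rV[R]_n -> \bar R}) :
  (forall a b, m1 (box a b) = m2 (box a b)) ->
  (forall a b, (m1 (box a b) < +oo)%E) ->
  forall A, measurable A -> m1 A = m2 A.
Proof.
move=> m12 m1oo A; rewrite rV_measurableE => mA.
apply: (@g_sigma_algebra_measure_unique _ _ _ G _ cube) => //.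
- by move=> _ [a [b ->]]; exact: measurable_box.
- by move=> k; eexists; eexists.
- by move=> _ _ [a [b ->]] [a' [b' ->]]; rewrite box_setI; eexists; eexists.
- by move=> _ [a [b ->]].
- by move=> k; exact: m1oo.
Qed.

Lemma bounded_set_box A : bounded_set A -> exists r : R, A `<=` box (const_mx (- r)) (const_mx r).
Proof.
move=> [M [_ /(_ (`|M| + 1))]]; rewrite (le_lt_trans (ler_norm M)) ?ltrDl//.
move=> /(_ isT) h; exists (`|M| + 2) => x Ax i; rewrite !mxE.
have := le_trans (rV_coord_le x i) (h x Ax); rewrite ler_norml => /andP[h1 h2].
by apply/andP; split; lra.
Qed.

Lemma bounded_set_lty A : measurable A -> bounded_set A -> (mu A < +oo)%E.
Proof.
move=> mA /bounded_set_box[r Ar].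
apply: le_lt_trans (lebesgue_rV_box_lty (const_mx (- r)) (const_mx r)).
by apply: le_measure => //; rewrite inE//; exact: measurable_box.
Qed.

Lemma measurable_shift h : measurable_fun setT (fun x : 'rV[R]_n => x + h).
Proof.
apply: measurable_fun_rV => i; under eq_fun do rewrite mxE.
by apply: measurable_funD; [exact: measurable_coord|exact: measurable_cst].
Qed.

(** The image of the measure under the translation agrees with it on boxes, whose side lengths do
    not change. *)
Lemma lebesgue_rV_shift h A : measurable A ->
  mu ((fun x => x + h) @^-1` A) = mu A.
Proof.
move=> mA; pose nu : {measure set 'rV[R]_n -> \bar R} :=
  measure_function_pushforward__canonical__measure_function_Measure mu (measurable_shift h).
have nubox a b : nu (box a b) = mu (box a b).
  have e : nu (box a b) = mu (box (a - h) (b - h)).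
    congr (mu _); apply/seteqP; split => x /= hx i; have := hx i; rewrite !mxE.
      by rewrite ltrBlDr lerBrDr.
    by rewrite ltrBlDr lerBrDr.
  rewrite e; have [ab|ab] := pselect (forall i, a ord0 i <= b ord0 i).
    have := lebesgue_rV_box ab; rewrite -/(box a b) => ->.
    have abh : forall i, (a - h) ord0 i <= (b - h) ord0 i.
      by move=> i; rewrite !mxE lerD2r.
    have := lebesgue_rV_box abh; rewrite -/(box (a - h) (b - h)) => ->.
    by congr EFin; apply: eq_bigr => i _; rewrite !mxE; ring.
  rewrite !box_set0 ?measure0// => abh; apply: ab => i.
  by have := abh i; rewrite !mxE lerD2r.
transitivity (nu A); first by [].
apply: rV_measure_unique => // a b.
rewrite nubox; exact: lebesgue_rV_box_lty.
Qed.

Lemma ge0_integral_shift h (f : 'rV[R]_n -> \bar R) :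
  measurable_fun setT f -> (forall x, 0 <= f x)%E ->
  (\int[mu]_x f (x + h)%R = \int[mu]_x f x)%E.
Proof.
move=> mf f0; have := @ge0_integral_pushforward _ _ _ _ _ _ (measurable_shift h) mu setT f measurableT mf (fun x _ => f0 x).
move=> <-. apply: eq_measure_integral => [|mT A mA _]; first exact: measurable_shift.
exact: (lebesgue_rV_shift h mA).
Qed.

Lemma integrable_shift h (f : 'rV[R]_n -> R) :
  mu.-integrable setT (EFin \o f) -> mu.-integrable setT (EFin \o (fun x => f (x + h))).
Proof.
move=> /integrableP[mf foo]; apply/integrableP; split.
  exact: (measurableT_comp mf (measurable_shift h)).
by rewrite (@ge0_integral_shift h (fun x => `|(f x)%:E|%E))//; exact: measurableT_comp.
Qed.

Lemma Rintegral_shift h (f : 'rV[R]_n -> R) : mu.-integrable setT (EFin \o f) ->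
  \int[mu]_x f (x + h) = \int[mu]_x f x.
Proof.
move=> intf; congr fine.
have /integrableP[mf _] := intf.
have := @integral_pushforward _ _ _ _ _ _ (measurable_shift h) mu setT (EFin \o f) mf (integrable_shift h intf) measurableT.
move=> <-; apply: eq_measure_integral => [|mT A mA _]; first exact: measurable_shift.
exact: (lebesgue_rV_shift h mA).
Qed.

End rV_measure.

(** * Smooth test functions *)

Section flat_exponential.
Context (R : realType).
Implicit Types (m k : nat) (s t : R).

(** For s > 0 this is s^(-m) exp(-1/s). The derivatives of exp(-1/s) are combinations of such
    functions, so the family is closed under differentiation, with one formula that also holds at
    0. *)
Definition flat m s : R := if 0 < s then s^-1 ^+ m * expR (- s^-1) else 0.

Lemma flat_ge0 m s : 0 <= flat m s.
Proof.
by rewrite /flat; case: ifPn => // s0; rewrite mulr_ge0 ?expR_ge0// exprn_ge0// invr_ge0 ltW.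
Qed.

Lemma flat0 m s : s <= 0 -> flat m s = 0.
Proof. by move=> s0; rewrite /flat ltNge s0. Qed.

Lemma flat_gt0 m s : 0 < s -> 0 < flat m s.
Proof.
by move=> s0; rewrite /flat s0 mulr_gt0 ?expR_gt0// exprn_gt0// invr_gt0.
Qed.

Lemma expn_fact_expR k t : 0 <= t -> t ^+ k <= k`!%:R * expR t.
Proof.
move=> t0; case: k => [|k]; first by rewrite expr0 fact0 mul1r -expR0 ler_expR.
have := expR_ge1Dxn k t0; rewrite -ler_pdivrMl ?ltr0n ?fact_gt0// mulrC.
by apply: le_trans; rewrite lerDr.
Qed.

Lemma flat_le m s : flat m s <= m`!%:R.
Proof.
rewrite /flat; case: ifPn => // s0; rewrite expRN ler_pdivrMr ?expR_gt0//.
by apply: expn_fact_expR; rewrite invr_ge0 ltW.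
Qed.

Lemma flatS m s : flat m s = s * flat m.+1 s.
Proof.
rewrite /flat; case: ifPn => s0; last by rewrite mulr0.
by rewrite exprS -!mulrA mulVKf// gt_eqF.
Qed.

Lemma gt_nbhs0 s : 0 < s -> \forall t \near s, 0 < t.
Proof. by move=> s0; apply: open_nbhs_nbhs; split; [exact: open_gt|]. Qed.

Lemma is_derive_flat m s :
  is_derive s 1 (flat m) (flat m.+2 s - m%:R * flat m.+1 s).
Proof.
have [s0|s0|->] := ltrgtP s 0.
- rewrite !flat0 ?ltW// mulr0 subr0.
  apply: (@near_eq_is_derive _ _ _ (cst 0)).
  by near=> t; rewrite flat0//; apply/ltW; near: t; exact: lt_nbhsl.
- have sN0 : s != 0 by rewrite gt_eqF.
  apply: (@near_eq_is_derive _ _ _ (fun t => t^-1 ^+ m * expR (- t^-1))).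
    by near=> t; rewrite /flat ifT//; near: t; exact: gt_nbhs0.
  have dV : is_derive s 1 (fun t : R => t^-1) (- (s^-1 ^+ 2)).
    by have := @is_deriveV _ id s 1 1 sN0 (is_derive_id _ _); rewrite /= /GRing.scale/= mulr1 exprVn.
  have dN : is_derive s 1 (fun t : R => - t^-1) (s^-1 ^+ 2).
    by have := @is_deriveN _ _ _ _ _ _ _ dV; rewrite opprK.
  have dE := @is_derive1_comp _ expR (fun t : R => - t^-1) s _ _ (is_derive_expR _) dN.
  have dP := @is_deriveX _ _ _ m _ _ _ dV.
  have := @is_deriveM _ _ _ _ _ _ _ _ dP dE.
  rewrite [X in is_derive _ _ X](_ : _ = fun t => t^-1 ^+ m * expR (- t^-1)); last first.
    by apply/funext => t; rewrite /= !fctE/=.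
  move=> h; apply: is_derive_eq; rewrite /flat s0 /GRing.scale/=.
  rewrite (_ : ([eta GRing.inv] ^+ m) s = s^-1 ^+ m) ?fctE//.
  by case: m {dP h} => [|m] /=; rewrite ?mulr0n !exprS ?expr0; ring.
- rewrite !flat0// mulr0 subr0.
  (* At 0 the difference quotient is [flat m.+1 h], that is [h * flat m.+2 h], at most |h| (m + 2)!
     in absolute value. *)
  have key : (h^-1 *: ((flat m \o shift 0) (h *: 1) - flat m 0)) @[h --> 0^'] --> (0 : R).
    apply/cvgr0Pnorm_le => e e0.
    have c0 : 0 < (m.+2)`!%:R :> R by rewrite ltr0n fact_gt0.
    near=> h.
    rewrite /= addr0 [flat m 0]flat0// subr0 /GRing.scale/= mulr1.
    have hN0 : h != 0 by near: h; exact: nbhs_dnbhs_neq.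
    have he : `|h| <= e / (m.+2)`!%:R.
      near: h; apply: dnbhs0_le; exact: divr_gt0.
    rewrite flatS mulKf// flatS normrM (ger0_norm (flat_ge0 _ _)).
    apply: le_trans (ler_wpM2l (normr_ge0 _) (flat_le _ _)) _.
    by rewrite -ler_pdivlMr.
  apply: DeriveDef; first by apply/cvg_ex; exists 0.
  by rewrite /derive; exact: cvg_lim.
Unshelve. all: by end_near. Qed.

End flat_exponential.
Section smooth_functions.
Context (R : realType) (n : nat).
Local Notation fct := ('rV[R]_n -> R).
Implicit Types (f g phi psi : fct) (i : 'I_n).

Lemma is_derive_line (V : normedModType R) (f : V -> R) (x v : V) (df : R) :
  is_derive x v f df <-> is_derive (0 : R) 1 (fun t : R => f (t *: v + x)) df.
Proof.
have e : (fun h : R => h^-1 *: ((f \o shift x) (h *: v) - f x)) =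
   (fun h : R => h^-1 *: (((fun t : R => f (t *: v + x)) \o shift 0) (h *: 1) -
     (fun t : R => f (t *: v + x)) 0)).
  by apply/funext => h; rewrite /= addr0 scale0r add0r /GRing.scale/= mulr1.
split=> -[df1 df2]; apply: DeriveDef.
- by rewrite /derivable -e.
- by rewrite /derive -e.
- by rewrite /derivable e.
- by rewrite /derive e.
Qed.

Lemma is_derive_comp (V : normedModType R) (g : R -> R) (f : V -> R) (x v : V)
    (dg df : R) :
  is_derive (f x) 1 g dg -> is_derive x v f df ->
  is_derive x v (fun y => g (f y)) (dg * df).
Proof.
move=> hg /is_derive_line hf; apply/is_derive_line.
apply: (@is_derive1_comp _ g (fun t : R => f (t *: v + x))) => //.
by rewrite scale0r add0r.
Qed.

(* closed under partial derivatives, hence contained in the smooth functions *)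
Inductive smooth_alg : fct -> Prop :=
| smooth_alg_cst (c : R) : smooth_alg (fun=> c)
| smooth_alg_coord i : smooth_alg (fun x => x ord0 i)
| smooth_alg_base phi : smooth phi -> smooth_alg phi
| smooth_alg_flat m f : smooth_alg f -> smooth_alg (fun x => flat m (f x))
| smooth_algD f g : smooth_alg f -> smooth_alg g -> smooth_alg (fun x => f x + g x)
| smooth_algM f g : smooth_alg f -> smooth_alg g -> smooth_alg (fun x => f x * g x).

Lemma flat_continuous m : continuous (@flat R m).
Proof.
move=> s; have [d _] := is_derive_flat m s.
by apply: differentiable_continuous; apply/derivable1_diffP.
Qed.

Lemma smooth_partial phi i : smooth phi -> smooth (partial i phi).
Proof. by move=> sphi s x; have := sphi (rcons s i) x; rewrite foldr_rcons. Qed.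

Lemma is_derive_coord (x : 'rV[R]_n) i j :
  is_derive x (delta_mx ord0 i) (fun y : 'rV[R]_n => y ord0 j) ((i == j)%:R : R).
Proof.
apply/is_derive_line; rewrite (_ : (fun t : R => _) =
  (fun t : R => (i == j)%:R * t + x ord0 j)); last first.
  by apply/funext => t; rewrite !mxE eqxx/= eq_sym mulrC.
have h : is_derive (0 : R) (1 : R) (( *:%R (i == j)%:R : R -> R) + cst (x ord0 j)) ((i == j)%:R *: 1 + 0).
  exact: is_deriveD.
by move: h; rewrite addr0 /GRing.scale/= mulr1.
Qed.

Lemma smooth_algP f : smooth_alg f -> continuous f /\
  forall i, exists2 g, smooth_alg g & forall x, is_derive x (delta_mx ord0 i) f (g x).
Proof.
elim=> {f}.
- move=> c; split=> [x|i]; first exact: cst_continuous.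
  by exists (fun=> 0); [exact: smooth_alg_cst|move=> x; exact: is_derive_cst].
- move=> i; split=> [x|j]; first exact: coord_continuous.
  exists (fun=> (j == i)%:R); first exact: smooth_alg_cst.
  by move=> x; exact: is_derive_coord.
- move=> phi sphi; split=> [x|i]; first by have [] := sphi [::] x.
  exists (partial i phi); first exact/smooth_alg_base/smooth_partial.
  by move=> x; apply: derivableP; have [_] := sphi [::] x.
- move=> m f sf [cf df]; split=> [x|i].
    apply: continuous_comp; [exact: cf|exact: flat_continuous].
  have [g sg dg] := df i.
  exists (fun x => (flat m.+2 (f x) + (- m%:R) * flat m.+1 (f x)) * g x).
    apply: smooth_algM => //; apply: smooth_algD; first exact: smooth_alg_flat.
    by apply: smooth_algM; [exact: smooth_alg_cst|exact: smooth_alg_flat].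
  move=> x; rewrite mulNr.
  exact: is_derive_comp (is_derive_flat m (f x)) (dg x).
- move=> f g sf [cf df] sg [cg dg]; split=> [x|i].
    exact: (@cvgD _ _ _ _ _ f g _ _ (cf x) (cg x)).
  have [f' sf' hf'] := df i; have [g' sg' hg'] := dg i.
  exists (fun x => f' x + g' x); first exact: smooth_algD.
  by move=> x; exact: (@is_deriveD _ _ _ _ _ _ _ _ _ (hf' x) (hg' x)).
- move=> f g sf [cf df] sg [cg dg]; split=> [x|i].
    exact: (@cvgM _ _ _ _ f g _ _ (cf x) (cg x)).
  have [f' sf' hf'] := df i; have [g' sg' hg'] := dg i.
  exists (fun x => f x * g' x + g x * f' x).
    by apply: smooth_algD; exact: smooth_algM.
  by move=> x; exact: (@is_deriveM _ _ _ _ _ _ _ _ (hf' x) (hg' x)).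
Qed.

Lemma smooth_alg_partial f i : smooth_alg f -> smooth_alg (partial i f).
Proof.
move=> /smooth_algP[_ /(_ i)[g sg dg]]; suff -> : partial i f = g by [].
by apply/funext => x; have [_] := dg x.
Qed.

Lemma smooth_alg_smooth f : smooth_alg f -> smooth f.
Proof.
move=> sf s x; have : smooth_alg (foldr (@partial R n) f s).
  by elim: s => [//|i s IH] /=; exact: smooth_alg_partial.
move=> /smooth_algP[cg dg]; split; first exact: cg.
by move=> i; have [g _ h] := dg i; have [] := h x.
Qed.

Lemma smooth_continuous phi : smooth phi -> continuous phi.
Proof. by move=> sphi x; have [] := sphi [::] x. Qed.

Lemma smooth_is_derive phi x i : smooth phi ->
  is_derive x (delta_mx ord0 i) phi (partial i phi x).
Proof. by move=> sphi; apply: derivableP; have [_] := sphi [::] x. Qed.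

Section test_functions.
Variable Omega : set 'rV[R]_n.

Lemma test_support_partial phi i K : compact K -> smooth phi ->
  (forall x, ~ K x -> phi x = 0) -> forall x, ~ K x -> partial i phi x = 0.
Proof.
move=> cK sphi phi0 x nKx.
have oK : open (~` K).
  by apply: closed_openC; apply: compact_closed => //; exact: norm_hausdorff.
have : is_derive x (delta_mx ord0 i) phi 0.
  apply: (@near_eq_is_derive _ _ _ (cst 0)).
  by apply: filterS (open_nbhs_nbhs (conj oK nKx)) => y nKy; rewrite phi0.
by move=> [_]; rewrite /partial.
Qed.

Lemma test_partial phi i : test_function Omega phi ->
  test_function Omega (partial i phi).
Proof.
move=> [sphi [K [cK KO phi0]]]; split; first exact: smooth_partial.
by exists K; split=> //; exact: test_support_partial.
Qed.

Lemma test_comb (c : R) phi psi : test_function Omega phi ->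
  test_function Omega psi -> test_function Omega (fun x => c * phi x + psi x).
Proof.
move=> [sphi [K [cK KO phi0]]] [spsi [L [cL LO psi0]]]; split.
  apply: smooth_alg_smooth; apply: smooth_algD; last exact: smooth_alg_base.
  by apply: smooth_algM; [exact: smooth_alg_cst|exact: smooth_alg_base].
exists (K `|` L); split; first exact: compactU.
  by move=> x [/KO|/LO].
move=> x /not_orP[nK nL]; rewrite phi0// psi0// mulr0 addr0//.
Qed.

(** A level k >= 0 makes the truncation vanish wherever phi does, so the compact support is
    preserved. *)
Lemma test_flat phi (k th : R) : 0 <= k -> 0 < th -> test_function Omega phi ->
  test_function Omega (fun x => th * flat 0 ((phi x - k) / th)).
Proof.
move=> k0 th0 [sphi [K [cK KO phi0]]]; split.
  apply: smooth_alg_smooth; apply: smooth_algM; first exact: smooth_alg_cst.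
  apply: smooth_alg_flat; apply: smooth_algM; last exact: smooth_alg_cst.
  by apply: smooth_algD; [exact: smooth_alg_base|exact: smooth_alg_cst].
exists K; split=> // x nKx; rewrite phi0// sub0r flat0 ?mulr0//.
by rewrite mulNr oppr_le0 divr_ge0// ltW.
Qed.

Lemma test_bounded phi : test_function Omega phi ->
  exists2 C : R, 0 < C & forall x, `|phi x| <= C.
Proof.
move=> [sphi [K [cK _ phi0]]].
have : bounded_set (phi @` K).
  apply: compact_bounded; apply: continuous_compact => //.
  by apply: continuous_subspaceT => x; exact: smooth_continuous.
move=> [M [_ /(_ (`|M| + 1))]]; rewrite (le_lt_trans (ler_norm M)) ?ltrDl//.
move=> /(_ isT) h; exists (`|M| + 1); first by rewrite ltr_wpDl.
move=> x; have [Kx|nKx] := pselect (K x); first by apply: h; exists x.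
by rewrite phi0// normr0 addr_ge0.
Qed.

Lemma test_eq0 phi x : test_function Omega phi -> ~ Omega x -> phi x = 0.
Proof. by move=> [_ [K [_ KO phi0]]] nO; apply: phi0 => /KO. Qed.

End test_functions.
End smooth_functions.

(** * Dominated convergence and difference quotients *)

Section dominated.
Context d (T : measurableType d) (R : realType)
  (mu : {measure set T -> \bar R}) (D : set T).
Hypothesis mD : measurable D.

Lemma Int_cvg (f_ : nat -> T -> R) (f G : T -> R) :
  (forall k, measurable_fun D (f_ k)) -> measurable_fun D f ->
  (forall x, D x -> f_ ^~ x @ \oo --> f x) -> L1 mu D G ->
  (forall k x, D x -> `|f_ k x| <= G x) ->
  \int[mu]_(x in D) f_ k x @[k --> \oo] --> \int[mu]_(x in D) f x.
Proof.
move=> mf_ mf cf iG fG.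
have [i1 _ i2] : [/\ mu.-integrable D (EFin \o f),
  [sequence \int[mu]_(x in D) `|(f_ k x)%:E - (f x)%:E|]_k @ \oo --> 0 &
  [sequence \int[mu]_(x in D) (f_ k x)%:E]_k @ \oo --> \int[mu]_(x in D) (f x)%:E]%E.
  apply: (@dominated_convergence _ _ _ mu D mD (fun k => EFin \o f_ k)
    (EFin \o f) (EFin \o G)) => //.
  - by move=> k; exact/measurable_EFinP.
  - exact/measurable_EFinP.
  - by apply: aeW => x Dx; apply: cvg_EFin; [exact: nearW|exact: cf].
  - by apply: aeW => x k Dx; exact: fG.
by apply: fine_cvg; rewrite fineK//; exact: integrable_fin_num.
Qed.

End dominated.

Section bounded_support.
Context (R : realType) (n : nat).
Local Notation mu := (lebesgue_rV R n).
Local Notation fct := ('rV[R]_n -> R).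
Implicit Types (f g phi psi : fct) (i : 'I_n).

Definition cube (r : R) : set 'rV[R]_n := box (const_mx (- r)) (const_mx r).

(** Test functions, extended by zero, belong to this class. It is stable under sums, products and
    translations, and its members are integrable on the whole space, where translation invariance is
    available. *)
Definition bsup f := measurable_fun setT f /\
  exists C r : R, forall x, `|f x| <= C /\ (~ cube r x -> f x = 0).

Lemma bsup_dominates f : bsup f -> exists C r : R,
  forall x, `|f x| <= C * \1_(cube r) x.
Proof.
move=> [mf [C [r h]]]; exists C, r => x; rewrite indicE.
have [h1 h2] := h x; case: (boolP (x \in _)) => [_|]; first by rewrite mulr1.
by rewrite notin_setE => /h2 ->; rewrite normr0 mulr0.
Qed.

Lemma L1_cube (C r : R) : L1 mu setT (fun x => C * \1_(cube r) x).
Proof.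
have mc : measurable (cube r) by exact: measurable_box.
apply: L1Z => //; apply/integrableP; split.
  by apply/measurable_EFinP; exact: measurable_indic.
rewrite (eq_integral (fun x => (\1_(cube r) x)%:E)); last first.
  by move=> x _; rewrite gee0_abs// lee_fin.
by rewrite integral_indic// setIT; exact: lebesgue_rV_box_lty.
Qed.

Lemma bsup_L1 f : bsup f -> L1 mu setT f.
Proof.
move=> /[dup] -[mf _] /bsup_dominates[C [r h]].
apply: L1_le (L1_cube C r) _ => //; exact: aeD_all.
Qed.

Lemma bsupM f g : bsup f -> bsup g -> bsup (fun x => f x * g x).
Proof.
move=> [mf [C [r hf]]] [mg [C' [r' hg]]]; split; first exact: measurable_funM.
exists (C * C'), r => x; have [h1 h2] := hf x; have [h3 h4] := hg x; split.
  by rewrite normrM ler_pM.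
by move=> /h2 ->; rewrite mul0r.
Qed.

Lemma bsupD f g : bsup f -> bsup g -> bsup (fun x => f x + g x).
Proof.
move=> [mf [C [r hf]]] [mg [C' [r' hg]]]; split; first exact: measurable_funD.
exists (C + C'), (Num.max r r') => x.
have [h1 h2] := hf x; have [h3 h4] := hg x; split.
  by rewrite (le_trans (ler_normD _ _))// lerD.
move=> nx; rewrite h2 ?h4 ?addr0// => hx; apply: nx => i.
  by have := hx i; rewrite !mxE => /andP[h5 h6]; rewrite le_max h6 orbT (le_lt_trans _ h5)// lerN2 le_max lexx orbT.
by have := hx i; rewrite !mxE => /andP[h5 h6]; rewrite le_max h6 (le_lt_trans _ h5)// lerN2 le_max lexx.
Qed.

Lemma bsupZ (c : R) f : bsup f -> bsup (fun x => c * f x).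
Proof.
move=> [mf [C [r hf]]]; split; first exact: measurable_funM.
exists (`|c| * C), r => x; have [h1 h2] := hf x; split.
  by rewrite normrM ler_wpM2l.
by move=> /h2 ->; rewrite mulr0.
Qed.

Lemma bsup_L2 f : bsup f -> L2 mu setT f.
Proof.
move=> bf; split; first by case: bf.
by apply: eq_L1 (bsup_L1 (bsupM bf bf)) => // x _; rewrite expr2.
Qed.

Lemma bsup_shift f h : bsup f -> bsup (fun x => f (x + h)).
Proof.
move=> [mf [C [r hf]]]; split; first exact: (measurableT_comp mf (@measurable_shift _ _ h)).
exists C, (r + `|h|) => x; have [h1 h2] := hf (x + h); split=> // nx.
apply: h2 => hx; apply: nx => i; have := hx i; rewrite !mxE.
have := rV_coord_le h i; rewrite ler_norml => /andP[h3 h4] /andP[h5 h6].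
by apply/andP; split; lra.
Qed.

Lemma n2_shift f h : bsup f -> n2 mu setT (fun x => f (x + h)) = n2 mu setT f.
Proof.
move=> bf; congr Num.sqrt.
exact: (@Rintegral_shift _ _ h (fun x => f x * f x) (bsup_L1 (bsupM bf bf))).
Qed.

Let e_ i : 'rV[R]_n := delta_mx ord0 i.

Section difference_quotient.
Variables (f g : fct) (i : 'I_n) (t : R).
Hypotheses (bf : bsup f) (bg : bsup g) (t0 : 0 < t).
Hypothesis fg : forall x, is_derive x (e_ i) f (g x).

(** The step is a fraction of a fixed length t, so that [k.+1] steps make up exactly the translation
    by t. *)
Definition dquot (k : nat) : fct :=
  fun x => (t / k.+1%:R)^-1 * (f (x + (t / k.+1%:R) *: e_ i) - f x).

Let s_gt0 k : 0 < t / k.+1%:R. Proof. by rewrite divr_gt0. Qed.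

Lemma bsup_dquot k : bsup (dquot k).
Proof.
apply: bsupZ; apply: (bsupD (bsup_shift _ bf)).
rewrite (_ : (fun x => - f x) = (fun x => - 1 * f x)); first exact: bsupZ.
by apply/funext => x; rewrite mulN1r.
Qed.

Lemma dquot_cvg x : dquot ^~ x @ \oo --> g x.
Proof.
have [dx <-] := fg x; rewrite /derive.
have h1 : (h^-1 *: ((f \o shift x) (h *: e_ i) - f x)) @[h --> 0^'] --> lim (h^-1 *: ((f \o shift x) (h *: e_ i) - f x) @[h --> 0^']) by exact: dx.
have h2 : (forall k : nat, t / k.+1%:R != 0) /\ (t / k.+1%:R @[k --> \oo] --> 0).
  split; first by move=> k; rewrite gt_eqF.
  have := cvgM (cvg_cst t) (@cvg_harmonic R); rewrite mulr0.
  exact.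
have := (cvgr_dnbhsP _ _ _).1 h1 (fun k => t / k.+1%:R) h2.
apply: cvg_trans; apply: near_eq_cvg; apply: nearW => k.
by rewrite /dquot /= [x + _]addrC.
Qed.

(** By the mean value theorem along the line, the quotients are bounded by the supremum of g; their
    supports stay in the cube enlarged by the largest step t. *)
Lemma dquot_dominated : exists C r : R, forall k x,
  `|dquot k x| <= C * \1_(cube r) x.
Proof.
have [mf [Cf [r hf]]] := bf; have [mg [C [rg hg]]] := bg.
exists C, (r + t) => k x; set s := t / k.+1%:R.
have sk : 0 < s by exact: s_gt0.
have st : s <= t by rewrite /s ler_pdivrMr// -[leLHS]mulr1 ler_pM2l// ler1n.
rewrite indicE; have [xin|xout] := boolP (x \in cube (r + t)).
  rewrite mulr1 /dquot -/s normrM gtr0_norm ?invr_gt0// ler_pdivrMl//.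
  pose F (y : R) := f (y *: e_ i + x).
  have dF (y : R) : is_derive (y : R) (1 : R) F (g (y *: e_ i + x)).
    have /is_derive_line := fg (y *: e_ i + x).
    move=> h; apply/is_derive_line; apply: is_derive_eq.
      rewrite (_ : (fun _ => _) = (fun z => f (z *: e_ i + (y *: e_ i + x)))); first exact: h.
      apply/funext => z; rewrite /F; have -> : z *: (1 : R) = z by exact: mulr1.
      by rewrite scalerDl addrA.
    by [].
  have cF : {within `[0, s], continuous F}.
    apply: derivable_within_continuous => y _; by have [] := dF y.
  have [c _] := MVT sk (fun y _ => dF y) cF.
  rewrite /F scale0r add0r subr0 [s *: _ + x]addrC => ->.
  by rewrite normrM (gtr0_norm sk) mulrC ler_wpM2l ?(ltW sk)//; have [] := hg (c *: e_ i + x).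
rewrite mulr0 /dquot; move: xout; rewrite notin_setE => xout.
have [_ ->] := hf x; last first.
  move=> xin; apply: xout => j; have := xin j; rewrite !mxE => /andP[h1 h2].
  by apply/andP; split; lra.
have [_ ->] := hf (x + (t / k.+1%:R) *: e_ i); first by rewrite subr0 mulr0 normr0.
move=> xin; apply: xout => j; have := xin j; rewrite !mxE -/s eqxx/= => /andP[h1 h2].
have [h3 h4] : 0 <= s * (j == i)%:R /\ s * (j == i)%:R <= t.
  by case: eqP => _; rewrite ?mulr1 ?mulr0; split => //; exact: ltW.
by apply/andP; split; lra.
Qed.

End difference_quotient.
End bounded_support.

(** * Nash inequality *)

Section nash.
Context (R : realType) (n : nat).
Local Notation mu := (lebesgue_rV R n).
Local Notation fct := ('rV[R]_n -> R).
Local Notation mT := (@measurableT _ 'rV[R]_n).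
Implicit Types (f g phi psi : fct) (i : 'I_n).
Let e_ i : 'rV[R]_n := delta_mx ord0 i.

(** By translation invariance the difference quotients have integral zero; this passes to the
    limit. *)
Lemma Int_derive0 f g i : bsup f -> bsup g ->
  (forall x, is_derive x (e_ i) f (g x)) -> \int[mu]_x g x = 0.
Proof.
move=> bf bg fg.
have [C [r hd]] := dquot_dominated bf bg ltr01 fg.
have cv : \int[mu]_x dquot f i 1 k x @[k --> \oo] --> \int[mu]_x g x.
  apply: (@Int_cvg _ _ _ mu setT mT _ _ (fun x => C * \1_(cube r) x)) => //.
  - by move=> k; have [] := @bsup_dquot _ _ f i 1 bf k.
  - by case: bg.
  - by move=> x _; exact: dquot_cvg.
  - exact: L1_cube.
have e0 : (fun k => \int[mu]_x dquot f i 1 k x) = cst 0.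
  apply/funext => k; rewrite /dquot RintegralZl//; last first.
    apply: L1B => //; [exact: (bsup_L1 (bsup_shift _ bf))|exact: bsup_L1].

  rewrite RintegralB//; [|exact: (bsup_L1 (bsup_shift _ bf))|exact/bsup_L1].
  by rewrite Rintegral_shift ?subrr ?mulr0//; exact: bsup_L1.
move: cv; rewrite e0 => cv.
exact: (cvg_unique _ cv (cvg_cst 0)).
Qed.

Lemma bsupB f g : bsup f -> bsup g -> bsup (fun x => f x - g x).
Proof.
move=> bf bg; apply: bsupD => //; rewrite (_ : (fun x => - g x) = (fun x => - 1 * g x)).
  exact: bsupZ.
by apply/funext => x; rewrite mulN1r.
Qed.

Lemma n2_translate_steps f (h : 'rV[R]_n) (N : nat) : bsup f ->
  n2 mu setT (fun x => f (x + h *+ N) - f x) <= N%:R * n2 mu setT (fun x => f (x + h) - f x).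
Proof.
move=> bf; elim: N => [|N IH].
  rewrite mul0r (@eq_n2 _ _ _ mu setT _ (fun=> 0)); last by move=> x _; rewrite mulr0n addr0 subrr.
  by rewrite /n2 /ip mulr0 Rintegral_cst// mul0r sqrtr0.
rewrite (@eq_n2 _ _ _ mu setT _ (fun x => (f (x + h *+ N + h) - f (x + h *+ N)) + (f (x + h *+ N) - f x))); last first.
  by move=> x _; rewrite addrA subrK mulrSr addrA.
have bd : bsup (fun x => f (x + h) - f x) by apply: bsupB => //; exact: (bsup_shift _ bf).
apply: (le_trans (n2D mT _ _)).
- exact/bsup_L2/(bsup_shift _ bd).
- by apply/bsup_L2/bsupB => //; exact: (bsup_shift _ bf).
by rewrite (n2_shift (h *+ N) bd) -natr1 mulrDl mul1r addrC lerD2r.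
Qed.

(** Cutting the translation into [k.+1] equal steps bounds the left side by t times the norm of a
    difference quotient, and these norms converge to the norm of g. *)
Lemma n2_translate f g i (t : R) : bsup f -> bsup g -> 0 <= t ->
  (forall x, is_derive x (e_ i) f (g x)) ->
  n2 mu setT (fun x => f (x + t *: e_ i) - f x) <= t * n2 mu setT g.
Proof.
move=> bf bg; rewrite le_eqVlt => /predU1P[<- _|t0 fg].
  rewrite mul0r (@eq_n2 _ _ _ mu setT _ (fun=> 0)); last by move=> x _; rewrite scale0r addr0 subrr.
  by rewrite /n2 /ip mulr0 Rintegral_cst// mul0r sqrtr0.
have [C [r hd]] := dquot_dominated bf bg t0 fg.
have bq k : bsup (dquot f i t k) by exact: bsup_dquot.
have cv : \int[mu]_x (dquot f i t k x * dquot f i t k x) @[k --> \oo] --> \int[mu]_x (g x * g x).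
  apply: (@Int_cvg _ _ _ mu setT mT _ _ (fun x => (C * C) * \1_(cube r) x)) => //.
  - by move=> k; have [] := bsupM (bq k) (bq k).
  - by have [] := bsupM bg bg.
  - by move=> x _; apply: cvgM; exact: dquot_cvg.
  - exact: L1_cube.
  - move=> k x _; rewrite normrM; have := hd k x; rewrite indicE; case: (_ \in _) => /=.
      by rewrite !mulr1 => h; rewrite ler_pM.
    by rewrite !mulr0 normr_le0 => /eqP ->; rewrite normr0 mulr0.
have le1 k : n2 mu setT (fun x => f (x + t *: e_ i) - f x) ^+ 2 <=
    t ^+ 2 * \int[mu]_x (dquot f i t k x * dquot f i t k x).
  rewrite -[X in _ * X]/(ip mu setT _ _) -n2_sq -exprMn ler_pXn2r ?nnegrE ?n2_ge0//; last first.
    by rewrite mulr_ge0 ?n2_ge0// ltW.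
  have -> : t * n2 mu setT (dquot f i t k) = k.+1%:R * n2 mu setT (fun x => f (x + (t / k.+1%:R) *: e_ i) - f x).
    rewrite [X in t * X]n2Z//; last by apply/bsup_L2/bsupB => //; exact: (bsup_shift _ bf).
    rewrite gtr0_norm ?invr_gt0 ?divr_gt0// mulrA invf_div; congr (_ * _).
    by rewrite mulrC divfK// gt_eqF.
  have := n2_translate_steps ((t / k.+1%:R) *: e_ i) k.+1 bf.
  by rewrite -scaler_nat scalerA (_ : k.+1%:R * (t / k.+1%:R) = t)// mulrC divfK// pnatr_eq0.
have : n2 mu setT (fun x => f (x + t *: e_ i) - f x) ^+ 2 <= t ^+ 2 * ip mu setT g g.
  have cv2 : t ^+ 2 * \int[mu]_x (dquot f i t k x * dquot f i t k x) @[k --> \oo]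
      --> t ^+ 2 * ip mu setT g g by apply: cvgM => //; exact: cvg_cst.
  by apply: (cvgr_to_ge cv2); apply: nearW => k; exact: le1.
by rewrite -n2_sq -exprMn ler_pXn2r ?nnegrE ?n2_ge0// mulr_ge0 ?n2_ge0// ltW.
Qed.

Lemma n2_translate_vec f (g : 'I_n -> fct) (h : 'rV[R]_n) (e : R) :
  bsup f -> (forall i, bsup (g i)) ->
  (forall i x, is_derive x (e_ i) f (g i x)) ->
  (forall i, 0 <= h ord0 i <= e) ->
  n2 mu setT (fun x => f (x + h) - f x) <= e * \sum_i n2 mu setT (g i).
Proof.
move=> bf bg fg h0e.
suff H (s : seq 'I_n) : n2 mu setT (fun x => f (x + \sum_(i <- s) h ord0 i *: e_ i) - f x)
    <= e * \sum_(i <- s) n2 mu setT (g i).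
  have {1}-> : h = \sum_i h ord0 i *: e_ i by exact: row_sum_delta.
  exact: H.
elim: s => [|i s IH].
  rewrite !big_nil mulr0 (@eq_n2 _ _ _ mu setT _ (fun=> 0)); last by move=> x _; rewrite addr0 subrr.
  by rewrite /n2 /ip mulr0 Rintegral_cst// mul0r sqrtr0.
rewrite !big_cons; set h' := \sum_(j <- s) _.
rewrite (@eq_n2 _ _ _ mu setT _ (fun x => (f (x + h' + h ord0 i *: e_ i) - f (x + h')) + (f (x + h') - f x))); last first.
  by move=> x _; rewrite [RHS]addrA subrK -[x + h' + _]addrA [h' + _]addrC.
have bd : bsup (fun x => f (x + h ord0 i *: e_ i) - f x) by apply: bsupB => //; exact: (bsup_shift _ bf).
apply: (le_trans (n2D mT _ _)).
- exact: (bsup_L2 (bsup_shift h' bd)).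
- by apply/bsup_L2/bsupB => //; exact: (bsup_shift _ bf).
rewrite (n2_shift h' bd) mulrDr lerD//.
have /andP[hi0 hie] := h0e i.
apply: (le_trans (n2_translate bf (bg i) hi0 (fg i))).
by rewrite ler_wpM2r ?n2_ge0.
Qed.

(* Averaging f over the translations by h in ]0, e]^n; [Num.max] only serves to
   keep the first bound nonnegative. *)
Lemma nash_le f (g : 'I_n -> fct) (e : R) : 0 < e -> bsup f ->
  (forall i, bsup (g i)) -> (forall i x, is_derive x (e_ i) f (g i x)) ->
  e ^+ n * (n2 mu setT f ^+ 2 - n2 mu setT f * (e * \sum_i n2 mu setT (g i)))
    <= (\int[mu]_x `|f x|) ^+ 2.
Proof.
move=> e0 bf bg fg; set c := (X in _ * X <= _).
have [c0|c0] := leP c 0.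
  apply: (@le_trans _ _ 0); last exact: sqr_ge0.
  by rewrite mulr_ge0_le0// exprn_ge0// ltW.
pose Q := @box R n 0 (const_mx e).
have mQ : measurable Q by exact: measurable_box.
have muQ : mu Q = (e ^+ n)%:E.
  rewrite /Q; have := @lebesgue_rV_box R n 0 (const_mx e).
  rewrite /box => ->; last by move=> i; rewrite !mxE ltW.
  congr EFin; rewrite (eq_bigr (fun=> e)); last by move=> i _; rewrite !mxE subr0.
  by rewrite prodr_const card_ord.
have mf : measurable_fun setT f by case: bf.
(* The double integral of |f(x)| |f(x + h)| over x and over h in Q. Integrating in h first, it is at
   most the square of the L1 norm; integrating in x first, it is at least c for each h in Q, since
   (f, f(. + h)) >= |f|^2 - |f| |f(. + h) - f|. *)
pose Fxh (p : 'rV[R]_n * 'rV[R]_n) : \bar R :=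
  (`|f p.1| * `|f (p.1 + p.2)| * \1_Q p.2)%:E.
have mF : measurable_fun setT Fxh.
  apply/measurable_EFinP; apply: measurable_funM; first apply: measurable_funM.
  - by apply: measurableT_comp => //; apply: measurableT_comp => //.
  - apply: measurableT_comp => //; apply: (measurableT_comp mf).
    apply: measurable_fun_rV => i; under eq_fun do rewrite mxE.
    by apply: measurable_funD; apply: (measurableT_comp (measurable_coord i)).
  - by apply: (measurableT_comp (measurable_indic mQ)).
have F0 p : (0 <= Fxh p)%E by rewrite lee_fin !mulr_ge0.
have afin : (\int[mu]_x `|f x|%:E = (\int[mu]_x `|f x|)%:E)%E.
  rewrite fineK//; apply: integrable_fin_num => //.
  exact: (L1_norm (bsup_L1 bf)).
have upper : (\int[mu]_x \int[mu]_h Fxh (x, h) <= ((\int[mu]_x `|f x|) ^+ 2)%:E)%E.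
  have -> : ((\int[mu]_x `|f x|) ^+ 2)%:E = (\int[mu]_x (`|f x|%:E * (\int[mu]_x `|f x|)%:E))%E.
    rewrite ge0_integralZr//; last 2 first.
      by apply/measurable_EFinP; exact: measurableT_comp.
      by rewrite lee_fin Rintegral_ge0.
    by rewrite afin -EFinM expr2.
  apply: ge0_le_integral => //.
  - by move=> x _; exact: integral_ge0.
  - exact: measurable_fun_fubini_tonelli_F.
  - by apply/measurable_EFinP; apply: measurable_funM => //; exact: measurableT_comp.
  - move=> x _; rewrite -afin.
    have mfx : measurable_fun setT (fun h => `|f (x + h)|%:E).
      apply/measurable_EFinP; apply: measurableT_comp => //.
      by under eq_fun do rewrite addrC; exact: (measurableT_comp mf (@measurable_shift _ _ x)).
    have mfy : measurable_fun setT (fun h => `|f h|%:E).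
      by apply/measurable_EFinP; exact: measurableT_comp.
    apply: (@le_trans _ _ (\int[mu]_h (`|f x|%:E * `|f (x + h)|%:E))%E).
      apply: ge0_le_integral => //.
      - by apply: (measurableT_comp mF); exact: measurable_fun_pair.
      - by apply: emeasurable_funM.
      - move=> h _; rewrite /Fxh/= lee_fin indicE.
        by case: (_ \in _); rewrite ?mulr1 ?mulr0// mulr_ge0.
    rewrite ge0_integralZl//; apply: lee_wpmul2l => //.
    have := @ge0_integral_shift R n x (fun h => `|f h|%:E) mfy (fun h => normr_ge0 (f h)).
    by under eq_integral do rewrite addrC; move=> ->.
rewrite -lee_fin; apply: le_trans upper.
rewrite (fubini_tonelli Fxh mF F0).
have -> : (e ^+ n * c)%:E = (\int[mu]_(h in Q) (cst c%:E h))%E.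
  by rewrite EFinM -muQ muleC; apply/esym; exact: integral_cst.
rewrite integral_mkcond; apply: ge0_le_integral => //.
- by move=> h _; rewrite /patch; case: ifP => // _; rewrite lee_fin ltW.
- by apply/(measurable_restrictT _ _).1.
- exact: measurable_fun_fubini_tonelli_G.
move=> h _; rewrite /patch; case: ifPn => [hQ|_]; last exact: integral_ge0.
have bfh : bsup (fun x => f (x + h)) by exact: (bsup_shift _ bf).
have l2f := bsup_L2 bf; have l2fh := bsup_L2 bfh.
have bfa : bsup (fun x => `|f x| * `|f (x + h)|).
  have [m1 [C [r hC]]] := bsupM bf bfh; split.
    by apply: measurable_funM; apply: measurableT_comp => //; case: bfh.
  exists C, r => x; have [h1 h2] := hC x; rewrite -normrM normr_id; split => //.
  by move=> /h2 ->; rewrite normr0.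
rewrite (eq_integral (fun x => (`|f x| * `|f (x + h)|)%:E)); last first.
  by move=> x _; rewrite /Fxh/= indicE hQ mulr1.
rewrite -[leRHS]fineK; last by apply: integrable_fin_num => //; exact: (bsup_L1 bfa).
rewrite lee_fin; apply: (@le_trans _ _ (ip mu setT f (fun x => f (x + h)))); last first.
  apply: Int_le_ae => //; [exact: bsup_L1 (bsupM bf bfh)|exact: bsup_L1|].
  by apply: aeD_all => x _; rewrite -normrM ler_norm.
have -> : ip mu setT f (fun x => f (x + h)) =
    n2 mu setT f ^+ 2 + ip mu setT f (fun x => f (x + h) - f x).
  by rewrite ipBr// n2_sq addrC subrK.
rewrite /c lerD2l; apply: lerNnormlW.
have := ip_CS mT l2f (L2B mT l2fh l2f).
move=> h1; apply: (le_trans h1); rewrite ler_wpM2l ?n2_ge0//.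
apply: n2_translate_vec => // i.
by move: hQ; rewrite inE => /(_ i); rewrite !mxE => /andP[/ltW -> ->].
Qed.

End nash.

(** * The fundamental lemma of the calculus of variations *)

Section density.
Context d (T : measurableType d) (R : realType)
  (mu : {measure set T -> \bar R}) (g : T -> \bar R).
Hypotheses (mg : measurable_fun setT g) (g0 : forall x, (0 <= g x)%E).

(** Turns the positive and the negative part of an integrable function into measures, so that
    [rV_measure_unique] can compare them on boxes. *)
Definition density (A : set T) : \bar R := (\int[mu]_(x in A) g x)%E.

Let density0 : density set0 = 0%E.
Proof. exact: integral_set0. Qed.

Let density_ge0 A : (0 <= density A)%E.
Proof. exact: integral_ge0. Qed.

Let density_sigma_additive : semi_sigma_additive density.
Proof. exact: semi_sigma_additive_nng_induced. Qed.

HB.instance Definition _ := isMeasure.Build _ _ _ density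
  density0 density_ge0 density_sigma_additive.

Definition density_measure : {measure set T -> \bar R} := density.

End density.

Section du_bois_reymond.
Context (R : realType) (n : nat).
Local Notation mu := (lebesgue_rV R n).
Local Notation fct := ('rV[R]_n -> R).
Variables (Omega : set 'rV[R]_n) (G : fct).
Hypotheses (oO : open Omega) (lG : L1 mu Omega G).
Hypothesis Gphi : forall phi, test_function Omega phi -> ip mu Omega G phi = 0.

Let mO : measurable Omega. Proof. exact: open_measurable_rV. Qed.

Lemma flat_cvg1 (u : nat -> R) (de : R) : 0 < de ->
  (forall k : nat, k.+1%:R * de <= u k) -> flat 0 (u k) @[k --> \oo] --> (1 : R).
Proof.
move=> de0 hu; apply: (@squeeze_cvgr _ _ _ _ (fun k => 1 - de^-1 * k.+1%:R^-1) (cst 1)).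
- apply: nearW => k; have uk : 0 < u k by rewrite (lt_le_trans _ (hu k))// mulr_gt0.
  apply/andP; split; last by have := flat_le 0 (u k); rewrite fact0.
  rewrite /flat uk expr0 mul1r.
  have := expR_ge1Dx (- (u k)^-1); apply: le_trans; rewrite lerD2l lerN2.
  by rewrite -invfM lef_pV2 ?posrE ?mulr_gt0// mulrC.
- rewrite -[X in _ --> X]subr0; apply: cvgB; first exact: cvg_cst.
  rewrite -(mulr0 de^-1); apply: cvgM; first exact: cvg_cst.
  exact: cvg_harmonic.
- exact: cvg_cst.
Qed.

Definition inner_box (a b : 'rV[R]_n) := exists2 e : R, 0 < e &
  forall x : 'rV[R]_n, (forall i, a ord0 i - e < x ord0 i < b ord0 i + e) -> Omega x.

(** Approximates the indicator of ]a_i, b_i] in the i-th coordinate. The right cutoff is shifted by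
    e/(k+1) because b_i belongs to the box; the factor (k+1)^2 sends its argument at b_i, which is
    (k+1) e, to infinity although the shift vanishes. *)
Definition bump (a b : 'rV[R]_n) (e : R) (k : nat) (i : 'I_n) : fct := fun x =>
  flat 0 ((k.+1%:R ^+ 2) * (x ord0 i - a ord0 i)) *
  flat 0 ((k.+1%:R ^+ 2) * (b ord0 i + e / k.+1%:R - x ord0 i)).

Lemma bump_ge0 a b e k i x : 0 <= bump a b e k i x.
Proof. by rewrite mulr_ge0 ?flat_ge0. Qed.

Lemma bump_le1 a b e k i x : bump a b e k i x <= 1.
Proof. by rewrite mulr_ile1 ?flat_ge0//; have := flat_le 0; exact. Qed.

Lemma smooth_bump a b e k : smooth (fun x => \prod_i bump a b e k i x).
Proof.
apply: smooth_alg_smooth; elim: (index_enum _) => [|i s IH].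
  by under eq_fun do rewrite big_nil; exact: smooth_alg_cst.
under eq_fun do rewrite big_cons; apply: smooth_algM => //.
apply: smooth_algM; apply: smooth_alg_flat; apply: smooth_algM;
  try exact: smooth_alg_cst; apply: smooth_algD; try exact: smooth_alg_cst.
  exact: smooth_alg_coord.
rewrite (_ : (fun x : 'rV[R]_n => - x ord0 i) = (fun x : 'rV[R]_n => - 1 * x ord0 i)).
  by apply: smooth_algM; [exact: smooth_alg_cst|exact: smooth_alg_coord].
by apply/funext => x; rewrite mulN1r.
Qed.

Lemma Int_inner_box a b : inner_box a b -> \int[mu]_(x in box a b) G x = 0.
Proof.
(* Half of the margin: the closed boxes that carry the bumps must stay strictly inside the enlarged
   open box. *)
move=> [e e0 eO]; pose e2 := e / 2.
have e20 : 0 < e2 by rewrite divr_gt0.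
pose phi (k : nat) (x : 'rV[R]_n) : R := \prod_(i < n) bump a b e2 k i x.
have tphi k : test_function Omega (phi k).
  split; first exact: smooth_bump.
  exists [set x : 'rV[R]_n | forall i, `[a ord0 i, b ord0 i + e2]%classic (x ord0 i)]; split.
  - apply: (@rV_compact _ _ (fun i => `[a ord0 i, b ord0 i + e2]%classic)).
    by move=> i; exact: segment_compact.
  - move=> x xK; apply: eO => i; have := xK i; rewrite /= in_itv/= => /andP[h1 h2].
    apply/andP; split; first by rewrite (lt_le_trans _ h1)// gtrDl oppr_lt0.
    by rewrite (le_lt_trans h2)// ltrD2l /e2 ltr_pdivrMr// ltr_pMr// ltr1n.
  move=> x /existsNP[i]; rewrite /= in_itv/= => /negP; rewrite negb_and -!ltNge => h.
  rewrite /phi (bigD1 i)//= /bump; case/orP: h => h.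
    by rewrite flat0 ?mul0r// pmulr_rle0 ?exprn_gt0// subr_le0 ltW.
  rewrite [flat 0 (_ * (b ord0 i + _ - _))]flat0 ?mulr0 ?mul0r//.
  rewrite pmulr_rle0 ?exprn_gt0// subr_le0 (le_trans _ (ltW h))// lerD2l.
  by rewrite ler_pdivrMr// -[leLHS]mulr1 ler_pM2l// ler1n.
have phi01 k x : 0 <= phi k x <= 1.
  rewrite prodr_ge0 => [|i _]; last exact: bump_ge0.
  by apply: prodr_ile1 => i _; rewrite bump_ge0 bump_le1.
have phi_cvg x : phi k x @[k --> \oo] --> (\1_(box a b) x : R).
  rewrite indicE; have [/set_mem xab|] := boolP (x \in box a b).
    rewrite /= -[1%:R](@big1 _ 1 *%R _ (index_enum 'I_n) predT (fun=> 1))//.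
    apply: cvg_big => [|i _]; first exact: mul_continuous.
    have /andP[h1 h2] := xab i; rewrite -[1%R]mulr1.
    apply: cvgM; [apply: (@flat_cvg1 _ (x ord0 i - a ord0 i))|apply: (@flat_cvg1 _ e2)] => //.
    - by rewrite subr_gt0.
    - move=> k; rewrite expr2 -mulrA ler_wpM2l// -[leLHS]mul1r ler_wpM2r ?subr_ge0 ?(ltW h1)//.
      by rewrite ler1n.
    - move=> k; rewrite expr2 -mulrA ler_wpM2l//.
      rewrite -addrAC mulrDr [_ * (e2 / _)]mulrC divfK// lerDr mulr_ge0// subr_ge0//.
  rewrite notin_setE /= => xab; rewrite /=.
  have /existsNP[i /negP] := xab; rewrite negb_and -leNgt -ltNge => /orP[h|h].
    apply: cvg_near_cst; apply: nearW => k; apply/eqP.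
    by rewrite /phi (bigD1 i)//= /bump flat0 ?mul0r// pmulr_rle0 ?exprn_gt0// subr_le0.
  apply: cvg_near_cst; near=> k; apply/eqP.
  rewrite /phi (bigD1 i)//= /bump [flat 0 (_ * (b ord0 i + _ - _))]flat0 ?mulr0 ?mul0r//.
  rewrite pmulr_rle0 ?exprn_gt0// subr_le0 -lerBrDl ler_pdivrMr// mulrC.
  rewrite -ler_pdivrMr ?subr_gt0//; apply: (@le_trans _ _ k%:R); last by rewrite ler_nat.
  near: k; exact: nbhs_infty_ger.
have boxO : box a b `<=` Omega.
  move=> x xab; apply: eO => i; have /andP[h1 h2] := xab i.
  apply/andP; split; first by rewrite (le_lt_trans _ h1)// gerDl oppr_le0 ltW.
  by rewrite (le_lt_trans h2)// ltrDl.
have mG := L1_measurable lG.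
have mphi k : measurable_fun setT (phi k).
  by have [sphi _] := tphi k; apply: continuous_measurable_rV; exact: smooth_continuous.
have cv : ip mu Omega G (phi k) @[k --> \oo] -->
    \int[mu]_(x in Omega) (G x * \1_(box a b) x).
  apply: (@Int_cvg _ _ _ mu Omega mO _ _ (fun x => `|G x|)) => //.
  - by move=> k; apply: measurable_funM => //; exact: measurable_funTS.
  - by apply: measurable_funM => //; apply: measurable_indic; exact: measurable_box.
  - by move=> x _; apply: cvgM; [exact: cvg_cst|exact: phi_cvg].
  - exact: L1_norm.
  - move=> k x _; rewrite normrM -[leRHS]mulr1 ler_wpM2l//.
    by have /andP[h1 h2] := phi01 k x; rewrite ger0_norm.
have e1 : (fun k => ip mu Omega G (phi k)) = cst 0 by apply/funext => k; exact: Gphi.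
move: cv; rewrite e1 => /(cvg_unique _ (cvg_cst 0)) /= ->//.
rewrite -{1}(setIidr boxO) Rintegral_mkcondr; apply: eq_Int => x _.
by rewrite /patch indicE; case: (_ \in _); rewrite ?mulr1 ?mulr0.
Unshelve. all: by end_near. Qed.

Lemma inner_box_subset a b : inner_box a b -> box a b `<=` Omega.
Proof.
move=> [e e0 eO] x xab; apply: eO => i; have /andP[h1 h2] := xab i.
apply/andP; split; first by rewrite (le_lt_trans _ h1)// gerDl oppr_le0 ltW.
by rewrite (le_lt_trans h2)// ltrDl.
Qed.

(** The measures with densities the positive and negative parts of G on the box agree on all boxes,
    since the intersection of a box with an inner box is again inner; hence they agree on all Borel
    sets, and G has integral zero over every measurable part of the box. *)
Lemma inner_box_eq0 a b : inner_box a b ->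
  \forall x \ae mu, box a b x -> G x = 0.
Proof.
move=> ab; pose Q := box a b; have mQ : measurable Q by exact: measurable_box.
have lGQ : mu.-integrable Q (EFin \o G).
  exact: (integrableS mO mQ (inner_box_subset ab) lG).
pose h := (EFin \o G) \_ Q.
have lh : mu.-integrable setT h by apply/(integrable_mkcond _ mQ).1.
pose mp := density_measure mu (measurable_funepos (measurable_int mu lh)) (funepos_ge0 h).
pose mm := density_measure mu (measurable_funeneg (measurable_int mu lh)) (funeneg_ge0 h).
have ip' A : measurable A -> mu.-integrable A (h^\+)%E.
  by move=> mA; apply: integrable_funepos => //; exact: (integrableS measurableT mA (@subsetT _ _) lh).
have im' A : measurable A -> mu.-integrable A (h^\-)%E.
  by move=> mA; apply: integrable_funeneg => //; exact: (integrableS measurableT mA (@subsetT _ _) lh).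
have intE A : measurable A -> (\int[mu]_(x in A) h x = mp A - mm A)%E.
  by move=> mA; rewrite integralE.
have pfin A : measurable A -> mp A \is a fin_num.
  by move=> mA; exact: (integrable_fin_num mA (ip' _ mA)).
have mfin A : measurable A -> mm A \is a fin_num.
  by move=> mA; exact: (integrable_fin_num mA (im' _ mA)).
have hE A : measurable A -> (\int[mu]_(x in A) h x = \int[mu]_(x in A `&` Q) (G x)%:E)%E.
  by move=> mA; rewrite integral_mkcondr.
have mpm A : measurable A -> mp A = mm A.
  move=> mA; apply: rV_measure_unique => // [a' b'|a' b'].
    have mB := @measurable_box R n a' b'.
    suff : (mp (box a' b') - mm (box a' b') = 0)%E.
      rewrite -(fineK (pfin _ mB)) -(fineK (mfin _ mB)) -EFinB => -[] /eqP.
      by rewrite subr_eq0 => /eqP ->.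
    rewrite -intE// hE// box_setI; set b1 := box _ _.
    have ib : inner_box (\row_i Num.max (a' ord0 i) (a ord0 i)) (\row_i Num.min (b' ord0 i) (b ord0 i)).
      have [e e0 eO] := ab; exists e => // x hx; apply: eO => i; have := hx i.
      rewrite !mxE => /andP[h1 h2]; apply/andP; split.
        by apply: le_lt_trans h1; rewrite lerD2r le_max lexx orbT.
      by apply: (lt_le_trans h2); rewrite lerD2r ge_min lexx orbT.
    have : (\int[mu]_(x in b1) (G x)%:E)%E \is a fin_num.
      apply: integrable_fin_num; first exact: measurable_box.
      apply: (integrableS mO _ _ lG); [exact: measurable_box|exact: inner_box_subset].
    by move=> /fineK <-; rewrite -[fine _]/(Rintegral mu b1 G) Int_inner_box.
  by rewrite -ge0_fin_numE ?pfin//; exact: measurable_box.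
have : ae_eq mu Q (EFin \o G) (cst 0%E).
  apply: integral_ae_eq => // E EQ mE; rewrite integral0.
  have := hE E mE; rewrite setIidl// => <-.
  by rewrite intE// mpm// subee// mfin.
by apply: filterS => x /[apply] -[].
Qed.

(** Countably many inner boxes cover Omega, so the exceptional null sets may be united. *)
Lemma test_orthogonal_eq0 : aeD mu Omega (fun x => G x = 0).
Proof.
have [F [OF FO hF]] := open_bigcup_box oO.
have hk (k : nat) : \forall x \ae mu,
    (if unpickle k is Some p then F p x else False) -> G x = 0.
  case: (unpickle k) => [p|]; last by apply: aeW.
  have [->|[a [b [e [-> e0 eO]]]]] := hF p; first by apply: aeW => x [].
  by apply: inner_box_eq0; exists e.
have := ae_foralln hk; rewrite /aeD; apply: filterS => x h.
by rewrite {1}OF => -[p _ Fpx]; apply: (h (pickle p)); rewrite pickleK.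
Qed.

End du_bois_reymond.

(** * Weak gradients and H^1_0 *)

Section bridge.
Context (R : realType) (n : nat).
Local Notation mu := (lebesgue_rV R n).
Local Notation fct := ('rV[R]_n -> R).
Implicit Types (u v f : fct) (D : set 'rV[R]_n).

Lemma measurable_restrict_fct D u : measurable D ->
  measurable_fun D u <-> measurable_fun setT (u \_ D).
Proof. by move=> mD; exact: measurable_restrictT. Qed.

Lemma integral_restrict_sq D u :
  (\int[mu]_x (`|(u \_ D) x| `^ 2)%:E = \int[mu]_(x in D) (u x ^+ 2)%:E)%E.
Proof.
rewrite [RHS]integral_mkcond; apply: eq_integral => x _; rewrite /patch.
by case: ifP => _; rewrite powR_mulrn// real_normK ?num_real// expr0n.
Qed.

Lemma inL2P D u : measurable D -> inL D 2%:E u <-> L2 mu D u.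
Proof.
move=> mD; rewrite /inL; split => [h|[mu2 iu2]].
  have /andP[/[!inE]/= mf _] := h.
  have := Lfun2_integrable_sqr h => h2.
  split; first exact/(measurable_restrict_fct u mD).
  apply/(integrable_mkcond _ mD).2; apply: eq_integrable h2 => // x _ /=.
  by rewrite /patch; case: ifP => _ //=; rewrite expr0n.
apply/andP; split; rewrite inE/=; first exact/(measurable_restrict_fct u mD).
rewrite /finite_norm unlock /=.
have -> : (\int[mu]_x `|((u \_ D) x)%:E| `^ 2 = \int[mu]_(x in D) (u x ^+ 2)%:E)%E.
  by rewrite -integral_restrict_sq; apply: eq_integral => x _; rewrite /= ?poweR_EFin.
apply: poweR_lty; case/integrableP: iu2 => _.
by under eq_integral do rewrite /= ger0_norm ?sqr_ge0//.
Qed.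

Lemma normL2E D u : measurable D -> L2 mu D u -> normL 2%:E D u = n2 mu D u.
Proof.
move=> mD [mu2 iu2]; rewrite /normL unlock /=.
have -> : (\int[mu]_x `|((u \_ D) x)%:E| `^ 2 = (ip mu D u u)%:E)%E.
  rewrite (_ : (\int[mu]_x _ = \int[mu]_(x in D) (u x ^+ 2)%:E)%E); last first.
    by rewrite -integral_restrict_sq; apply: eq_integral => x _; rewrite /= ?poweR_EFin.
  rewrite -[LHS]fineK; last exact: integrable_fin_num.
  by congr EFin; apply: eq_Int => x _; rewrite expr2.
by rewrite poweR_EFin /= powR12_sqrt// ip_ge0.
Qed.

Lemma normL1E D u : measurable D -> measurable_fun D u ->
  normL 1%:E D u = \int[mu]_(x in D) `|u x|.
Proof.
move=> mD mu1; rewrite /normL Lnorm1; congr fine.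
rewrite [RHS]integral_mkcond; apply: eq_integral => x _ /=; rewrite /patch.
by case: ifP => // _; rewrite normr0.
Qed.

Lemma dotL2E D u v : dotL2 D u v = ip mu D u v.
Proof. by []. Qed.

Lemma Int_extend D f : (forall x, ~ D x -> f x = 0) ->
  \int[mu]_(x in D) f x = \int[mu]_x f x.
Proof.
move=> f0; rewrite Rintegral_mkcond; apply: eq_Int => x _; rewrite /patch.
by case: ifPn => //; rewrite notin_setE => /f0.
Qed.

Lemma n2_extend D f : (forall x, ~ D x -> f x = 0) -> n2 mu D f = n2 mu setT f.
Proof. by move=> f0; congr Num.sqrt; apply: Int_extend => x /f0 ->; rewrite mulr0. Qed.

End bridge.

Section H10.
Context (R : realType) (n : nat) (Omega : set 'rV[R]_n).
Local Notation mu := (lebesgue_rV R n).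
Local Notation fct := ('rV[R]_n -> R).
Local Notation L2 := (L2 mu Omega).
Local Notation n2 := (n2 mu Omega).
Local Notation ip := (ip mu Omega).
Local Notation aeO := (aeD mu Omega).
Hypotheses (oO : open Omega) (bO : bounded_set Omega).
Implicit Types (u v y f : fct) (G H : 'I_n -> fct).

Let mO : measurable Omega. Proof. exact: open_measurable_rV. Qed.
Let fO : (mu Omega < +oo)%E. Proof. exact: bounded_set_lty. Qed.

Lemma test_bsup phi : test_function Omega phi -> bsup phi.
Proof.
move=> /[dup] tphi -[sphi [K [cK KO phi0]]]; split.
  by apply: continuous_measurable_rV; exact: smooth_continuous.
have [C C0 hC] := test_bounded tphi.
have [r hr] := bounded_set_box bO.
exists C, r => x; split => // nx; apply: phi0 => /KO /hr; exact: nx.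
Qed.

Lemma test_L2 phi : test_function Omega phi -> L2 phi.
Proof.
move=> tphi; have [mphi _] := test_bsup tphi; have [C C0 hC] := test_bounded tphi.
apply: (L2_bdd mO fO (c := C)); first exact: measurable_funTS.
by apply: aeD_all.
Qed.

Lemma test_weak_gradient phi : test_function Omega phi ->
  weak_gradient Omega phi (fun i => partial i phi).
Proof.
move=> tphi; split=> [i|psi tpsi i].
  by apply/(inL2P _ mO)/test_L2/test_partial.
have tpi := test_partial i tphi; have tsi := test_partial i tpsi.
rewrite !dotL2E; apply/eqP; rewrite -subr_eq0 opprK; apply/eqP.
rewrite -RintegralD//; [|exact: L2M (test_L2 tphi) (test_L2 tsi)|exact: L2M (test_L2 tpi) (test_L2 tpsi)].
rewrite Int_extend; last first.
  by move=> x nx; rewrite (test_eq0 tphi nx) (test_eq0 tpsi nx) mul0r mulr0 addr0.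
apply: (@Int_derive0 _ _ (fun x => phi x * psi x) _ i).
- by apply: bsupM; exact: test_bsup.
- by apply: bsupD; apply: bsupM; exact: test_bsup.
- move=> x; rewrite [X in is_derive _ _ _ (_ + X)]mulrC.
  apply: (@is_deriveM _ _ phi psi x (delta_mx ord0 i)).
    by apply: smooth_is_derive; case: tphi.
  by apply: smooth_is_derive; case: tpsi.
Qed.

Lemma weak_gradient_unique u G H : weak_gradient Omega u G ->
  weak_gradient Omega u H -> forall i, aeO (fun x => G i x = H i x).
Proof.
move=> [G2 uG] [H2 uH] i.
have lG : L2 (G i) by apply/(inL2P _ mO).
have lH : L2 (H i) by apply/(inL2P _ mO).
have h : aeO (fun x => G i x - H i x = 0).
  apply: (test_orthogonal_eq0 oO); first exact: (L2_L1 mO fO (L2B mO lG lH)).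
  move=> phi tphi; rewrite ipBl//; last exact: test_L2.
  by apply/eqP; rewrite subr_eq0 -!dotL2E -eqr_opp -uG// -uH.
by apply: aeD_mp h => x _ /eqP; rewrite subr_eq0 => /eqP.
Qed.

Lemma weak_gradient_grad u G : weak_gradient Omega u G ->
  weak_gradient Omega u (grad Omega u).
Proof. by move=> uG; rewrite /grad; case: xgetP => [H -> //|/(_ G)]. Qed.

Lemma grad_ae u G : weak_gradient Omega u G ->
  forall i, aeO (fun x => grad Omega u i x = G i x).
Proof.
by move=> uG; apply: (weak_gradient_unique (weak_gradient_grad uG) uG).
Qed.

Lemma weak_gradient_L2 u G i : weak_gradient Omega u G -> L2 (G i).
Proof. by move=> [h _]; apply/(inL2P _ mO). Qed.

(* [y] lies in H^1_0 and [G] is its gradient, phrased without the choice made by [grad] *)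
Definition H10pair y G := [/\ L2 y, forall i, L2 (G i) &
  forall e, 0 < e -> exists2 phi, test_function Omega phi &
    n2 (fun x => y x - phi x) < e /\
    forall i, n2 (fun x => G i x - partial i phi x) < e].

(** Both sides of the defining identity of a weak gradient are continuous in L2, so a pair that can
    be approximated by weakly differentiable functions inherits it. *)
Lemma ip_test_limit u G : L2 u -> (forall i, L2 (G i)) ->
  (forall e, 0 < e -> exists2 y : fct * ('I_n -> fct), weak_gradient Omega y.1 y.2 /\ L2 y.1 &
    n2 (fun x => u x - y.1 x) < e /\ forall i, n2 (fun x => G i x - y.2 i x) < e) ->
  weak_gradient Omega u G.
Proof.
move=> lu lG h; split=> [i|psi tpsi i]; first exact/inL2P.
have lpsi := test_L2 tpsi; have ldpsi := test_L2 (test_partial i tpsi).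
rewrite !dotL2E; apply/eqP; rewrite -subr_eq0 opprK -normr_le0.
apply/ler_addgt0Pr => e e0; rewrite add0r.
pose C := n2 (partial i psi) + n2 psi + 1.
have C0 : 0 < C by rewrite ltr_wpDl// addr_ge0 ?n2_ge0.
have [[y H] /= [wy ly] [h1 h2]] := h (e / C) (divr_gt0 e0 C0).
have lH := weak_gradient_L2 i wy.
have : ip y (partial i psi) = - ip (H i) psi by case: wy => _ /(_ _ tpsi i).
move=> yH.
have -> : ip u (partial i psi) + ip (G i) psi =
  ip (fun x => u x - y x) (partial i psi) + ip (fun x => G i x - H i x) psi.
  by rewrite !ipBl// yH; ring.
apply: (le_trans (ler_normD _ _)).
have k1 := ip_CS mO (L2B mO lu ly) ldpsi; have k2 := ip_CS mO (L2B mO (lG i) lH) lpsi.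
apply: (le_trans (lerD k1 k2)).
apply: (@le_trans _ _ (e / C * n2 (partial i psi) + e / C * n2 psi)).
  by apply: lerD; rewrite ler_wpM2r ?n2_ge0// ltW.
rewrite -mulrDr -[leRHS](@divfK _ C) ?gt_eqF// ler_wpM2l ?divr_ge0 ?ltW//.
by rewrite /C ltrDl.
Qed.

Lemma H10pair_weak_gradient y G : H10pair y G -> weak_gradient Omega y G.
Proof.
move=> [ly lG h]; apply: ip_test_limit => // e e0.
have [phi tphi [h1 h2]] := h e e0.
exists (phi, fun i => partial i phi) => //; split; last exact: test_L2.
exact: test_weak_gradient.
Qed.

Lemma normH1E y G : L2 y -> weak_gradient Omega y G ->
  normH1 Omega y = Num.sqrt (n2 y ^+ 2 + \sum_i n2 (G i) ^+ 2).
Proof.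
move=> ly wy; rewrite /normH1 normL2E//; congr (Num.sqrt (_ + _)).
apply: eq_bigr => i _; have wg := weak_gradient_grad wy.
have lg := weak_gradient_L2 i wg; have lGi := weak_gradient_L2 i wy.
rewrite normL2E//; congr (_ ^+ 2).
by apply: (n2_eq_ae mO _ _ (grad_ae wy i)); [case: lg|case: lGi].
Qed.

Lemma weak_gradientB y G z H : L2 y -> L2 z -> weak_gradient Omega y G ->
  weak_gradient Omega z H ->
  weak_gradient Omega (fun x => y x - z x) (fun i x => G i x - H i x).
Proof.
move=> ly lz wy wz; split=> [i|psi tpsi i].
  apply/(inL2P _ mO).
  exact: (L2B mO (weak_gradient_L2 i wy) (weak_gradient_L2 i wz)).
have lpsi := test_L2 tpsi; have ldpsi := test_L2 (test_partial i tpsi).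
have l1 := weak_gradient_L2 i wy; have l2 := weak_gradient_L2 i wz.
rewrite !dotL2E !ipBl//; by rewrite -!dotL2E wy.2// wz.2//; ring.
Qed.

Lemma n2_le_normH1 y G : L2 y -> weak_gradient Omega y G ->
  n2 y <= normH1 Omega y /\ forall i, n2 (G i) <= normH1 Omega y.
Proof.
move=> ly wy; rewrite (normH1E ly wy).
have s0 (P : pred 'I_n) : 0 <= \sum_(i | P i) n2 (G i) ^+ 2 by apply: sumr_ge0 => i _; exact: sqr_ge0.
split=> [|i].
  rewrite -[leLHS]ger0_norm ?n2_ge0// -sqrtr_sqr ler_sqrt ?lerDl ?s0//.
  by rewrite addr_ge0 ?sqr_ge0 ?s0.
rewrite -[leLHS]ger0_norm ?n2_ge0// -sqrtr_sqr ler_sqrt; last by rewrite addr_ge0 ?sqr_ge0 ?s0.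
by rewrite (bigD1 i)//= addrCA lerDl addr_ge0 ?sqr_ge0 ?s0.
Qed.

Lemma normH1_le y G : L2 y -> weak_gradient Omega y G ->
  normH1 Omega y <= n2 y + \sum_i n2 (G i).
Proof.
move=> ly wy; rewrite (normH1E ly wy).
have s0 : 0 <= \sum_i n2 (G i) by apply: sumr_ge0 => i _; exact: n2_ge0.
rewrite -[leRHS]ger0_norm ?addr_ge0 ?n2_ge0// -sqrtr_sqr ler_sqrt ?sqr_ge0//.
apply: (@le_trans _ _ (n2 y ^+ 2 + (\sum_i n2 (G i)) ^+ 2)); last first.
  by rewrite sqrrD lerD2r lerDl mulrn_wge0// mulr_ge0// n2_ge0.
rewrite lerD2l; suff [] : \sum_i n2 (G i) ^+ 2 <= (\sum_i n2 (G i)) ^+ 2 /\ 0 <= \sum_i n2 (G i) by [].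
elim/big_rec2 : _ => [|i a b _ [ab a0]]; first by rewrite expr0n.
split; last by rewrite addr_ge0// n2_ge0.
rewrite sqrrD; have := mulr_ge0 (n2_ge0 mu Omega (G i)) a0; lra.
Qed.

Lemma inH10_H10pair y : inH10 Omega y -> H10pair y (grad Omega y).
Proof.
move=> [[ly0 [G wy]] [phi [tphi hphi]]].
have ly : L2 y by exact/(inL2P _ mO).
have wg := weak_gradient_grad wy.
split=> // [i|e e0]; first exact: weak_gradient_L2 wg.
have /cvgr0Pnorm_lt/(_ e e0)[N _ /(_ N (leqnn N))/=] := hphi.
rewrite ger0_norm ?sqrtr_ge0// => hN; exists (phi N) => //.
have tN := tphi N.
have wd := weak_gradientB ly (test_L2 tN) wg (test_weak_gradient tN).
have [h1 h2] := n2_le_normH1 (L2B mO ly (test_L2 tN)) wd.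
by split=> [|i]; [exact: le_lt_trans h1 hN|exact: le_lt_trans (h2 i) hN].
Qed.

Lemma H10pair_seq y G : H10pair y G -> exists phi : nat -> fct,
  [/\ forall k, test_function Omega (phi k),
      n2 (fun x => y x - phi k x) @[k --> \oo] --> (0 : R) &
      forall i, n2 (fun x => G i x - partial i (phi k) x) @[k --> \oo] --> (0 : R)].
Proof.
move=> [ly lG h].
have /choice[phi hphi] : forall k : nat, exists phi, test_function Omega phi /\
   (n2 (fun x => y x - phi x) < k.+1%:R^-1 /\ forall i, n2 (fun x => G i x - partial i phi x) < k.+1%:R^-1).
  by move=> k; have [|phi tphi hphi] := h k.+1%:R^-1; [rewrite invr_gt0|exists phi].
have cv0 (v : nat -> R) : (forall k, 0 <= v k < k.+1%:R^-1) -> v k @[k --> \oo] --> (0 : R).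
  move=> hv; apply: (@squeeze_cvgr _ _ _ _ (cst 0) (fun k => k.+1%:R^-1)).
  - by apply: nearW => k /=; have /andP[-> /ltW ->] := hv k.
  - exact: cvg_cst.
  - exact: cvg_harmonic.
exists phi; split=> [k||i]; first by have [] := hphi k.
- by apply: cv0 => k; rewrite n2_ge0; have [_ []] := hphi k.
- by apply: cv0 => k; rewrite n2_ge0; have [_ [_ ->]] := hphi k.
Qed.

Lemma H10pair_inH10 y G : H10pair y G -> inH10 Omega y.
Proof.
move=> yG; have wy := H10pair_weak_gradient yG; have [ly lG h] := yG.
split; first by split; [exact/inL2P|exists G].
have [phi [tphi h1 h2]] := H10pair_seq yG.
exists phi; split => //.
apply/cvgr0Pnorm_le => e e0; near=> k.
have wd := weak_gradientB ly (test_L2 (tphi k)) wy (test_weak_gradient (tphi k)).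
rewrite ger0_norm ?sqrtr_ge0//.
apply: le_trans (normH1_le (L2B mO ly (test_L2 (tphi k))) wd) _.
near: k.
have cv : n2 (fun x => y x - phi k x) +
    \sum_i n2 (fun x => G i x - partial i (phi k) x) @[k --> \oo] --> 0 + \sum_(i < n) (0 : R).
  by apply: cvgD => //; apply: cvg_big => [|i _]; [exact: add_continuous|exact: h2].
rewrite big1// addr0 in cv.
have /cvgr0Pnorm_le/(_ e e0) := cv; apply: filterS => k.
by apply: le_trans; exact: ler_norm.
Unshelve. all: by end_near. Qed.

Lemma n2_sub u v : L2 u -> L2 v -> `|n2 u - n2 v| <= n2 (fun x => u x - v x).
Proof.
move=> lu lv; rewrite ler_norml lerBlDr; apply/andP; split.
  rewrite lerNl opprB lerBlDr.
  rewrite (@eq_n2 _ _ _ mu Omega v (fun x => (v x - u x) + u x)); last by move=> x _; rewrite subrK.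
  apply: (le_trans (n2D mO (L2B mO lv lu) lu)); rewrite lerD2r -n2N.
  by rewrite (@eq_n2 _ _ _ mu Omega (fun x => - (v x - u x)) (fun x => u x - v x))// => x _; rewrite opprB.
rewrite (@eq_n2 _ _ _ mu Omega u (fun x => (u x - v x) + v x)); last by move=> x _; rewrite subrK.
by apply: (le_trans (n2D mO (L2B mO lu lv) lv)); rewrite lerD2r.
Qed.

Lemma n2_cvg u (v : nat -> fct) : L2 u -> (forall k, L2 (v k)) ->
  n2 (fun x => u x - v k x) @[k --> \oo] --> (0 : R) -> n2 (v k) @[k --> \oo] --> n2 u.
Proof.
move=> lu lv h; apply/cvgrPdist_le => e e0.
have /cvgr0Pnorm_le/(_ e e0) := h; apply: filterS => k.
rewrite ger0_norm ?n2_ge0//; apply: le_trans; exact: n2_sub.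
Qed.

Lemma H10pairD c y G z H : H10pair y G -> H10pair z H ->
  H10pair (fun x => c * y x + z x) (fun i x => c * G i x + H i x).
Proof.
move=> [ly lG hy] [lz lH hz]; split; first exact: (L2D mO (L2Z mO c ly) lz).
  by move=> i; exact: (L2D mO (L2Z mO c (lG i)) (lH i)).
move=> e e0; pose d := e / (2 * (`|c| + 1)).
have c0 : 0 < `|c| + 1 by rewrite ltr_wpDl.
have d0 : 0 < d by rewrite divr_gt0// mulr_gt0.
have cd : `|c| * d <= e / 2.
  rewrite (_ : `|c| * d = e / 2 * (`|c| / (`|c| + 1))); last first.
    by rewrite /d; field; rewrite gt_eqF.
  apply: ler_piMr; first by rewrite divr_ge0// ltW.
  by rewrite ler_pdivrMr// mul1r lerDl.
have e20 : 0 < e / 2 by rewrite divr_gt0.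
have [phi tphi [p1 p2]] := hy d d0; have [psi tpsi [q1 q2]] := hz (e / 2) e20.
exists (fun x => c * phi x + psi x); first exact: test_comb.
have key u v u' v' : L2 u -> L2 v -> L2 u' -> L2 v' -> n2 (fun x => u x - v x) < d -> n2 (fun x => u' x - v' x) < e / 2 ->
  n2 (fun x => c * u x + u' x - (c * v x + v' x)) < e.
  move=> lu lv lu' lv' h1 h2.
  rewrite (@eq_n2 _ _ _ mu Omega _ (fun x => c * (u x - v x) + (u' x - v' x))); last by move=> x _; ring.
  apply: (le_lt_trans (n2D mO (L2Z mO c (L2B mO lu lv)) (L2B mO lu' lv'))).
  rewrite n2Z//; last exact: L2B.
  rewrite [ltRHS]splitr ler_ltD//; apply: le_trans cd.
  by rewrite ler_wpM2l// ltW.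
have ltp := test_L2 tphi; have lts := test_L2 tpsi.
split; first exact: key.
move=> i; rewrite (_ : partial i _ = fun x => c * partial i phi x + partial i psi x).
  by apply: key => //; [exact: (test_L2 (test_partial i tphi))|exact: (test_L2 (test_partial i tpsi))].
apply/funext => x.
have d1 : is_derive x (delta_mx ord0 i) phi (partial i phi x) by apply: smooth_is_derive; case: tphi.
have d2 : is_derive x (delta_mx ord0 i) psi (partial i psi x) by apply: smooth_is_derive; case: tpsi.
by have [_ <-] := @is_deriveD _ _ _ _ _ _ _ _ _ (@is_deriveZ _ _ _ _ c _ _ _ d1) d2.
Qed.

(** Gradients are determined up to null sets; this transports pairs along the almost everywhere
    identities that [grad_ae] provides. *)
Lemma H10pair_ae y G z H : H10pair y G -> L2 z -> (forall i, L2 (H i)) ->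
  aeO (fun x => y x = z x) -> (forall i, aeO (fun x => G i x = H i x)) ->
  H10pair z H.
Proof.
move=> [ly lG h] lz lH yz GH; split => // e e0.
have [phi tphi [h1 h2]] := h e e0; exists phi => //.
have ltp := test_L2 tphi.
split=> [|i].
  rewrite (n2_eq_ae mO (g := fun x => y x - phi x))//.
  - exact: (L2B mO lz ltp).1.
  - exact: (L2B mO ly ltp).1.
  - by apply: aeD_mp yz => x _ ->.
have ltpi := test_L2 (test_partial i tphi).
rewrite (n2_eq_ae mO (g := fun x => G i x - partial i phi x))//.
- exact: (L2B mO (lH i) ltpi).1.
- exact: (L2B mO (lG i) ltpi).1.
- by apply: aeD_mp (GH i) => x _ ->.
Qed.

End H10.

(** * Truncation and Stampacchia's iteration *)

Section flat_bounds.
Context (R : realType).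
Implicit Types (a b s : R).

Lemma lipschitz_derive (f g : R -> R) (C : R) :
  (forall x : R, is_derive x 1 f (g x)) -> (forall x, `|g x| <= C) ->
  forall a b, `|f a - f b| <= C * `|a - b|.
Proof.
move=> df gC a b; wlog ab : a b / b <= a.
  move=> W; have [|/ltW] := leP b a; first exact: W.
  by move=> /W; rewrite distrC [`|b - a|]distrC.
move: ab; rewrite le_eqVlt => /predU1P[->|ba]; first by rewrite !subrr normr0 mulr0.
have cf : {within `[b, a], continuous f}.
  by apply: derivable_within_continuous => x _; have [] := df x.
have [c _ ->] := MVT ba (fun x _ => df x) cf.
by rewrite normrM ler_wpM2r.
Qed.

(** With t = 1/s the claim is t^2 <= e^t. As e^(t/4) >= 1 + t/4, it follows from (1 + t/4)^2 >= t,
    which is (1 - t/4)^2 >= 0. The value 1, where [flat_le] gives 2, is what makes the truncations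
    1-Lipschitz and allows [energy_coercive] to be applied to their derivatives. *)
Lemma flat2_le1 s : flat 2 s <= 1.
Proof.
rewrite /flat; case: ifPn => // s0; set t := s^-1.
have t0 : 0 <= t by rewrite invr_ge0 ltW.
have -> : - t = - (t / 4) *+ 4 by rewrite -mulr_natr; field.
rewrite -[_ *+ 4]mulr_natl expRM_natl.
have e1 := expR_ge1Dx (t / 4).
rewrite expRN [(expR _)^-1 ^+ _]exprVn ler_pdivrMr ?exprn_gt0 ?expR_gt0// mul1r.
apply: (@le_trans _ _ ((1 + t / 4) ^+ 4)); last first.
  by rewrite lerXn2r ?nnegrE ?expR_ge0// addr_ge0// divr_ge0.
have -> : (1 + t / 4) ^+ 4 = ((1 + t / 4) ^+ 2) ^+ 2 by rewrite -exprM.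
rewrite lerXn2r ?nnegrE ?sqr_ge0//.
have := sqr_ge0 (1 - t / 4); nra.
Qed.

Lemma flat0_lipschitz a b : `|flat 0 a - flat 0 b| <= `|a - b|.
Proof.
rewrite -[leRHS]mul1r; apply: (lipschitz_derive (g := flat 2)) => x.
  by have := is_derive_flat 0 x; rewrite mul0r subr0.
by rewrite ger0_norm ?flat_ge0// flat2_le1.
Qed.

(** The derivative is [flat 4 - 2 * flat 3], and 36 = 4! + 2 * 3!. *)
Lemma flat2_lipschitz a b : `|flat 2 a - flat 2 b| <= 36 * `|a - b|.
Proof.
apply: (lipschitz_derive (g := fun x => flat 4 x - 2 * flat 3 x)) => x.
  exact: is_derive_flat.
have := flat_le 4 x; have := flat_le 3 x; have := flat_ge0 4 x; have := flat_ge0 3 x.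
rewrite (_ : 4`! = 24)%N// (_ : 3`! = 6)%N// => h1 h2 h3 h4.
by rewrite ler_norml; apply/andP; split; lra.
Qed.

Lemma measurable_flat d (T : measurableType d) (D : set T) m (f : T -> R) :
  measurable_fun D f -> measurable_fun D (fun x => flat m (f x)).
Proof.
by move=> mf; apply: (measurableT_comp _ mf); apply: continuous_measurable_fun; exact: flat_continuous.
Qed.

End flat_bounds.

Section truncation.
Context (R : realType) (n : nat) (Omega : set 'rV[R]_n).
Local Notation mu := (lebesgue_rV R n).
Local Notation fct := ('rV[R]_n -> R).
Local Notation L2 := (L2 mu Omega).
Local Notation n2 := (n2 mu Omega).
Local Notation ip := (ip mu Omega).
Local Notation aeO := (aeD mu Omega).
Hypotheses (oO : open Omega) (bO : bounded_set Omega).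
Implicit Types (u v y f : fct) (G H : 'I_n -> fct) (k th : R).

Let mO : measurable Omega. Proof. exact: open_measurable_rV. Qed.
Let fO : (mu Omega < +oo)%E. Proof. exact: bounded_set_lty. Qed.

(* a smooth substitute for the truncation (s - k)^+, vanishing for s <= k *)
Definition strunc k th (s : R) : R := th * flat 0 ((s - k) / th).
Definition strunc' k th (s : R) : R := flat 2 ((s - k) / th).

Lemma strunc_ge0 k th s : 0 < th -> 0 <= strunc k th s.
Proof. by move=> th0; rewrite mulr_ge0 ?flat_ge0// ltW. Qed.

Lemma strunc_eq0 k th s : 0 < th -> s <= k -> strunc k th s = 0.
Proof.
by move=> th0 sk; rewrite /strunc flat0 ?mulr0// mulr_le0_ge0 ?subr_le0// invr_ge0 ltW.
Qed.

Lemma strunc'_ge0 k th s : 0 <= strunc' k th s.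
Proof. exact: flat_ge0. Qed.

Lemma strunc'_le1 k th s : strunc' k th s <= 1.
Proof. exact: flat2_le1. Qed.

Lemma strunc_lipschitz k th s t : 0 < th ->
  `|strunc k th s - strunc k th t| <= `|s - t|.
Proof.
move=> th0; rewrite /strunc -mulrBr normrM gtr0_norm//.
apply: (le_trans (ler_wpM2l (ltW th0) (flat0_lipschitz _ _))).
by rewrite -mulrBl normrM (@gtr0_norm _ th^-1) ?invr_gt0// opprB addrA subrK mulrCA divff ?gt_eqF// mulr1.
Qed.

Lemma strunc_le k th s : 0 <= k -> 0 < th -> `|strunc k th s| <= `|s|.
Proof.
move=> k0 th0; have := @strunc_lipschitz k th s 0 th0.
by rewrite (@strunc_eq0 k th 0)// !subr0.
Qed.

Lemma strunc_ge k th s : 0 < th -> k + th <= s -> th * flat 0 (1 : R) <= strunc k th s.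
Proof.
move=> th0 ks; rewrite ler_wpM2l ?(ltW th0)//.
have h : 1 <= (s - k) / th by rewrite ler_pdivlMr// mul1r lerBrDl.
have h0 : 0 < (s - k) / th by rewrite (lt_le_trans _ h).
rewrite /flat ltr01 h0 /= !expr0 !mul1r ler_expR invr1 lerN2.
by rewrite invf_le1.
Qed.

Lemma strunc'_lipschitz k th s t : 0 < th ->
  `|strunc' k th s - strunc' k th t| <= 36 / th * `|s - t|.
Proof.
move=> th0; apply: (le_trans (flat2_lipschitz _ _)).
rewrite -mulrBl normrM (@gtr0_norm _ th^-1) ?invr_gt0// opprB addrA subrK.
by rewrite -!mulrA [_^-1 * _]mulrC.
Qed.

Lemma measurable_strunc D k th f : measurable_fun D f ->
  measurable_fun D (fun x => strunc k th (f x)).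
Proof.
move=> mf; apply: measurable_funM => //; apply: measurable_flat.
by apply: measurable_funM => //; exact: measurable_funB.
Qed.

Lemma measurable_strunc' D k th f : measurable_fun D f ->
  measurable_fun D (fun x => strunc' k th (f x)).
Proof.
move=> mf; apply: measurable_flat.
by apply: measurable_funM => //; exact: measurable_funB.
Qed.

Lemma partial_strunc phi k th i x : 0 < th -> test_function Omega phi ->
  partial i (fun x => strunc k th (phi x)) x = strunc' k th (phi x) * partial i phi x.
Proof.
move=> th0 [sphi _].
have d1 := smooth_is_derive x i sphi.
have d2 : is_derive (phi x) 1 (strunc k th) (strunc' k th (phi x)).
  have da : is_derive (phi x) 1 (fun s : R => (s - k) / th) th^-1.
    have h : is_derive (phi x) (1 : R) ( *:%R th^-1 \o (fun s : R => s - k)) (th^-1 *: (1 - 0)).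
      by apply: is_deriveZ; apply: is_deriveB.
    move: h; rewrite subr0 /GRing.scale/= mulr1.
    by rewrite (_ : _ \o _ = fun s : R => (s - k) / th)//; apply/funext => s /=; rewrite mulrC.
  have := @is_derive_comp R R (flat 0) (fun s => (s - k) / th) (phi x) 1 _ _ (is_derive_flat 0 ((phi x - k) / th)) da.
  rewrite mul0r subr0 => /(@is_deriveZ _ _ _ _ th) h.
  rewrite (_ : strunc' k th (phi x) = th *: (flat 2 ((phi x - k) / th) * th^-1)); first exact: h.
  by rewrite /GRing.scale/= mulrCA divff ?mulr1 ?gt_eqF.
by have [_] := is_derive_comp d2 d1.
Qed.

End truncation.

Section stampacchia.
Context (R : realType) (n : nat) (Omega : set 'rV[R]_n).
Local Notation mu := (lebesgue_rV R n).
Local Notation fct := ('rV[R]_n -> R).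
Local Notation L2 := (L2 mu Omega).
Local Notation n2T := (n2 mu setT).
Local Notation n2 := (n2 mu Omega).
Local Notation ip := (ip mu Omega).
Local Notation aeO := (aeD mu Omega).
Hypotheses (oO : open Omega) (bO : bounded_set Omega).
Implicit Types (u v y f g : fct) (G H : 'I_n -> fct) (k th : R).

Let mO : measurable Omega. Proof. exact: open_measurable_rV. Qed.
Let fO : (mu Omega < +oo)%E. Proof. exact: bounded_set_lty. Qed.

Lemma L2_strunc k th y : 0 <= k -> 0 < th -> L2 y -> L2 (fun x => strunc k th (y x)).
Proof.
move=> k0 th0 ly; apply: (L2_le mO _ ly).
  by apply: measurable_strunc; case: ly.
by apply: aeD_all => x _; exact: strunc_le.
Qed.

Lemma L2_strunc' k th y g : measurable_fun Omega y -> L2 g ->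
  L2 (fun x => strunc' k th (y x) * g x).
Proof.
move=> my lg; apply: (L2_bddM mO (c := 1)) => //; first exact: measurable_strunc'.
by apply: aeD_all => x _; rewrite ger0_norm ?strunc'_ge0 ?strunc'_le1.
Qed.

Lemma test_grad_bounded phi : test_function Omega phi ->
  exists2 C, 0 < C & forall i x, `|partial i phi x| <= C.
Proof.
move=> tphi; have /choice[C hC] : forall i, exists C, 0 < C /\ forall x, `|partial i phi x| <= C.
  by move=> i; have [C C0 h] := test_bounded (test_partial i tphi); exists C.
exists (1 + \sum_i C i).
  by rewrite ltr_pwDl// sumr_ge0// => i _; have [/ltW] := hC i.
move=> i x; have [_ h] := hC i; apply: (le_trans (h x)).
rewrite (bigD1 i)//= addrCA lerDl addr_ge0// sumr_ge0// => j _.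
by have [/ltW] := hC j.
Qed.

Lemma quarters (e a b c d : R) : 0 < e -> d <= b + c -> a < e / 4 -> b < e / 4 ->
  c <= e / 4 -> a + d < e.
Proof. lra. Qed.

(** A product of an L2 function with the merely square integrable G need not be small in L2, so the
    Lipschitz bound for [strunc'] cannot be used against G itself. A fixed test function phi0 with
    bounded gradient is put in between; the approximation phi is chosen afterwards, close enough to
    y for the bound C of that gradient. *)
Lemma H10pair_strunc y G k th : 0 <= k -> 0 < th -> H10pair Omega y G ->
  H10pair Omega (fun x => strunc k th (y x)) (fun i x => strunc' k th (y x) * G i x).
Proof.
move=> k0 th0 [ly lG h].
have my : measurable_fun Omega y by case: ly.
split; first exact: L2_strunc.
  by move=> i; exact: L2_strunc'.
move=> e e0; have e4 : 0 < e / 4 by rewrite divr_gt0.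
have [phi0 tphi0 [_ h0]] := h _ e4.
have [C C0 hC] := test_grad_bounded tphi0.
pose L := 36 / th * C.
have L0 : 0 < L by rewrite mulr_gt0// divr_gt0.
pose d := Num.min (e / 4) (e / 4 / L).
have d0 : 0 < d by rewrite lt_min e4 divr_gt0.
have d1 : d <= e / 4 by rewrite ge_min lexx.
have d2 : L * d <= e / 4 by rewrite mulrC -ler_pdivlMr// ge_min lexx orbT.
have [phi tphi [p1 p2]] := h d d0.
have lphi := test_L2 oO bO tphi.
exists (fun x => strunc k th (phi x)); first exact: test_flat.
split.
  apply: (@le_lt_trans _ _ (n2 (fun x => y x - phi x))); last first.
    by rewrite (lt_le_trans p1)// (le_trans d1)//; lra.
  apply: (n2_le mO); [apply: (L2B mO); exact: L2_strunc|exact: (L2B mO)|].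
  by apply: aeD_all => x _; exact: strunc_lipschitz.
move=> i; have lGi := lG i.
have tpi := test_L2 oO bO (test_partial i tphi).
have tpi0 := test_L2 oO bO (test_partial i tphi0).
have mphi : measurable_fun Omega phi by case: lphi.
(* A and B are small because phi and phi0 approximate the gradient, D because y - phi is small and
   the gradient of phi0 is bounded. *)
pose A := fun x => strunc' k th (phi x) * (G i x - partial i phi x).
pose B := fun x => (strunc' k th (y x) - strunc' k th (phi x)) * (G i x - partial i phi0 x).
pose D := fun x => (strunc' k th (y x) - strunc' k th (phi x)) * partial i phi0 x.
have lA : L2 A by apply: L2_strunc' => //; exact: (L2B mO).
have mdiff : measurable_fun Omega (fun x => strunc' k th (y x) - strunc' k th (phi x)).
  by apply: measurable_funB; exact: measurable_strunc'.
have diff1 x : `|strunc' k th (y x) - strunc' k th (phi x)| <= 1.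
  have := strunc'_ge0 k th (y x); have := strunc'_le1 k th (y x).
  have := strunc'_ge0 k th (phi x); have := strunc'_le1 k th (phi x).
  by move=> ? ? ? ?; rewrite ler_norml; apply/andP; split; lra.
have lB : L2 B.
  apply: (L2_bddM mO (c := 1)) => //; last exact: (L2B mO).
  by apply: aeD_all => x _.
have lD : L2 D.
  by apply: (L2_bddM mO (c := 1)) => //; apply: aeD_all => x _.
rewrite (@eq_n2 _ _ _ mu Omega _ (fun x => A x + (B x + D x))); last first.
  by move=> x _; rewrite (partial_strunc _ _ _ th0 tphi) /A /B /D; ring.
have lBD := L2D mO lB lD.
apply: (le_lt_trans (n2D mO lA lBD)).
have nA : n2 A < e / 4.
  apply: le_lt_trans (lt_le_trans (p2 i) d1).
  have := n2_bddM mO ler01 (measurable_strunc' k th mphi) _ (L2B mO lGi tpi).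
  rewrite mul1r; apply; apply: aeD_all => x _.
  by rewrite ger0_norm ?strunc'_ge0 ?strunc'_le1.
have nB : n2 B < e / 4.
  apply: le_lt_trans (h0 i).
  have := n2_bddM mO ler01 mdiff _ (L2B mO lGi tpi0).
  by rewrite mul1r; apply; apply: aeD_all => x _.
have nD : n2 D <= e / 4.
  apply: (@le_trans _ _ (L * n2 (fun x => y x - phi x))); last first.
    by apply: le_trans d2; rewrite ler_wpM2l ?ltW.
  rewrite -[X in X * _](gtr0_norm L0) -n2Z//; last exact: (L2B mO).
  apply: (n2_le mO) => //; first by apply: (L2Z mO); exact: (L2B mO).
  apply: aeD_all => x _; rewrite /D normrM [leRHS]normrM (gtr0_norm L0) /L mulrAC.
  by rewrite ler_pM// strunc'_lipschitz.
exact: (quarters e0 (n2D mO lB lD) nA nB nD).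
Qed.

(** The L2 norms and, on a domain of finite measure, the L1 norm are continuous along an
    approximating sequence, so [nash_le] passes to the limit. *)
Lemma H10pair_nash y G (e : R) : 0 < e -> H10pair Omega y G ->
  e ^+ n * (n2 y ^+ 2 - n2 y * (e * \sum_i n2 (G i))) <= (\int[mu]_(x in Omega) `|y x|) ^+ 2.
Proof.
move=> e0 /[dup] yG /H10pair_seq[phi [tphi h1 h2]]; have [ly lG _] := yG.
have lphi (k : nat) := test_L2 oO bO (tphi k).
have ldphi (k : nat) i := test_L2 oO bO (test_partial i (tphi k)).
have c1 := n2_cvg oO ly lphi h1.
have c2 i := n2_cvg oO (lG i) (ldphi^~ i) (h2 i).
have c3 : \int[mu]_(x in Omega) `|phi k x| @[k --> \oo] --> \int[mu]_(x in Omega) `|y x|.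
  apply/cvgrPdist_le => e1 e10.
  pose M := Num.sqrt (fine (mu Omega)) + 1.
  have M0 : 0 < M by rewrite ltr_wpDl ?sqrtr_ge0.
  have /cvgr0Pnorm_le/(_ (e1 / M) (divr_gt0 e10 M0)) := h1; apply: filterS => k.
  rewrite ger0_norm ?n2_ge0// => hk.
  have l1 : L1 mu Omega (fun x => `|y x|) by exact/L1_norm/(L2_L1 mO fO).
  have l3 : L1 mu Omega (fun x => `|phi k x|) by exact/L1_norm/(L2_L1 mO fO).
  rewrite -RintegralB//; apply: (le_trans (le_normr_Rintegral mO (L1B mO l1 l3))).
  apply: (@le_trans _ _ (\int[mu]_(x in Omega) `|y x - phi k x|)).
    apply: (Int_le_ae mO); first exact: (L1_norm (L1B mO l1 l3)).
      exact: (L1_norm (L2_L1 mO fO (L2B mO ly (lphi k)))).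
    by apply: aeD_all => x _; exact: ler_dist_dist.
  apply: (le_trans (Int_norm_le mO fO (L2B mO ly (lphi k)))).
  apply: (@le_trans _ _ (M * n2 (fun x => y x - phi k x))).
    by rewrite ler_wpM2r ?n2_ge0// lerDl.
  by rewrite mulrC -ler_pdivlMr.
have ineq (k : nat) : e ^+ n * (n2 (phi k) ^+ 2 - n2 (phi k) * (e * \sum_i n2 (partial i (phi k))))
    <= (\int[mu]_(x in Omega) `|phi k x|) ^+ 2.
  have t0 := fun x => test_eq0 (x := x) (tphi k).
  rewrite (Int_extend (f := fun x => `|phi k x|)); last by move=> x /t0 ->; rewrite normr0.
  rewrite n2_extend// (eq_bigr (fun i => n2T (partial i (phi k)))); last first.
    move=> i _; apply: n2_extend => x nx.
    exact: (test_eq0 (test_partial i (tphi k)) nx).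
  apply: nash_le => //.
  - exact: (test_bsup bO (tphi k)).
  - by move=> i; exact: (test_bsup bO (test_partial i (tphi k))).
  - by move=> i x; apply: smooth_is_derive; case: (tphi k).
have cl : e ^+ n * (n2 (phi k) ^+ 2 - n2 (phi k) * (e * \sum_i n2 (partial i (phi k)))) @[k --> \oo]
   --> e ^+ n * (n2 y ^+ 2 - n2 y * (e * \sum_i n2 (G i))).
  apply: cvgM; first exact: cvg_cst.
  apply: cvgB; first by apply: cvgM.
  apply: cvgM => //; apply: cvgM; first exact: cvg_cst.
  by apply: cvg_big => [|i _]; [exact: add_continuous|exact: c2].
have cr : (\int[mu]_(x in Omega) `|phi k x|) ^+ 2 @[k --> \oo] --> (\int[mu]_(x in Omega) `|y x|) ^+ 2.
  by apply: cvgM.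
rewrite -subr_ge0; apply: (cvgr_to_ge (cvgB cr cl)).
by apply: nearW => k; rewrite /= subr_ge0.
Qed.

(** In the applications m bounds the measure of the set where y is nonzero, and the hypothesis on
    the L1 norm is Cauchy-Schwarz. Once e^n >= 2m, the right side of the Nash inequality is at most
    half of e^n |y|^2 and is absorbed. *)
Lemma H10pair_faber_krahn y G (e m : R) : 0 < e -> 0 <= m -> H10pair Omega y G ->
  (\int[mu]_(x in Omega) `|y x|) ^+ 2 <= m * n2 y ^+ 2 -> 2 * m <= e ^+ n ->
  n2 y <= 2 * e * \sum_i n2 (G i).
Proof.
move=> e0 m0 yG ym me; have := H10pair_nash e0 yG; set g := \sum_i _.
set a := n2 y => h; have a0 : 0 <= a by exact: n2_ge0.
have en0 : 0 < e ^+ n by rewrite exprn_gt0.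
rewrite leNgt; apply/negP => ga.
have a1 : 0 < a.
  have g0 : 0 <= g by apply: sumr_ge0 => i _; exact: n2_ge0.
  by apply: le_lt_trans ga; rewrite !mulr_ge0// ltW.
have h2 : e ^+ n * (a ^+ 2 - a * (e * g)) <= e ^+ n * (a ^+ 2 / 2).
  apply: (le_trans h); apply: (le_trans ym); rewrite -subr_ge0.
  have -> : e ^+ n * (a ^+ 2 / 2) - m * a ^+ 2 = (e ^+ n - 2 * m) * (a ^+ 2 / 2) by field.
  by rewrite mulr_ge0 ?subr_ge0// divr_ge0// sqr_ge0.
rewrite ler_pM2l// in h2.
have : a * (a - 2 * e * g) <= 0 by nra.
by rewrite pmulr_rle0// subr_le0 leNgt ga.
Qed.

Definition level y k : set 'rV[R]_n := Omega `&` [set x | k < y x].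

Lemma measurable_level y k : measurable_fun Omega y -> measurable (level y k).
Proof.
move=> my; rewrite /level (_ : [set x | k < y x] = y @^-1` `]k, +oo[%classic); first exact: my.
by apply/seteqP; split => x /=; rewrite in_itv/= andbT.
Qed.

Lemma level_fin y k : measurable_fun Omega y -> mu (level y k) \is a fin_num.
Proof.
move=> my; have mk := measurable_level k my; rewrite ge0_fin_numE//.
apply: le_lt_trans fO; apply: le_measure; rewrite ?inE//; exact: subIsetl.
Qed.

Lemma Int_level y k : measurable_fun Omega y ->
  L1 mu Omega (fun x => \1_(level y k) x : R) /\
  \int[mu]_(x in Omega) (\1_(level y k) x : R) = fine (mu (level y k)).
Proof.
move=> my; have mk := measurable_level k my; split.
  apply: (L2_L1 mO fO); apply: (L2_bdd mO fO (c := 1)).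
    exact: measurable_indic.
  by apply: aeD_all => x _; rewrite indicE; case: (_ \in _); rewrite ?normr1 ?normr0.
rewrite /Rintegral integral_indic// setIidl//; exact: subIsetl.
Qed.

(** The truncation vanishes off the level set of measure at most r^2, so its L1 norm is at most r
    times its L2 norm; the Poincare inequality for small supports, inserted into the energy bound,
    controls the latter by e^2 N. On the next level set the truncation is at least
    [th * flat 0 1]. *)
Lemma level_step y G g (lam N e r k th : R) : 0 < lam -> 0 < N -> 0 < e -> 0 <= r ->
  0 <= k -> 0 < th -> H10pair Omega y G -> L2 g -> n2 g <= N ->
  (forall i, lam * n2 (fun x => strunc' k th (y x) * G i x) ^+ 2 <=
    ip g (fun x => strunc k th (y x))) ->
  fine (mu (level y k)) <= r ^+ 2 -> 2 * r ^+ 2 <= e ^+ n ->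
  th * flat 0 (1 : R) * fine (mu (level y (k + th))) <=
    r * (4 * n%:R ^+ 2 / lam * e ^+ 2 * N).
Proof.
move=> lam0 N0 e0 r0 k0 th0 yG lg gN hk mr re; have [ly _ _] := yG.
have my : measurable_fun Omega y by case: ly.
have wH := H10pair_strunc k0 th0 yG.
set w := (X in H10pair _ X _) in wH; have [lw _ _] := wH.
have lw1 : L1 mu Omega (fun x => `|w x|) by exact/L1_norm/(L2_L1 mO fO).
set b := \int[mu]_(x in Omega) `|w x|.
have a0 : 0 <= n2 w by exact: n2_ge0.
have b0 : 0 <= b by apply: Rintegral_ge0.
have [li Ii] := Int_level k my.
have l2i : L2 (fun x => \1_(level y k) x).
  apply: (L2_bdd mO fO (c := 1)); first by apply: measurable_indic; exact: measurable_level.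
  by apply: aeD_all => x _; rewrite indicE; case: (_ \in _); rewrite ?normr1 ?normr0.
have bw : b <= r * n2 w.
  have -> : b = ip (fun x => \1_(level y k) x) (fun x => `|w x|).
    apply: eq_Int => x Ox; rewrite indicE; case: (boolP (x \in level y k)) => [_|]; first by rewrite mul1r.
    rewrite notin_setE => h; rewrite mul0r /w strunc_eq0 ?normr0//.
    by rewrite leNgt; apply/negP => kx; apply: h.
  apply: (le_trans (ler_norm _)); apply: (le_trans (ip_CS mO l2i (L2_norm mO lw))).
  rewrite n2_abs ler_wpM2r// -[leRHS](ger0_norm r0) -sqrtr_sqr ler_sqrt ?sqr_ge0//.
  apply: le_trans mr; rewrite -Ii le_eqVlt; apply/predU1P; left.
  by apply: eq_Int => x _; rewrite indicE; case: (_ \in _); rewrite ?mulr1 ?mulr0.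
have aK : n2 w <= 4 * n%:R ^+ 2 / lam * e ^+ 2 * N.
  have a1 : n2 w <= 2 * e * \sum_i n2 (fun x => strunc' k th (y x) * G i x).
    apply: (H10pair_faber_krahn e0 (sqr_ge0 r) wH) => //.
    by rewrite -exprMn ler_pXn2r ?nnegrE// mulr_ge0.
  set q := Num.sqrt (N * n2 w / lam).
  have q0 : 0 <= N * n2 w / lam by rewrite divr_ge0 ?mulr_ge0// ltW.
  have hq i : n2 (fun x => strunc' k th (y x) * G i x) <= q.
    rewrite -[leLHS]ger0_norm ?n2_ge0// -sqrtr_sqr ler_sqrt// ler_pdivlMr// mulrC.
    apply: (le_trans (hk i)); apply: (le_trans (ler_norm _)).
    by apply: (le_trans (ip_CS mO lg lw)); rewrite ler_wpM2r.
  have a2 : n2 w <= 2 * e * (n%:R * q).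
    apply: (le_trans a1); rewrite ler_wpM2l ?mulr_ge0 ?(ltW e0)//.
    apply: (le_trans (ler_sum _ (fun i _ => hq i))).
    by rewrite sumr_const card_ord mulr_natl.
  have qq : q ^+ 2 = N * n2 w / lam by rewrite sqr_sqrtr.
  have [->|aN0] := eqVneq (n2 w) 0.
    by rewrite !mulr_ge0 ?invr_ge0 ?sqr_ge0// ltW.
  have a3 : 0 < n2 w by rewrite lt_def aN0.
  (* [a2] bounds the norm by a multiple of its own square root; multiplying the claim by the norm
     reduces it to the square of this bound. *)
  rewrite -(ler_pM2r a3).
  apply: (@le_trans _ _ ((2 * e * (n%:R * q)) ^+ 2)).
    by rewrite -expr2 ler_pXn2r ?nnegrE// (le_trans a0 a2).
  rewrite !exprMn qq le_eqVlt; apply/predU1P; left; field.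
  by rewrite gt_eqF.
have lb : th * flat 0 1 * fine (mu (level y (k + th))) <= b.
  have [lj <-] := Int_level (k + th) my.
  rewrite -RintegralZl//; apply: (Int_le_ae mO) => //; first exact: (L1Z mO).
  apply: aeD_all => x Ox; rewrite indicE.
  case: (boolP (x \in level y (k + th))) => [/set_mem[_ /= kx]|_]; last by rewrite mulr0.
  by rewrite mulr1 ger0_norm ?strunc_ge0// strunc_ge// ltW.
by apply: (le_trans lb); apply: (le_trans bw); rewrite ler_wpM2l.
Qed.

Hypothesis n03 : (0 < n <= 3)%N.

(* Stampacchia's iteration: [|{y > k_j}|] decays like [2^{-6j}] along
   [k_j = k0 + (1 - 2^{-j}) C s N]. *)
Lemma stampacchia (lam M : R) : 0 < lam -> exists2 C, 0 < C &
  forall y G g (k0 s N : R), H10pair Omega y G -> L2 g -> 0 <= k0 ->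
    0 < s <= M -> 0 < N -> n2 g <= N ->
    (forall k th, k0 <= k -> 0 < th -> forall i,
      lam * n2 (fun x => strunc' k th (y x) * G i x) ^+ 2 <=
      ip g (fun x => strunc k th (y x))) ->
    fine (mu (level y k0)) <= s ^+ 6 ->
    aeO (fun x => y x <= k0 + C * s * N).
Proof.
move=> lam0; pose B := Num.max 1 (M ^+ 2).
have B1 : 1 <= B by rewrite le_max lexx.
have B0 : 0 < B by rewrite (lt_le_trans ltr01).
(* With t = s^2 p_j^2 <= B the measure bound is t^3 and the length is e = c t. This c gives 2 t^3 <=
   e^n for n = 1, 2, 3 alike; for n < 3 the surplus powers of t are absorbed by B. *)
pose c := 2 * B ^+ 2.
have c1 : 1 <= c.
  by rewrite /c; have := exprn_ege1 2 B1; lra.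
have c0 : 0 < c by rewrite (lt_le_trans ltr01).
have f0 : 0 < flat 0 (1 : R) by exact: flat_gt0.
pose K := 4 * n%:R ^+ 2 / lam.
have K0 : 0 < K by rewrite /K divr_gt0// mulr_gt0// exprn_gt0// ltr0n; case/andP: n03.
(* Both sides of the induction step carry s^7 p_j^7 N. The factor 128 = 2 * 2^6 pays for the halved
   step [th] and for the six halvings in the next measure bound. *)
have [C C0 CE] : exists2 C, 0 < C & C = K * c ^+ 2 * 128 / flat 0 1.
  eexists; last reflexivity.
  by rewrite divr_gt0// mulr_gt0// mulr_gt0// exprn_gt0.
exists C => // y G g k0 s N yG lg k00 /andP[s0 sM] N0 gN hyp m0.
have [ly _ _] := yG; have my : measurable_fun Omega y by case: ly.
pose d := C * s * N; have d0 : 0 < d by rewrite mulr_gt0// mulr_gt0.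
pose p (j : nat) : R := 2^-1 ^+ j.
have p0 j : 0 < p j by rewrite /p exprn_gt0 ?invr_gt0.
have p1 j : p j <= 1 by rewrite /p exprn_ile1// ?invr_ge0// invf_le1// ler1n.
pose k j := k0 + d * (1 - p j).
have kk0 j : k0 <= k j by rewrite lerDl mulr_ge0 ?(ltW d0)// subr_ge0.
have key j : fine (mu (level y (k j))) <= (s ^+ 3 * p j ^+ 3) ^+ 2.
  elim: j => [|j IH].
    by rewrite /k /p expr0 subrr mulr0 addr0 expr1n mulr1 -exprM.
  pose e := c * (s ^+ 2 * p j ^+ 2); pose th := d * p j.+1.
  have th0 : 0 < th by rewrite mulr_gt0.
  have pS : p j.+1 = 2^-1 * p j by rewrite /p exprS.
  have kS : k j.+1 = k j + th by rewrite /k /th pS; field.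
  have sp0 : 0 < s ^+ 2 * p j ^+ 2 by rewrite mulr_gt0 ?exprn_gt0.
  have e0 : 0 < e by rewrite mulr_gt0.
  have spB : s ^+ 2 * p j ^+ 2 <= B.
    apply: (@le_trans _ _ (s ^+ 2 * 1)).
      by rewrite ler_wpM2l ?sqr_ge0// expr_le1// ltW.
    rewrite mulr1 le_max; apply/orP; right.
    by rewrite ler_pXn2r ?nnegrE ?(ltW s0)// (le_trans (ltW s0)).
  have re : 2 * (s ^+ 3 * p j ^+ 3) ^+ 2 <= e ^+ n.
    have -> : (s ^+ 3 * p j ^+ 3) ^+ 2 = (s ^+ 2 * p j ^+ 2) ^+ 3.
      by ring.
    move: sp0 spB; rewrite /e; move: (s ^+ 2 * p j ^+ 2) => t t0 tB.
    have cB : 2 * B ^+ 2 <= c by [].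
    have t2B : t ^+ 2 <= B ^+ 2 by rewrite ler_pXn2r ?nnegrE ?(ltW t0) ?(ltW B0).
    have BB : B <= B ^+ 2 by rewrite expr2 ler_peMr// ltW.
    case: (n) n03 => [//|[|[|[|//]]]] _.
    - rewrite expr1 exprSr mulrA ler_pM2r// (le_trans _ cB)// ler_wpM2l//.
    - rewrite exprMn [t ^+ 3]exprS mulrA ler_pM2r ?exprn_gt0//.
      have : c <= c ^+ 2 by rewrite expr2 ler_peMr// ltW.
      by apply: le_trans; apply: le_trans cB; rewrite ler_wpM2l// (le_trans tB).
    - rewrite exprMn ler_pM2r ?exprn_gt0//.
      have : c <= c ^+ 3 by rewrite -[leLHS]expr1 ler_weXn2l.
      apply: le_trans; apply: le_trans cB; rewrite -[leLHS]mulr1 ler_wpM2l//.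
      by rewrite (le_trans B1).
  have kj0 : 0 <= k j by rewrite (le_trans k00).
  have r0 : 0 <= s ^+ 3 * p j ^+ 3 by rewrite mulr_ge0 ?exprn_ge0 ?ltW.
  have := level_step lam0 N0 e0 r0 kj0 th0 yG lg gN (hyp _ _ (kk0 j) th0) IH re.
  rewrite -kS -/K.
  have -> : s ^+ 3 * p j ^+ 3 * (K * e ^+ 2 * N) =
     th * flat 0 1 * (s ^+ 3 * p j.+1 ^+ 3) ^+ 2.
    rewrite /th /e /d CE pS; field.
    by rewrite !gt_eqF.
  by rewrite ler_pM2l// mulr_gt0.
have limit : fine (mu (level y (k0 + d))) <= 0.
  have pcv : s ^+ 6 * p j @[j --> \oo] --> s ^+ 6 * 0.
    apply: cvgM; first exact: cvg_cst.
    by apply: cvg_expr; rewrite ger0_norm ?invr_ge0// invf_lt1// ltr1n.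
  rewrite mulr0 in pcv; apply: (cvgr_to_ge pcv); apply: nearW => j.
  apply: (@le_trans _ _ (fine (mu (level y (k j))))).
    apply: fine_le; rewrite ?level_fin//; apply: le_measure; rewrite ?inE; try exact: measurable_level.
    move=> x [Ox /= h]; split => //=; apply: le_lt_trans h.
    by rewrite /k lerD2l -[leRHS]mulr1 ler_wpM2l ?(ltW d0)// gerBl ltW.
  apply: (le_trans (key j)); rewrite exprMn -!exprM ler_wpM2l ?exprn_ge0 ?(ltW s0)//.
  by rewrite /p ler_wiXn2l ?leq_pmulr ?invr_ge0 ?invf_le1 ?ler1n.
have mu0 : mu (level y (k0 + d)) = 0%E.
  rewrite -[LHS]fineK ?level_fin//; congr EFin.
  by apply/eqP; rewrite eq_le limit fine_ge0.
exists (level y (k0 + d)); split => //; first exact: measurable_level.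
move=> x /= /not_implyP[Ox /negP]; rewrite -ltNge => h.
by split.
Qed.

End stampacchia.

(** * Superposition with a nonlinearity and mean value estimates *)

Section caratheodory.
Context d (T : measurableType d) (R : realType) (D : set T).
Hypothesis mD : measurable D.

(* The superposition is the limit of g(x, floor((k+1) y(x)) / (k+1)). *)
Lemma measurable_superposition (g : T -> R -> R) (y : T -> R) :
  (forall s, measurable_fun D (g ^~ s)) -> (forall x, D x -> continuous (g x)) ->
  measurable_fun D y -> measurable_fun D (fun x => g x (y x)).
Proof.
move=> mg cg my.
pose yk (k : nat) x : R := (Num.floor (k.+1%:R * y x))%:~R / k.+1%:R.
apply: (@measurable_fun_cvg _ _ _ _ (fun k x => g x (yk k x))) => [k|x Dx]; last first.
  suff h : yk k x @[k --> \oo] --> y x by exact: (cvg_comp _ _ h (cg x Dx (y x))).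
  apply/cvgrPdist_le => e e0; near=> k.
  have k0 : (0 : R) < k.+1%:R by rewrite ltr0n.
  have -> : y x - yk k x = (k.+1%:R * y x - (Num.floor (k.+1%:R * y x))%:~R) / k.+1%:R.
    by rewrite /yk; field; rewrite gt_eqF.
  have h1 := floor_le (k.+1%:R * y x); have h2 := floorD1_gt (k.+1%:R * y x).
  rewrite normrM [X in _ * X]gtr0_norm ?invr_gt0// ler_pdivrMr//.
  apply: (@le_trans _ _ 1).
    rewrite ger0_norm ?subr_ge0// lerBlDl ltW//.
    by move: h2; rewrite intrD.
  rewrite -ler_pdivrMl// mulr1; apply: (@le_trans _ _ k%:R); last by rewrite ler_nat.
  near: k; exact: nbhs_infty_ger.
move=> _ B mB.
have -> : D `&` (fun x => g x (yk k x)) @^-1` B = \bigcup_(m : int)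
   ((D `&` y @^-1` `[(m%:~R / k.+1%:R : R), ((m + 1)%:~R / k.+1%:R : R)[%classic) `&`
    (D `&` (g ^~ (m%:~R / k.+1%:R)) @^-1` B)).
  have k0 : (0 : R) < k.+1%:R by rewrite ltr0n.
  apply/seteqP; split => [x [Dx Bx]|x [m _ [[Dx +] [_ Bx]]]].
    exists (Num.floor (k.+1%:R * y x)) => //; split => //; split => //=.
    rewrite in_itv/= ler_pdivrMr// ltr_pdivlMr// [y x * _]mulrC floor_le/=.
    exact: floorD1_gt.
  rewrite /= in_itv/= ler_pdivrMr// ltr_pdivlMr// [y x * _]mulrC => ym; split => //.
  rewrite /= /yk.
  suff -> : Num.floor (k.+1%:R * y x) = m by [].
  by apply/eqP; rewrite floor_eq.
apply: countable_bigcupT_measurable => [|m]; first exact: countableP.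
apply: measurableI; first by apply: my => //; exact: measurable_itv.
exact: mg.
Unshelve. all: by end_near. Qed.

End caratheodory.

Section mean_value.
Context (R : realType).
Implicit Types (g : R -> R) (s M C : R).

Lemma mean_value g s1 s2 : (forall s, derivable g s 1) ->
  exists2 xi, `|xi - s1| <= `|s2 - s1| /\ `|xi| <= Num.max `|s1| `|s2| &
    g s2 - g s1 = derive1 g xi * (s2 - s1).
Proof.
move=> dg.
have dg' (x : R) : is_derive x 1 g (derive1 g x).
  by rewrite derive1E; apply: derivableP; exact: dg.
have cg a b : {within `[a, b], continuous g}.
  by apply: derivable_within_continuous => x _; exact: dg.
have [s12|s21|->] := ltgtP s1 s2; last first.
- exists s2; last by rewrite !subrr mulr0.
  by split; rewrite // le_max lexx.
- have [xi + h] := MVT s21 (fun x _ => dg' x) (cg s2 s1).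
  rewrite in_itv/= => /andP[h1 h2]; exists xi; last by rewrite -opprB h -mulrN opprB.
  split; first by rewrite !ler0_norm ?subr_le0 ?ltW//; lra.
  rewrite le_max; have [x0|x0] := leP 0 xi.
    by rewrite (ger0_norm x0) (le_trans (ltW h2))// ler_norm.
  by rewrite (ltr0_norm x0) [X in _ || X](_ : _ = true) ?orbT// -(normrN s2) (le_trans _ (ler_norm _))// lerN2 ltW.
- have [xi + h] := MVT s12 (fun x _ => dg' x) (cg s1 s2).
  rewrite in_itv/= => /andP[h1 h2]; exists xi => //.
  split; first by rewrite !gtr0_norm ?subr_gt0// lerD2r ltW.
  rewrite le_max; have [x0|x0] := leP 0 xi.
    by rewrite (ger0_norm x0) [X in _ || X](_ : _ = true) ?orbT// (le_trans (ltW h2))// ler_norm.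
  by rewrite (ltr0_norm x0) -(normrN s1) (le_trans _ (ler_norm _))// lerN2 ltW.
Qed.

Lemma taylor2 g M C s1 s2 : (forall s, derivable g s 1) ->
  (forall s, derivable (derive1 g) s 1) ->
  (forall s, `|s| <= M -> `|derive1 (derive1 g) s| <= C) ->
  `|s1| <= M -> `|s2| <= M ->
  `|g s2 - g s1 - derive1 g s1 * (s2 - s1)| <= C * `|s2 - s1| ^+ 2.
Proof.
move=> dg ddg hC s1M s2M.
have [xi [h1 h2] ->] := mean_value s1 s2 dg; rewrite -mulrBl.
have xM : `|xi| <= M by rewrite (le_trans h2)// ge_max s1M s2M.
have [ze [h3 h4] ->] := mean_value s1 xi ddg.
have zM : `|ze| <= M by rewrite (le_trans h4)// ge_max s1M xM.
by rewrite !normrM -mulrA expr2 ler_pM// ?mulr_ge0// ?hC// ler_wpM2r.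
Qed.

Lemma lipschitz1 g M C s1 s2 : (forall s, derivable g s 1) ->
  (forall s, `|s| <= M -> `|derive1 g s| <= C) ->
  `|s1| <= M -> `|s2| <= M -> `|g s2 - g s1| <= C * `|s2 - s1|.
Proof.
move=> dg hC s1M s2M; have [xi [h1 h2] ->] := mean_value s1 s2 dg.
by rewrite normrM ler_wpM2r// hC// (le_trans h2)// ge_max s1M s2M.
Qed.

End mean_value.

Section domain_facts.
Context (R : realType) (n : nat) (Omega : set 'rV[R]_n).
Local Notation mu := (lebesgue_rV R n).
Local Notation fct := ('rV[R]_n -> R).
Local Notation L2 := (L2 mu Omega).
Local Notation n2 := (n2 mu Omega).
Local Notation ip := (ip mu Omega).
Local Notation aeO := (aeD mu Omega).
Hypotheses (oO : open Omega) (bO : bounded_set Omega).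
Implicit Types (u v y f g : fct).

Let mO : measurable Omega. Proof. exact: open_measurable_rV. Qed.
Let fO : (mu Omega < +oo)%E. Proof. exact: bounded_set_lty. Qed.

Lemma within_closure_measurable f : {within closure Omega, continuous f} ->
  measurable_fun Omega f.
Proof.
move=> cf; apply: open_continuous_measurable_rV => //.
rewrite -continuous_open_subspace//.
by apply: continuous_subspaceW cf; exact: subset_closure.
Qed.

Lemma compact_closure : compact (closure Omega).
Proof.
apply: bounded_closed_compact; last exact: closed_closure.
have [r Or] := bounded_set_box bO.
exists `|r|; split; first exact: num_real.
move=> x rx y yO; have x0 : 0 <= x by rewrite (le_trans _ (ltW rx)).
apply/rV_norm_le => // i; rewrite leNgt; apply/negP => xy.
have cc : {for y, continuous (fun z : 'rV[R]_n => `|z ord0 i|)}.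
  by apply: continuous_comp; [exact: coord_continuous|exact: norm_continuous].
have : nbhs y [set z : 'rV[R]_n | x < `|z ord0 i|].
  by apply: (cc [set t | x < t]); apply: open_nbhs_nbhs; split => //; exact: open_gt.
move=> /yO[z [/Or zr /= xz]]; have := zr i; rewrite !mxE => /andP[h1 h2].
have : `|z ord0 i| <= r by rewrite ler_norml ltW.
by move=> /(lt_le_trans xz); rewrite ltNge (le_trans (ler_norm r) (ltW rx)).
Qed.

Lemma within_closure_bounded f : {within closure Omega, continuous f} ->
  exists2 C, 0 < C & forall x, closure Omega x -> `|f x| <= C.
Proof.
move=> cf; have : bounded_set (f @` closure Omega).
  by apply: compact_bounded; apply: continuous_compact cf _; exact: compact_closure.
move=> [M [_ /(_ (`|M| + 1))]]; rewrite (le_lt_trans (ler_norm M)) ?ltrDl//.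
move=> /(_ isT) h; exists (`|M| + 1); first by rewrite ltr_wpDl.
by move=> x Ox; apply: h; exists x.
Qed.

Lemma le_normY y x : {within closure Omega, continuous y} -> closure Omega x ->
  `|y x| <= sup [set `|y x| | x in closure Omega].
Proof.
move=> cy Ox; have [C C0 hC] := within_closure_bounded cy.
apply: ub_le_sup; last by exists x.
by exists C => _ [z Oz <-]; exact: hC.
Qed.

Lemma normY_bounds y : inY Omega y ->
  normH1 Omega y <= normY Omega y /\ forall x, Omega x -> `|y x| <= normY Omega y.
Proof.
move=> [_ cy]; split.
  rewrite lerDl; have [[x0 Ox0]|e] := pselect (closure Omega !=set0).
    by apply: le_trans (le_normY cy Ox0).
  rewrite (_ : [set _ | _ in _] = set0) ?sup0//.
  by apply/seteqP; split => // t [x Ox]; case: e; exists x.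
move=> x Ox; apply: (le_trans (le_normY cy (subset_closure Ox))).
by rewrite lerDr sqrtr_ge0.
Qed.

Lemma inLoo_bounded u : inL Omega +oo%E u -> measurable_fun Omega u /\
  exists2 C, 0 < C & aeO (fun x => `|u x| <= C).
Proof.
rewrite /inL => /andP[/[!inE]/= mu1]; rewrite /finite_norm unlock.
have mu2 : measurable_fun Omega u by apply/(measurable_restrict_fct u mO).
case: ifPn => [_ fin|]; last first.
  (* When the measure of the space is not positive the norm carries no information, but then every
     property holds almost everywhere. *)
  move=> mu0 _; split => //; exists 1 => //.
  exists setT; split => //.
  by apply/eqP; rewrite eq_le measure_ge0 andbT leNgt.
split => //.
have h := ess_sup_ge mu (abse \o (EFin \o (u \_ Omega))).
have [C C0 hC] : exists2 C : R, 0 < C & (ess_sup mu (abse \o (EFin \o (u \_ Omega))) <= C%:E)%E.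
  case: (ess_sup _ _) fin => [r _|//|_]; last by exists 1 => //; rewrite leNye.
  by exists (`|r| + 1); [rewrite ltr_wpDl|rewrite lee_fin (le_trans (ler_norm r))// lerDl].
exists C => //; rewrite /aeD; apply: filterS h => x h Ox.
have := le_trans h hC; rewrite /= lee_fin patchE mem_set//.
Qed.

(** For finite q, |u| <= 1 + |u|^q, and constants are integrable on a bounded domain. *)
Lemma inL_L1 (q : \bar R) u : (1 <= q)%E -> inL Omega q u -> L1 mu Omega u.
Proof.
case: q => [q| |//]; last first.
  move=> _ /inLoo_bounded[mu1 [C C0 hC]].
  exact: (L2_L1 mO fO (L2_bdd mO fO mu1 hC)).
rewrite lee_fin => q1 h; have /andP[/[!inE]/= mu1 _] := h.
have mu2 : measurable_fun Omega u by apply/(measurable_restrict_fct u mO).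
have := Lfun_integrable q1 h => h2.
have h3 : L1 mu Omega (fun x => `|u x| `^ q).
  apply/(integrable_mkcond _ mO).2; apply: eq_integrable h2 => // x _ /=.
  rewrite /patch; case: ifP => // _; rewrite normr0 powR0//.
  by rewrite gt_eqF// (lt_le_trans ltr01).
apply: (L1_le mO mu2 (L1D mO (L1_cst mO fO 1) h3)).
apply: aeD_all => x _; have [h4|h4] := leP `|u x| 1.
  by rewrite (le_trans h4)// lerDl powR_ge0.
by rewrite ler_wpDl// -[leLHS]powRr1// ler_powR// ltW.
Qed.

End domain_facts.

(** * Elliptic equations with monotone terms *)

Section energy_form.
Context (R : realType) (n : nat) (Omega : set 'rV[R]_n).
Local Notation mu := (lebesgue_rV R n).
Local Notation fct := ('rV[R]_n -> R).
Local Notation L2 := (L2 mu Omega).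
Local Notation L1 := (L1 mu Omega).
Local Notation n2 := (n2 mu Omega).
Local Notation ip := (ip mu Omega).
Local Notation aeO := (aeD mu Omega).
Local Notation pair := (H10pair Omega).
Hypotheses (oO : open Omega) (bO : bounded_set Omega) (n03 : (0 < n <= 3)%N).
Implicit Types (u v y g h : fct) (G H : 'I_n -> fct) (k th : R).
Variables (a : 'I_n -> 'I_n -> fct) (lam : R).
Hypothesis ella : elliptic Omega a lam.

Let mO : measurable Omega. Proof. exact: open_measurable_rV. Qed.
Let fO : (mu Omega < +oo)%E. Proof. exact: bounded_set_lty. Qed.
Let lam0 : 0 < lam. Proof. by case: ella. Qed.

(** A form on arbitrary vector fields, so that fields such as [strunc' * G] can be inserted without
    recourse to the choice made by [grad]. *)
Definition energy G H : R :=
  \int[mu]_(x in Omega) (\sum_i \sum_j a i j x * G i x * H j x).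

Lemma coef_bounded : exists2 C, 0 < C & forall i j x, Omega x -> `|a i j x| <= C.
Proof.
have [ca _ _] := ella.
have /choice[C hC] : forall ij : 'I_n * 'I_n, exists C, 0 < C /\ forall x, closure Omega x -> `|a ij.1 ij.2 x| <= C.
  by move=> [i j]; have [C C0 hC] := within_closure_bounded bO (ca i j); exists C.
exists (1 + \sum_ij C ij).
  by rewrite ltr_pwDl// sumr_ge0// => ij _; have [/ltW] := hC ij.
move=> i j x Ox; have [_ h] := hC (i, j); apply: (le_trans (h x (subset_closure Ox))).
rewrite (bigD1 (i, j))//= addrCA lerDl addr_ge0// sumr_ge0// => ij _.
by have [/ltW] := hC ij.
Qed.

Lemma coef_L2 i j g : L2 g -> L2 (fun x => a i j x * g x).
Proof.
move=> lg; have [C C0 hC] := coef_bounded; have [ca _ _] := ella.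
apply: (L2_bddM mO (c := C)) => //; first exact: within_closure_measurable.
by apply: aeD_all => x; exact: hC.
Qed.

Lemma energy_term_L1 i j g h : L2 g -> L2 h -> L1 (fun x => a i j x * g x * h x).
Proof. by move=> lg lh; exact: (L2M mO (coef_L2 i j lg) lh). Qed.

Lemma energy_density_L1 G H : (forall i, L2 (G i)) -> (forall i, L2 (H i)) ->
  L1 (fun x => \sum_i \sum_j a i j x * G i x * H j x).
Proof. by move=> lG lH; apply: (L1_sum mO) => i; apply: (L1_sum mO) => j; exact: energy_term_L1. Qed.

Lemma energyE G H : (forall i, L2 (G i)) -> (forall i, L2 (H i)) ->
  energy G H = \sum_i \sum_j ip (fun x => a i j x * G i x) (H j).
Proof.
move=> lG lH; rewrite /energy (Int_sum mO); last first.
  by move=> i; apply: (L1_sum mO) => j; exact: energy_term_L1.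
by apply: eq_bigr => i _; rewrite (Int_sum mO)// => j; exact: energy_term_L1.
Qed.

Lemma energyDl c G G' H : (forall i, L2 (G i)) -> (forall i, L2 (G' i)) -> (forall i, L2 (H i)) ->
  energy (fun i x => c * G i x + G' i x) H = c * energy G H + energy G' H.
Proof.
move=> lG lG' lH; rewrite /energy -RintegralZl//; last exact: energy_density_L1.
rewrite -RintegralD//; [|exact: (L1Z mO c (energy_density_L1 lG lH))|exact: energy_density_L1].
apply: eq_Int => x _; rewrite mulr_sumr -big_split/=; apply: eq_bigr => i _.
by rewrite mulr_sumr -big_split/=; apply: eq_bigr => j _; ring.
Qed.

Lemma aeO_forall (I : finType) (P : I -> 'rV[R]_n -> Prop) :
  (forall i, aeO (P i)) -> aeO (fun x => forall i, P i x).
Proof.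
move=> h; have : aeO (fun x => forall i, i \in enum I -> P i x).
  elim: (enum I) => [|i s IH]; first exact: aeD_all.
  apply: aeD_mp2 (h i) IH => x _ Pi IH j; rewrite inE => /orP[/eqP ->//|]; exact: IH.
by apply: aeD_mp => x _ hx i; apply: hx; rewrite mem_enum.
Qed.

Lemma eq_energy G G' H H' : (forall i, L2 (G i)) -> (forall i, L2 (H i)) ->
  (forall i, L2 (G' i)) -> (forall i, L2 (H' i)) ->
  (forall i, aeO (fun x => G i x = G' i x)) -> (forall i, aeO (fun x => H i x = H' i x)) ->
  energy G H = energy G' H'.
Proof.
move=> lG lH lG' lH' /aeO_forall GG' /aeO_forall HH'; apply: (Int_eq_ae mO).
- exact: (L1_measurable (energy_density_L1 lG lH)).
- exact: (L1_measurable (energy_density_L1 lG' lH')).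
- apply: aeD_mp2 GG' HH' => x _ e1 e2; apply: eq_bigr => i _; apply: eq_bigr => j _.
  by rewrite e1 e2.
Qed.

Lemma energy_continuous : exists2 C, 0 < C & forall G H, (forall i, L2 (G i)) -> (forall i, L2 (H i)) ->
  `|energy G H| <= C * (\sum_i n2 (G i)) * (\sum_j n2 (H j)).
Proof.
have [C C0 hC] := coef_bounded; have [ca _ _] := ella; exists C => // G H lG lH.
rewrite energyE//; apply: (le_trans (ler_norm_sum _ _ _)).
rewrite [C * _]mulr_sumr mulr_suml; apply: ler_sum => i _.
apply: (le_trans (ler_norm_sum _ _ _)); rewrite mulr_sumr; apply: ler_sum => j _.
apply: (le_trans (ip_CS mO (coef_L2 i j (lG i)) (lH j))).
rewrite ler_wpM2r ?n2_ge0//; apply: (n2_bddM mO (ltW C0)) => //.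
  exact: within_closure_measurable.
by apply: aeD_all => x; exact: hC.
Qed.

(** In the applications b is the derivative of a truncation. The form carries b once and the left
    side twice; b^2 <= b closes the gap. *)
Lemma energy_coercive G (b : fct) : (forall i, L2 (G i)) -> measurable_fun Omega b ->
  (forall x, 0 <= b x <= 1) -> forall i,
  lam * n2 (fun x => b x * G i x) ^+ 2 <= energy G (fun i x => b x * G i x).
Proof.
move=> lG mb b01 i.
have bc : aeO (fun x => `|b x| <= 1).
  by apply: aeD_all => x _; have /andP[h1 h2] := b01 x; rewrite ger0_norm.
have lbG j : L2 (fun x => b x * G j x) by exact: (L2_bddM mO mb bc).
rewrite n2_sq /ip -RintegralZl//; last exact: (L2M mO).
apply: (Int_le_ae mO); first exact: (L1Z mO lam (L2M mO (lbG i) (lbG i))).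
  exact: energy_density_L1.
have [_ _ he] := ella; have {}he : aeO (fun x => forall zeta : 'rV[R]_n,
    lam * \sum_i zeta ord0 i ^+ 2 <= \sum_i \sum_j a i j x * zeta ord0 i * zeta ord0 j) by [].
apply: aeD_mp he => x _ he; have /andP[b0 b1] := b01 x.
have -> : \sum_i0 \sum_j a i0 j x * G i0 x * (b x * G j x) =
   b x * \sum_i0 \sum_j a i0 j x * G i0 x * G j x.
  rewrite mulr_sumr; apply: eq_bigr => i0 _; rewrite mulr_sumr; apply: eq_bigr => j _; ring.
apply: (@le_trans _ _ (b x * (lam * \sum_i0 G i0 x ^+ 2))); last first.
  apply: ler_wpM2l => //; have := he (\row_j G j x).
  under eq_bigr do rewrite mxE.
  by under [X in _ <= X]eq_bigr do under eq_bigr do rewrite !mxE.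
rewrite [leRHS]mulrCA ler_wpM2l ?(ltW lam0)//.
rewrite mulrACA -expr2 -expr2; apply: (@le_trans _ _ (b x * G i x ^+ 2)).
  by rewrite ler_wpM2r ?sqr_ge0// expr2 ler_piMr.
rewrite ler_wpM2l// (bigD1 i)//= lerDl sumr_ge0// => j _; exact: sqr_ge0.
Qed.

Lemma energy_coercive1 G : (forall i, L2 (G i)) -> forall i, lam * n2 (G i) ^+ 2 <= energy G G.
Proof.
move=> lG i; have := @energy_coercive G (fun=> 1) lG (measurable_cst _) _ i.
have -> : (fun (i : 'I_n) x => 1 * G i x) = G by apply/funext => j; apply/funext => x; rewrite mul1r.
have -> : (fun x => 1 * G i x) = G i by apply/funext => x; rewrite mul1r.
by apply => x; rewrite ler01 lexx.
Qed.

Lemma energy_poincare : exists2 C, 0 < C & forall y G, pair y G -> n2 y ^+ 2 <= C * energy G G.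
Proof.
set m := fine (mu Omega); have m0 : 0 <= m by rewrite fine_ge0.
(* The whole domain serves as support; e >= 1 gives e^n >= e >= 2m. *)
pose e := 2 * m + 1; have e1 : 1 <= e by rewrite lerDr mulr_ge0.
have e0 : 0 < e by rewrite (lt_le_trans ltr01).
have n0 : 0 < (n%:R : R) by rewrite ltr0n; case/andP: n03.
exists ((2 * e * n%:R) ^+ 2 / lam); first by rewrite divr_gt0// exprn_gt0// !mulr_gt0.
move=> y G yG; have [ly lG _] := yG.
have FK : n2 y <= 2 * e * \sum_i n2 (G i).
  apply: (H10pair_faber_krahn oO bO e0 m0 yG).
    apply: (@le_trans _ _ ((Num.sqrt m * n2 y) ^+ 2)); last by rewrite exprMn sqr_sqrtr.
    have hi := Int_norm_le mO fO ly.
    by rewrite ler_pXn2r ?nnegrE// ?mulr_ge0 ?sqrtr_ge0 ?n2_ge0//; exact: Rintegral_ge0.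
  apply: (@le_trans _ _ e); first by rewrite /e lerDl.
  by case/andP: n03 => n1 _; rewrite -[leLHS]expr1 ler_weXn2l.
have c0 := energy_coercive1 lG.
have E0 : 0 <= energy G G.
  case/andP: n03 => n1 _; apply: le_trans (c0 (Ordinal n1)).
  by rewrite mulr_ge0 ?sqr_ge0// ltW.
set q := Num.sqrt (energy G G / lam).
have q0 : 0 <= energy G G / lam by rewrite divr_ge0// ltW.
have hq i : n2 (G i) <= q.
  rewrite -[leLHS]ger0_norm ?n2_ge0// -sqrtr_sqr ler_sqrt// ler_pdivlMr// mulrC.
  exact: c0.
have : n2 y <= 2 * e * n%:R * q.
  apply: (le_trans FK); rewrite -[leRHS]mulrA ler_wpM2l ?mulr_ge0 ?(ltW e0)//.
  apply: (le_trans (ler_sum _ (fun i _ => hq i))).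
  by rewrite sumr_const card_ord mulr_natl.
move=> h; apply: (@le_trans _ _ ((2 * e * n%:R * q) ^+ 2)).
  by rewrite ler_pXn2r ?nnegrE ?n2_ge0// (le_trans (n2_ge0 _ _ _) h).
by rewrite exprMn sqr_sqrtr// mulrA mulrAC.
Qed.

(** All that Stampacchia's method asks of the equation; h stands for the whole term of order
    zero. *)
Definition truncated_eq y G h g := forall k th, 0 <= k -> 0 < th ->
  energy G (fun i x => strunc' k th (y x) * G i x) + ip h (fun x => strunc k th (y x)) =
  ip g (fun x => strunc k th (y x)).

(** Where y > k >= 0, the sign condition makes h nonnegative, so the term of order zero may be
    dropped. Hence C does not depend on h, and one constant serves all states and adjoint states. *)
Lemma upper_bound (M : R) : exists2 C, 0 < C &
  forall y G h g (k0 s N : R), pair y G -> L2 g -> L2 h ->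
    aeO (fun x => 0 <= h x * y x) -> truncated_eq y G h g ->
    0 <= k0 -> 0 < s <= M -> 0 < N -> n2 g <= N ->
    fine (mu (level Omega y k0)) <= s ^+ 6 ->
    aeO (fun x => y x <= k0 + C * s * N).
Proof.
have [C C0 hC] := stampacchia oO bO n03 M lam0; exists C => //.
move=> y G h g k0 s N yG lg lh hy eqy k00 sM N0 gN ms.
have [ly lG _] := yG; have my := L2_measurable ly.
apply: (hC y G g k0 s N) => // k th kk0 th0 i.
have kge0 := le_trans k00 kk0.
apply: (le_trans (energy_coercive lG (measurable_strunc' k th my) _ i)).
  by move=> x; rewrite strunc'_ge0 strunc'_le1.
rewrite -(eqy k th kge0 th0) lerDl; apply: (Int_ge0_ae mO).
  exact: (L2M mO lh (L2_strunc oO kge0 th0 ly)).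
apply: aeD_mp hy => x _; have [yk|ky] := leP (y x) k.
  by rewrite strunc_eq0// mulr0.
by rewrite pmulr_lge0 ?(le_lt_trans kge0)// => hx; rewrite mulr_ge0// strunc_ge0.
Qed.

Lemma energyZl c G H : (forall i, L2 (G i)) -> (forall i, L2 (H i)) ->
  energy (fun i x => c * G i x) H = c * energy G H.
Proof.
move=> lG lH; rewrite /energy -RintegralZl//; last exact: energy_density_L1.
apply: eq_Int => x _; rewrite mulr_sumr; apply: eq_bigr => i _.
by rewrite mulr_sumr; apply: eq_bigr => j _; ring.
Qed.

(* The growth condition on the test function is void for bounded test functions,
   and satisfied by the truncations of the solution itself. *)
Definition weak_eq y G h g := forall psi H, pair psi H ->
  (exists C, aeO (fun x => `|psi x| <= C * (1 + `|y x|))) ->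
  energy G H + ip h psi = ip g psi.

Lemma pairZ c y G : pair y G -> pair (fun x => c * y x) (fun i x => c * G i x).
Proof.
move=> yG; have [ly lG _] := yG.
have := H10pairD oO bO (c - 1) yG yG => /(H10pair_ae oO bO).
apply; first exact: (L2Z mO c ly).
- by move=> i; exact: (L2Z mO c (lG i)).
- by apply: aeD_all => x _; ring.
- by move=> i; apply: aeD_all => x _; ring.
Qed.

(** In [weak_eq] the solution enters through the growth of the admissible test functions; z is any
    function whose growth is allowed by both equations. *)
Lemma weak_eqD c y G h g y' G' h' g' z : pair y G -> pair y' G' ->
  L2 h -> L2 h' -> L2 g -> L2 g' ->
  (exists C, aeO (fun x => `|z x| <= C * (1 + `|y x|))) ->
  (exists C, aeO (fun x => `|z x| <= C * (1 + `|y' x|))) ->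
  weak_eq y G h g -> weak_eq y' G' h' g' ->
  weak_eq z (fun i x => c * G i x + G' i x) (fun x => c * h x + h' x) (fun x => c * g x + g' x).
Proof.
move=> [ly lG _] [ly' lG' _] lh lh' lg lg' [C1 zC1] [C2 zC2] e e' psi H pH [C pC].
have [lp lH _] := pH.
have gr y0 C0 : aeO (fun x => `|z x| <= C0 * (1 + `|y0 x|)) ->
    exists C, aeO (fun x => `|psi x| <= C * (1 + `|y0 x|)).
  move=> zC; exists (`|C| * (1 + `|C0|)); apply: aeD_mp2 zC pC => x _ h1 h2.
  apply: (le_trans h2); apply: (@le_trans _ _ (`|C| * (1 + `|z x|))).
    by rewrite ler_wpM2r ?ler_norm// addr_ge0.
  rewrite -mulrA ler_wpM2l// mulrDl mul1r lerD//.
    by rewrite lerDl.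
  by apply: (le_trans h1); rewrite ler_wpM2r ?ler_norm// addr_ge0.
have {}e := e _ _ pH (gr _ _ zC1); have {}e' := e' _ _ pH (gr _ _ zC2).
rewrite energyDl// (ipDl mO (L2Z mO c lh) lh' lp) (ipDl mO (L2Z mO c lg) lg' lp).
by rewrite !(ipZl mO)// -e -e'; ring.
Qed.

Lemma weak_eqZ c y G h g : c != 0 -> pair y G -> L2 h -> L2 g -> weak_eq y G h g ->
  weak_eq (fun x => c * y x) (fun i x => c * G i x) (fun x => c * h x) (fun x => c * g x).
Proof.
move=> c0 [ly lG _] lh lg e psi H pH [C pC]; have [lp lH _] := pH.
rewrite energyZl// !(ipZl mO)// -mulrDr (e _ _ pH)//.
exists (`|C| * (1 + `|c|)); apply: aeD_mp pC => x _ pC.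
apply: (le_trans pC); apply: (@le_trans _ _ (`|C| * (1 + `|c * y x|))).
  by rewrite ler_wpM2r ?ler_norm// addr_ge0.
rewrite -mulrA ler_wpM2l// normrM mulrDl mul1r lerD ?lerDl//.
by rewrite ler_wpM2l// lerDr.
Qed.

Lemma weak_eq_truncated y G h g : pair y G -> weak_eq y G h g -> truncated_eq y G h g.
Proof.
move=> yG e k th k0 th0; apply: e; first exact: H10pair_strunc.
exists 1; apply: aeD_all => x _; rewrite mul1r; apply: (le_trans (strunc_le _ k0 th0)).
by rewrite lerDr.
Qed.

Lemma chebyshev_level y k c : L2 y -> 0 < k -> n2 y ^+ 2 <= k ^+ 2 * c ->
  fine (mu (level Omega y k)) <= c.
Proof.
move=> ly k0 yc; have my := L2_measurable ly.
have [i1 i2] := Int_level oO bO k my; rewrite -i2.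
rewrite -(@ler_pM2l _ (k ^+ 2)) ?exprn_gt0//; apply: le_trans yc.
rewrite n2_sq /ip -RintegralZl//; apply: (Int_le_ae mO).
- exact: (L1Z mO _ i1).
- exact: (L2M mO).
apply: aeD_all => x Ox; rewrite indicE; case: (boolP (x \in _)); last first.
  by rewrite mulr0 -expr2 sqr_ge0.
rewrite inE => -[_ /= kx]; rewrite mulr1 expr2.
by have x0 := ltW (lt_trans k0 kx); rewrite ler_pM// ltW.
Qed.

(** The one-sided bound for y and for -y. The last hypothesis offers two starts of the iteration:
    Chebyshev at a positive level, which will give smallness, or the measure of the whole domain,
    which permits k0 = 0. *)
Lemma sup_bound (M : R) : exists2 C, 0 < C &
  forall y G h g (k0 s N : R), pair y G -> L2 g -> L2 h ->
    aeO (fun x => 0 <= h x * y x) -> weak_eq y G h g ->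
    0 <= k0 -> 0 < s <= M -> 0 < N -> n2 g <= N ->
    0 < k0 /\ n2 y ^+ 2 <= k0 ^+ 2 * s ^+ 6 \/ fine (mu Omega) <= s ^+ 6 ->
    aeO (fun x => `|y x| <= k0 + C * s * N).
Proof.
have [C C0 hC] := upper_bound M; exists C => //.
move=> y G h g k0 s N yG lg lh hy eqy k00 sM N0 gN H.
have lev z : L2 z -> n2 z = n2 y -> fine (mu (level Omega z k0)) <= s ^+ 6.
  move=> lz nz; have mz := L2_measurable lz.
  case: H => [[k1 ys]|Os]; first by apply: chebyshev_level; rewrite ?nz.
  apply: le_trans Os; apply: fine_le; rewrite ?ge0_fin_numE//.
    by rewrite -ge0_fin_numE//; exact: level_fin.
  by apply: le_measure; rewrite ?inE//; [exact: measurable_level|exact: subIsetl].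
have [ly _ _] := yG.
have h1 := hC y G h g k0 s N yG lg lh hy (weak_eq_truncated yG eqy) k00 sM N0 gN (lev y ly erefl).
have yG' := pairZ (-1) yG; have [ly' _ _] := yG'.
have n0 : -1 != 0 :> R by rewrite oppr_eq0 oner_eq0.
have eqy' := weak_eqZ n0 yG lh lg eqy.
have nN (v : fct) : n2 (fun x => -1 * v x) = n2 v.
  by rewrite -[RHS]n2N; apply: eq_n2 => x _; rewrite mulN1r.
have h2 := hC _ _ _ _ k0 s N yG' (L2Z mO (-1) lg) (L2Z mO (-1) lh) _ (weak_eq_truncated yG' eqy') k00 sM N0.
have {}h2 : aeO (fun x => -1 * y x <= k0 + C * s * N).
  apply: h2; rewrite ?nN//; last exact: (lev _ ly' (nN y)).
  by apply: aeD_mp hy => x _; rewrite mulrACA mulrNN !mul1r.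
by apply: aeD_mp2 h1 h2 => x _ e1 e2; rewrite ler_norml e1 lerNl -mulN1r e2.
Qed.

Lemma weak_eq_energy y G h g : pair y G -> L2 h -> aeO (fun x => 0 <= h x * y x) ->
  weak_eq y G h g -> energy G G <= ip g y.
Proof.
move=> yG lh hy e; have [ly _ _] := yG; rewrite -(e y G yG); last first.
  by exists 1; apply: aeD_all => x _; rewrite mul1r lerDr.
rewrite lerDl; apply: (Int_ge0_ae mO) => //; exact: (L2M mO).
Qed.

Lemma weak_eq_n2 : exists2 C, 0 < C & forall y G h g, pair y G -> L2 h -> L2 g ->
  aeO (fun x => 0 <= h x * y x) -> weak_eq y G h g -> n2 y <= C * n2 g.
Proof.
have [C C0 hC] := energy_poincare; exists C => // y G h g yG lh lg hy e.
have [ly _ _] := yG; have [->|y0] := eqVneq (n2 y) 0; first by rewrite mulr_ge0 ?n2_ge0 ?ltW.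
have {}y0 : 0 < n2 y by rewrite lt_neqAle eq_sym y0 n2_ge0.
rewrite -(ler_pM2r y0) -expr2 -mulrA; apply: (le_trans (hC _ _ yG)).
rewrite ler_wpM2l ?(ltW C0)//; apply: (le_trans (weak_eq_energy yG lh hy e)).
exact: le_trans (ler_norm _) (ip_CS mO lg ly).
Qed.

End energy_form.

Section transpose.
Context (R : realType) (n : nat) (Omega : set 'rV[R]_n).
Variables (a : 'I_n -> 'I_n -> 'rV[R]_n -> R) (lam : R).

Lemma elliptic_transpose : elliptic Omega a lam -> elliptic Omega (fun i j => a j i) lam.
Proof.
move=> [ca l0 he]; split => //; apply: filterS he => x he Ox zeta.
rewrite exchange_big/=; apply: le_trans (he Ox zeta) _.
by apply: ler_sum => i _; apply: ler_sum => j _; rewrite mulrAC.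
Qed.

Lemma energy_transpose G H : energy Omega (fun i j => a j i) G H = energy Omega a H G.
Proof.
apply: eq_Int => x _; rewrite exchange_big/=; apply: eq_bigr => i _.
by apply: eq_bigr => j _; rewrite mulrAC.
Qed.

End transpose.

Section more_L2.
Context d (T : measurableType d) (R : realType)
  (mu : {measure set T -> \bar R}) (D : set T).
Hypotheses (mD : measurable D) (Dfin : (mu D < +oo)%E).
Implicit Types (f g h : T -> R).

Lemma n2_bdd c f : measurable_fun D f -> aeD mu D (fun x => `|f x| <= c) -> 0 <= c ->
  n2 mu D f <= c * n2 mu D (fun=> 1).
Proof.
move=> mf fc c0; have l1 := L2_cst mD Dfin 1.
rewrite -[X in X * _](ger0_norm c0) -n2Z//; apply: (n2_le mD).
- exact: (L2_bdd mD Dfin mf fc).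
- exact: (L2Z mD c l1).
- by apply: aeD_mp fc => x _; rewrite mulr1 (ger0_norm c0).
Qed.

Lemma eq_ip f f' g g' : (forall x, D x -> f x = f' x) -> (forall x, D x -> g x = g' x) ->
  ip mu D f g = ip mu D f' g'.
Proof. by move=> e1 e2; apply: eq_Int => x Dx; rewrite e1 ?e2. Qed.

Lemma ip_eq_ae f f' g g' : L2 mu D f -> L2 mu D f' -> L2 mu D g -> L2 mu D g' ->
  aeD mu D (fun x => f x = f' x) -> aeD mu D (fun x => g x = g' x) ->
  ip mu D f g = ip mu D f' g'.
Proof.
move=> lf lf' lg lg' e1 e2; apply: (Int_eq_ae mD).
- exact: (L1_measurable (L2M mD lf lg)).
- exact: (L1_measurable (L2M mD lf' lg')).
- by apply: aeD_mp2 e1 e2 => x _ -> ->.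
Qed.

End more_L2.

(** * The state equation and its linearization *)

Section nonlinearity.
Context (R : realType) (n : nat) (Omega : set 'rV[R]_n).
Local Notation mu := (lebesgue_rV R n).
Local Notation fct := ('rV[R]_n -> R).
Local Notation L2 := (L2 mu Omega).
Local Notation n2 := (n2 mu Omega).
Local Notation ip := (ip mu Omega).
Local Notation aeO := (aeD mu Omega).
Hypotheses (oO : open Omega) (bO : bounded_set Omega).
Implicit Types (u v y z : fct).
Variables (q : \bar R) (f : 'rV[R]_n -> R -> R).
Hypotheses (q1 : (1 <= q)%E) (hf : admissible_nonlinearity Omega q f).

Let mO : measurable Omega. Proof. exact: open_measurable_rV. Qed.
Let fO : (mu Omega < +oo)%E. Proof. exact: bounded_set_lty. Qed.

Lemma derive1_measurable (g : 'rV[R]_n -> R -> R) : (forall s, measurable_fun Omega (g ^~ s)) ->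
  (forall x, Omega x -> forall s, derivable (g x) s 1) ->
  forall s, measurable_fun Omega (fun x => derive1 (g x) s).
Proof.
move=> mg dg s.
apply: (@measurable_fun_cvg _ _ _ _
  (fun k x => (k.+1%:R^-1)^-1 * (g x (k.+1%:R^-1 + s) - g x s))) => [k|x Ox].
  apply: measurable_funM; first exact: measurable_cst.
  by apply: measurable_funB; exact: mg.
have dx := dg x Ox s; rewrite derive1E /derive.
have h1 : (h^-1 *: ((g x \o shift s) (h *: 1) - g x s)) @[h --> 0^'] --> lim (h^-1 *: ((g x \o shift s) (h *: 1) - g x s) @[h --> 0^']) by exact: dx.
have h2 : (forall k : nat, (k.+1%:R^-1 : R) != 0) /\ ((k.+1%:R^-1 : R) @[k --> \oo] --> 0).
  by split; [move=> k; rewrite gt_eqF|exact: cvg_harmonic].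
have := (cvgr_dnbhsP _ _ _).1 h1 (fun k => k.+1%:R^-1) h2.
apply: cvg_trans; apply: near_eq_cvg; apply: nearW => k /=.
by rewrite [_ *: 1]mulr1.
Qed.

Let contf (g : R -> R) : (forall s, derivable g s 1) -> continuous g.
Proof.
move=> dg s; apply: differentiable_continuous; apply/derivable1_diffP; exact: dg.
Qed.

Lemma nonlinearity_measurable y : measurable_fun Omega y ->
  [/\ measurable_fun Omega (fun x => f x (y x)),
      measurable_fun Omega (fun x => fy f x (y x)) &
      measurable_fun Omega (fun x => fyy f x (y x))].
Proof.
move=> my; have [[mf df] _ _ _ _] := hf.
have mfy : forall s, measurable_fun Omega (fy f ^~ s).
  by apply: derive1_measurable mf _ => x /df[].
have mfyy : forall s, measurable_fun Omega (fyy f ^~ s).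
  by apply: derive1_measurable mfy _ => x /df[].
split; apply: (measurable_superposition mO) => //.
- by move=> x /df[d1 _ _]; exact: contf.
- by move=> x /df[_ d2 _]; exact: contf.
- by move=> x /df[].
Qed.

Lemma nonlinearity_bound M : exists2 C, 0 < C & aeO (fun x => forall s, `|s| <= M ->
  `|fy f x s| <= C /\ `|fyy f x s| <= C).
Proof.
have [_ _ _ hb _] := hf; have M1 : 0 < `|M| + 1 by rewrite ltr_wpDl.
have [C C0 hC] := hb _ M1; exists C => //; apply: aeD_mp hC => x _ hC s sM.
have sM' : `|s| <= `|M| + 1.
  by apply: (le_trans sM); apply: (le_trans (ler_norm M)); rewrite lerDl.
have h := hC s sM'.
by split; apply: le_trans h; rewrite ?lerDl ?lerDr.
Qed.

Lemma fy_ge0 : aeO (fun x => forall s, 0 <= fy f x s).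
Proof. by have [_ _ h _ _] := hf. Qed.

Lemma nonlinearity_lipschitz M : exists2 C, 0 < C & aeO (fun x => forall s1 s2,
  `|s1| <= M -> `|s2| <= M ->
  [/\ `|fy f x s1| <= C, `|fyy f x s1| <= C,
      `|f x s2 - f x s1| <= C * `|s2 - s1|,
      `|fy f x s2 - fy f x s1| <= C * `|s2 - s1| &
      `|f x s2 - f x s1 - fy f x s1 * (s2 - s1)| <= C * `|s2 - s1| ^+ 2]).
Proof.
have [C C0 hC] := nonlinearity_bound M; exists C => //.
have [[_ df] _ _ _ _] := hf.
apply: aeD_mp hC => x Ox hC s1 s2 s1M s2M; have [d1 d2 _] := df x Ox.
split; try by have [] := hC _ s1M.
- by apply: lipschitz1 d1 _ s1M s2M => s /hC[].
- by apply: lipschitz1 d2 _ s1M s2M => s /hC[].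
- by apply: taylor2 d1 d2 _ s1M s2M => s /hC[].
Qed.

Lemma nonlinearity_monotone : aeO (fun x => forall s1 s2,
  0 <= (f x s2 - f x s1) * (s2 - s1)).
Proof.
have [[_ df] _ _ _ _] := hf; apply: aeD_mp fy_ge0 => x Ox h s1 s2.
have [d1 _ _] := df x Ox; have [xi _ ->] := mean_value s1 s2 d1.
by rewrite -mulrA mulr_ge0 ?h// -expr2 sqr_ge0.
Qed.

Lemma fy_difference M e : 0 < M -> 0 < e -> exists2 r, 0 < r & aeO (fun x => forall s1 s2,
  `|s1| <= M -> `|s2| <= M -> `|s2 - s1| <= r ->
  `|fy f x s2 - fy f x s1 - fyy f x s1 * (s2 - s1)| <= e * `|s2 - s1|).
Proof.
move=> M0 e0; have [[_ df] _ _ _ hc] := hf; have [r r0 hr] := hc M e M0 e0.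
exists r => //; apply: aeD_mp hr => x Ox hr s1 s2 s1M s2M s12.
have [_ d2 _] := df x Ox; have [xi [h1 h2] ->] := mean_value s1 s2 d2.
rewrite -mulrBl normrM ler_wpM2r//; apply: hr => //; last exact: le_trans h1 s12.
by rewrite (le_trans h2)// ge_max s1M.
Qed.

(** Unboundedness can only come from f(., 0): for bounded y the difference f(., y) - f(., 0) is
    bounded. *)
Lemma nonlinearity_L1 y M : measurable_fun Omega y -> aeO (fun x => `|y x| <= M) ->
  L1 mu Omega (fun x => f x (y x)).
Proof.
move=> my yM; have [_ f0 _ _ _] := hf; have l0 := inL_L1 oO bO q1 f0.
have [C C0 hC] := nonlinearity_lipschitz `|M|.
have [mfy _ _] := nonlinearity_measurable my.
have mf0 := L1_measurable l0.
suff l1 : L1 mu Omega (fun x => f x (y x) - f x 0).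
  by apply: (eq_L1 mO _ (L1D mO l1 l0)) => x _; rewrite subrK.
apply: (L2_L1 mO fO); apply: (L2_bdd mO fO (c := C * `|M|)); first exact: measurable_funB.
apply: aeD_mp2 yM hC => x _ yM hC.
have yM' : `|y x| <= `|M| by exact: le_trans yM (ler_norm _).
have [||_ _ h _ _] := hC 0 (y x) => //; first by rewrite normr0.
by apply: (le_trans h); rewrite subr0 ler_wpM2l// ltW.
Qed.

End nonlinearity.

Lemma quotient_identity (R : realType) (t A B c E F : R) :
  t * A + E + (t * B + F) = t * c -> t * (A + B - c) = - (E + F).
Proof. by move=> h; rewrite mulrBr mulrDr -h; ring. Qed.

(** Two nested limits: t tends to 0 for fixed e, in a range that may shrink with e, and then e tends
    to 0. *)
Lemma squeeze_eq0 (R : realType) (X K K' : R) : 0 <= K -> 0 <= K' ->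
  (forall e, 0 < e <= 1 -> exists2 r, 0 < r & forall t, 0 < t <= r ->
    `|X| <= e * K + t * K') -> X = 0.
Proof.
move=> K0 K'0 h; apply/eqP; rewrite -normr_le0; apply/ler_addgt0Pr => d d0; rewrite add0r.
have k1 : 0 < K + 1 by rewrite ltr_wpDl.
have k2 : 0 < K' + 1 by rewrite ltr_wpDl.
pose e := Num.min 1 (d / 2 / (K + 1)).
have e0 : 0 < e <= 1 by rewrite lt_min ltr01 !divr_gt0//= ge_min lexx.
have [r r0 hr] := h e e0; pose t := Num.min r (d / 2 / (K' + 1)).
have t0 : 0 < t <= r by rewrite lt_min r0 !divr_gt0//= ge_min lexx.
apply: (le_trans (hr t t0)); rewrite [leRHS](splitr d); apply: lerD.
  apply: (@le_trans _ _ (d / 2 / (K + 1) * (K + 1))); last by rewrite divfK ?gt_eqF.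
  apply: ler_pM => //; first by case/andP: e0 => /ltW.
    by rewrite ge_min lexx orbT.
  by rewrite lerDl.
apply: (@le_trans _ _ (d / 2 / (K' + 1) * (K' + 1))); last by rewrite divfK ?gt_eqF.
apply: ler_pM => //; first by case/andP: t0 => /ltW.
  by rewrite ge_min lexx orbT.
by rewrite lerDl.
Qed.

Section state.
Context (R : realType) (n : nat) (Omega : set 'rV[R]_n).
Local Notation mu := (lebesgue_rV R n).
Local Notation fct := ('rV[R]_n -> R).
Local Notation L2 := (L2 mu Omega).
Local Notation L1 := (L1 mu Omega).
Local Notation n2 := (n2 mu Omega).
Local Notation ip := (ip mu Omega).
Local Notation aeO := (aeD mu Omega).
Local Notation pair := (H10pair Omega).
Hypotheses (oO : open Omega) (bO : bounded_set Omega) (n03 : (0 < n <= 3)%N).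
Implicit Types (u v y z h g psi : fct) (G H : 'I_n -> fct).

Let mO : measurable Omega. Proof. exact: open_measurable_rV. Qed.
Let fO : (mu Omega < +oo)%E. Proof. exact: bounded_set_lty. Qed.

Lemma pairB y G z H : pair y G -> pair z H ->
  pair (fun x => y x - z x) (fun i x => G i x - H i x).
Proof.
move=> yG zH; have [ly lG _] := yG; have [lz lH _] := zH.
have := H10pairD oO bO (-1) zH yG => /(H10pair_ae oO bO); apply.
- exact: (L2B mO ly lz).
- by move=> i; exact: (L2B mO (lG i) (lH i)).
- by apply: aeD_all => x _; ring.
- by move=> i; apply: aeD_all => x _; ring.
Qed.

Lemma inY_pair y : inY Omega y -> pair y (grad Omega y).
Proof. by move=> [hy _]; exact: inH10_H10pair. Qed.

Lemma inY_bounded y : inY Omega y -> exists2 M, 0 < M & forall x, Omega x -> `|y x| <= M.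
Proof.
move=> [_ cy]; have [M M0 hM] := within_closure_bounded bO cy.
by exists M => // x Ox; apply: hM; exact: subset_closure.
Qed.

Section form.
Variables (a : 'I_n -> 'I_n -> fct) (lam : R).
Hypothesis ella : elliptic Omega a lam.
Local Notation energy := (energy Omega a).

Lemma energyBl G G' H : (forall i, L2 (G i)) -> (forall i, L2 (G' i)) -> (forall i, L2 (H i)) ->
  energy (fun i x => G i x - G' i x) H = energy G H - energy G' H.
Proof.
move=> lG lG' lH; have := energyDl oO bO ella (-1) lG' lG lH.
rewrite mulN1r addrC => <-; apply: eq_Int => x _.
by apply: eq_bigr => i _; apply: eq_bigr => j _; rewrite mulN1r addrC.
Qed.

Lemma weak_solution_pair (f : 'rV[R]_n -> R -> R) u y psi H :
  weak_solution Omega a f u y -> pair psi H ->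
  energy (grad Omega y) H + \int[mu]_(x in Omega) (f x (y x) * psi x) = ip u psi.
Proof.
move=> [Hy hy] pH; have [lp lH _] := pH; have [ly lG _] := inH10_H10pair oO bO Hy.
have wH := H10pair_weak_gradient oO bO pH.
have wg := weak_gradient_grad wH.
rewrite -[RHS](hy psi (H10pair_inH10 oO bO pH)); congr (_ + _).
apply: (eq_energy oO bO ella) => //.
- by move=> i; exact: (weak_gradient_L2 oO i wg).
- by move=> i; exact: aeD_all.
- by move=> i; apply: aeD_mp (grad_ae oO bO wH i) => x _ ->.
Qed.

End form.

Variables (a : 'I_n -> 'I_n -> fct) (lam : R).
Hypothesis ella : elliptic Omega a lam.
Variables (q : \bar R) (f : 'rV[R]_n -> R -> R) (S : fct -> fct).
Hypotheses (q1 : (1 <= q)%E) (hf : admissible_nonlinearity Omega q f).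
Hypothesis hS : control_to_state Omega a f S.
Local Notation energy := (energy Omega a).

Lemma state u : L2 u -> inY Omega (S u) /\ weak_solution Omega a f u (S u).
Proof. by move=> /(inL2P _ mO); exact: hS. Qed.

Lemma L2_coef y h M : measurable_fun Omega y -> (forall x, Omega x -> `|y x| <= M) ->
  L2 h -> L2 (fun x => fy f x (y x) * h x).
Proof.
move=> my yM lh; have [_ mfy _] := nonlinearity_measurable oO hf my.
have [C C0 hC] := nonlinearity_bound hf M.
apply: (L2_bddM mO (c := C)) => //; apply: aeD_mp hC => x Ox hC.
by have [] := hC (y x) (yM x Ox).
Qed.

(** The superpositions f(., S u) are known to be integrable only; their difference is square
    integrable by the Lipschitz bound for f on the common range of the two states. *)
Lemma L2_state_difference u1 u2 : L2 u1 -> L2 u2 -> L2 (fun x => f x (S u2 x) - f x (S u1 x)).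
Proof.
move=> l1 l2; have [Y1 w1] := state l1; have [Y2 w2] := state l2.
have [M1 M10 hM1] := inY_bounded Y1; have [M2 M20 hM2] := inY_bounded Y2.
have [ly1 _ _] := inY_pair Y1; have [ly2 _ _] := inY_pair Y2.
have [m1 _ _] := nonlinearity_measurable oO hf (L2_measurable ly1).
have [m2 _ _] := nonlinearity_measurable oO hf (L2_measurable ly2).
have [C C0 hC] := nonlinearity_lipschitz hf (Num.max M1 M2).
apply: (@L2_le _ _ _ mu Omega mO _ (fun x => C * (S u2 x - S u1 x))).
- exact: measurable_funB.
- exact: (L2Z mO C (L2B mO ly2 ly1)).
apply: aeD_mp hC => x Ox hC; have [||_ _ h _ _] := hC (S u1 x) (S u2 x).
- by rewrite le_max hM1.
- by rewrite le_max hM2 ?orbT.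
by rewrite [leRHS]normrM (gtr0_norm C0).
Qed.

(** Splitting the nonlinear term requires f(., S u) psi to be integrable, hence psi bounded; the
    growth condition ensures this because both states are bounded. *)
Lemma state_difference u1 u2 : L2 u1 -> L2 u2 ->
  weak_eq Omega a (fun x => S u2 x - S u1 x) (fun i x => grad Omega (S u2) i x - grad Omega (S u1) i x)
    (fun x => f x (S u2 x) - f x (S u1 x)) (fun x => u2 x - u1 x).
Proof.
move=> l1 l2 psi H pH [C pC].
have [Y1 w1] := state l1; have [Y2 w2] := state l2.
have [M1 M10 hM1] := inY_bounded Y1; have [M2 M20 hM2] := inY_bounded Y2.
have [ly1 lG1 _] := inY_pair Y1; have [ly2 lG2 _] := inY_pair Y2.
have [lp lH _] := pH.
have pB : aeO (fun x => `|psi x| <= `|C| * (1 + (M2 + M1))).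
  apply: aeD_mp pC => x Ox pC; apply: (le_trans pC).
  apply: (le_trans (ler_wpM2r _ (ler_norm C))); first by rewrite addr_ge0.
  rewrite ler_wpM2l// lerD2l (le_trans (ler_normB _ _))// lerD ?hM1 ?hM2//.
have i1 : L1 (fun x => f x (S u1 x) * psi x).
  have l := nonlinearity_L1 oO bO q1 hf (L2_measurable ly1) (aeD_all mu hM1).
  by apply: (eq_L1 mO _ (L1_bddM mO (L2_measurable lp) pB l)) => x _; rewrite mulrC.
have i2 : L1 (fun x => f x (S u2 x) * psi x).
  have l := nonlinearity_L1 oO bO q1 hf (L2_measurable ly2) (aeD_all mu hM2).
  by apply: (eq_L1 mO _ (L1_bddM mO (L2_measurable lp) pB l)) => x _; rewrite mulrC.
have e1 := weak_solution_pair ella w1 pH; have e2 := weak_solution_pair ella w2 pH.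
rewrite (energyBl ella)// (ipBl mO l2 l1 lp) -e1 -e2.
have -> : ip (fun x => f x (S u2 x) - f x (S u1 x)) psi =
   \int[mu]_(x in Omega) (f x (S u2 x) * psi x) - \int[mu]_(x in Omega) (f x (S u1 x) * psi x).
  by rewrite -RintegralB//; apply: eq_Int => x _; rewrite mulrBl.
by rewrite addrACA -opprD.
Qed.

(** * The equation solved by the derivative of the control-to-state map *)

Section linearized.
Variables (u : fct) (T : fct -> fct).
Hypotheses (lu : L2 u) (hT : frechet_L2_Y Omega S u T).

Lemma linearized_inY v : L2 v -> inY Omega (T v).
Proof. by move=> lv; have [h _ _ _] := hT; apply: h; apply/inL2P. Qed.

Lemma linearizedD c v1 v2 : L2 v1 -> L2 v2 -> forall x, closure Omega x ->
  T (fun x => c * v1 x + v2 x) x = c * T v1 x + T v2 x.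
Proof.
move=> l1 l2 x Ox; have [_ h _ _] := hT.
by apply: (h c v1 v2); [apply/inL2P|apply/inL2P|rewrite inE].
Qed.

Lemma linearizedZ c v : L2 v -> forall x, closure Omega x ->
  T (fun x => c * v x) x = c * T v x.
Proof.
move=> lv x Ox; have := linearizedD (c - 1) lv lv Ox.
rewrite (_ : (fun x => (c - 1) * v x + v x) = (fun x => c * v x)) => [->|]; first by ring.
by apply/funext => z; ring.
Qed.

Lemma linearized_bound : exists2 C, 0 < C & forall v, L2 v ->
  (forall x, Omega x -> `|T v x| <= C * n2 v).
Proof.
have [_ _ [C hC] _] := hT; exists (`|C| + 1); first by rewrite ltr_wpDl.
move=> v lv x Ox; have [_ hb] := normY_bounds bO (linearized_inY lv).
apply: (le_trans (hb x Ox)); apply: (le_trans (hC v _)); first exact/inL2P.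
rewrite (normL2E mO)// ler_wpM2r ?n2_ge0// (le_trans (ler_norm C))// lerDl//.
Qed.

Lemma linearized_remainder e : 0 < e -> exists2 r, 0 < r & forall v, L2 v -> n2 v < r ->
  let w := fun x => S (fun x => u x + v x) x - S u x - T v x in
  let G := fun i x => grad Omega (S (fun x => u x + v x)) i x - grad Omega (S u) i x - grad Omega (T v) i x in
  [/\ pair w G, forall x, Omega x -> `|w x| <= e * n2 v & forall i, n2 (G i) <= e * n2 v].
Proof.
move=> e0; have [_ _ _ /(_ e e0)[r r0 hr]] := hT; exists r => // v lv vr w G.
have lv' : inL Omega 2%:E v by exact/inL2P.
have := hr v lv'; rewrite (normL2E mO)// => /(_ vr).
have luv : L2 (fun x => u x + v x) by exact: (L2D mO).
have [Y1 _] := state luv; have [Y0 _] := state lu; have Y2 := linearized_inY lv.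
have pw : pair w G.
  exact: (pairB (pairB (inY_pair Y1) (inY_pair Y0)) (inY_pair Y2)).
have Yw : inY Omega w.
  split; first exact: (H10pair_inH10 oO bO pw).
  move: Y1 Y0 Y2 => [_ c1] [_ c0] [_ c2] x.
  apply: (@cvgB _ _ _ (nbhs (x : subspace (closure Omega))) _ (fun x => S (fun x => u x + v x) x - S u x) (T v)); last exact: c2.
  by apply: (@cvgB _ _ _ (nbhs (x : subspace (closure Omega))) _ (S (fun x => u x + v x)) (S u)); [exact: c1|exact: c0].
move=> hw; have [b1 b2] := normY_bounds bO Yw; have [lw _ _] := pw.
have [_ b3] := n2_le_normH1 oO bO lw (H10pair_weak_gradient oO bO pw).
split => // [x Ox|i]; first exact: le_trans (b2 x Ox) hw.
exact: le_trans (b3 i) (le_trans b1 hw).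
Qed.

(* Difference quotients of the state equation along [u + t v], tested with a
   fixed bounded function. *)
Lemma linearized_eq v : L2 v ->
  weak_eq Omega a (T v) (grad Omega (T v)) (fun x => fy f x (S u x) * T v x) v.
Proof.
move=> lv psi H pH [C0 pC0].
have [Y0 _] := state lu; have Yz := linearized_inY lv.
have [M0 M00 hM0] := inY_bounded Y0; have [Z Z0 hZ] := inY_bounded Yz.
have [ly0 lG0 _] := inY_pair Y0; have [lz lGz _] := inY_pair Yz.
have [lp lH _] := pH.
have my0 := L2_measurable ly0.
set V := n2 v; have V0 : 0 <= V by exact: n2_ge0.
have [B B0 pB] : exists2 B, 0 <= B & aeO (fun x => `|psi x| <= B).
  exists (`|C0| * (1 + Z)); first by rewrite mulr_ge0// addr_ge0// ltW.
  apply: aeD_mp pC0 => x Ox h; apply: (le_trans h).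
  apply: (le_trans (ler_wpM2r _ (ler_norm C0))); first by rewrite addr_ge0.
  by rewrite ler_wpM2l// lerD2l hZ.
(* For t <= 1 and e <= 1 this bounds both [S u] and the state at u + t v. *)
pose M := M0 + (V + Z); have MM : M0 <= M by rewrite lerDl addr_ge0 ?(ltW Z0).
have [C1 C10 hC1] := nonlinearity_lipschitz hf M.
have [C2 C20 hC2] := energy_continuous oO bO ella.
set sH := \sum_j n2 (H j); have sH0 : 0 <= sH by apply: sumr_ge0 => j _; exact: n2_ge0.
set n1 := n2 (fun=> 1); have n10 : 0 <= n1 by exact: n2_ge0.
have np0 : 0 <= n2 psi by exact: n2_ge0.
have lcz := L2_coef my0 hM0 lz.
have VZ0 : 0 <= V + Z by rewrite addr_ge0// ltW.
apply/eqP; rewrite -subr_eq0; apply/eqP.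
(* X is the residual of the linearized equation. K collects the errors of order e, from the Frechet
   remainder; K' comes from the quadratic Taylor remainder of f, which after division by t is of
   order t. *)
set X := _ - _; pose K := C2 * (n%:R * V) * sH + C1 * V * (n1 * n2 psi).
pose K' := C1 * (V + Z) ^+ 2 * (n1 * n2 psi).
apply: (@squeeze_eq0 _ X K K').
- by rewrite /K addr_ge0 ?mulr_ge0 ?(ltW C10) ?(ltW C20).
- by rewrite /K' ?mulr_ge0 ?exprn_ge0 ?(ltW C10).
move=> e /andP[e0 e1]; have [r r0 hr] := linearized_remainder e0.
pose r' := Num.min 1 (r / (V + 1)).
have V1 : 0 < V + 1 by rewrite ltr_wpDl.
exists r'; first by rewrite lt_min ltr01 divr_gt0.
move=> t /andP[t0 tr].
have t1 : t <= 1 by rewrite (le_trans tr)// ge_min lexx.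
have {tr}tr : t * (V + 1) <= r by rewrite -ler_pdivlMr// (le_trans tr)// ge_min lexx orbT.
have ltv : L2 (fun x => t * v x) by exact: (L2Z mO).
have ntv : n2 (fun x => t * v x) = t * V by rewrite (n2Z mO)// gtr0_norm.
have [|pw hw hG] := hr _ ltv; first by rewrite ntv (lt_le_trans _ tr)// ltr_pM2l// ltrDl.
move: pw hw hG; set y := S (fun x => u x + t * v x).
set w := (fun x => y x - _ - _); set G := (fun i x => _ - _ - _) => pw hw hG.
have lut : L2 (fun x => u x + t * v x) by exact: (L2D mO).
have [Yy _] := state lut; have [ly lGy _] := inY_pair Yy.
have [lw lG _] := pw.
have ew x : Omega x -> y x - S u x = t * T v x + w x.
  by move=> Ox; rewrite /w (linearizedZ t lv (subset_closure Ox)) [RHS]addrC subrK.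
have hw1 x : Omega x -> `|w x| <= e * (t * V) by move=> /hw; rewrite ntv.
have hd x : Omega x -> `|y x - S u x| <= t * (V + Z).
  move=> Ox; rewrite ew// (le_trans (ler_normD _ _))// mulrDr addrC lerD//.
    by rewrite (le_trans (hw1 x Ox))// ler_piMl// mulr_ge0// ltW.
  by rewrite normrM gtr0_norm// ler_wpM2l ?(ltW t0)// hZ.
have hy x : Omega x -> `|y x| <= M.
  move=> Ox; rewrite -[y x](subrK (S u x)) (le_trans (ler_normD _ _))// addrC lerD ?hM0//.
  by rewrite (le_trans (hd x Ox))// ler_piMl// addr_ge0// ltW.
have gd i : aeO (fun x => grad Omega y i x - grad Omega (S u) i x = t * grad Omega (T v) i x + G i x).
  have YT := linearized_inY ltv.
  have pz := pairZ oO bO t (inY_pair Yz).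
  have [lGT _ _] := inY_pair YT; have [lz' lGz' _] := pz.
  have pz' : pair (T (fun x => t * v x)) (fun i x => t * grad Omega (T v) i x).
    apply: (H10pair_ae oO bO pz) => //.
    - by apply: aeD_all => x Ox; rewrite (linearizedZ t lv (subset_closure Ox)).
    - by move=> j; exact: aeD_all.
  have ge := grad_ae oO bO (H10pair_weak_gradient oO bO pz') i.
  apply: aeD_mp ge => x Ox ge.
  by rewrite /G ge [RHS]addrC subrK.
pose rho x := f x (y x) - f x (S u x) - fy f x (S u x) * (t * T v x).
have ldf := L2_state_difference lu lut.
have lct : L2 (fun x => fy f x (S u x) * (t * T v x)) by exact: (L2_coef my0 hM0 (L2Z mO t lz)).
have lrho : L2 rho by exact: (L2B mO ldf lct).
have nrho : n2 rho <= (C1 * (t * (V + Z)) ^+ 2 + C1 * (e * (t * V))) * n1.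
  apply: (n2_bdd mO fO (L2_measurable lrho)); last first.
    by rewrite addr_ge0 ?mulr_ge0 ?exprn_ge0 ?mulr_ge0 ?(ltW C10) ?(ltW e0) ?(ltW t0).
  apply: aeD_mp hC1 => x Ox hC1.
  have [||c1 _ _ _ c2] := hC1 (S u x) (y x); [by rewrite (le_trans (hM0 x Ox))|exact: hy|].
  have -> : rho x = f x (y x) - f x (S u x) - fy f x (S u x) * (y x - S u x) + fy f x (S u x) * w x.
    by rewrite ew// /rho mulrDr opprD addrA subrK.
  rewrite (le_trans (ler_normD _ _))// lerD//.
    apply: (le_trans c2); rewrite ler_wpM2l ?(ltW C10)// ler_sqr ?nnegrE ?hd//.
    by rewrite mulr_ge0 ?(ltW t0)// addr_ge0// ltW.
  by rewrite normrM ler_pM ?hw1.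
have key : t * X = - (energy G H + ip rho psi).
  have sd := state_difference lu lut pH; move: sd => /(_ _)/wrap[|sd].
    exists B; apply: aeD_mp pB => x _ h; apply: (le_trans h).
    by rewrite ler_peMr// lerDl.
  have e1' : energy (fun i x => grad Omega y i x - grad Omega (S u) i x) H = t * energy (grad Omega (T v)) H + energy G H.
    rewrite -(energyDl oO bO ella)//; apply: (eq_energy oO bO ella) => //.
    - by move=> i; exact: (L2B mO).
    - by move=> i; exact: (L2D mO (L2Z mO t (lGz i)) (lG i)).
    - by move=> i; exact: aeD_all.
  have e2 : ip (fun x => f x (y x) - f x (S u x)) psi =
      t * ip (fun x => fy f x (S u x) * T v x) psi + ip rho psi.
    rewrite -(ipZl mO t lcz lp) -(ipDl mO (L2Z mO t lcz) lrho lp).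
    by apply: eq_ip => // x _; rewrite /rho [fy _ _ _ * (t * _)]mulrCA [RHS]addrC subrK.
  have e3 : ip (fun x => u x + t * v x - u x) psi = t * ip v psi.
    by rewrite -(ipZl mO t lv lp); apply: eq_ip => // x _; rewrite addrC addKr.
  by move: sd; rewrite e1' e2 e3; exact: quotient_identity.
have nG : \sum_i n2 (G i) <= n%:R * (e * (t * V)).
  apply: (@le_trans _ _ (\sum_(i < n) e * (t * V))).
    by apply: ler_sum => i _; rewrite (le_trans (hG i))// ntv.
  by rewrite sumr_const card_ord mulr_natl.
rewrite -(ler_pM2l t0) -[X in X * `|_|](gtr0_norm t0) -normrM key normrN.
rewrite (le_trans (ler_normD _ _))//.
apply: (@le_trans _ _ (C2 * (n%:R * (e * (t * V))) * sH +
   (C1 * (t * (V + Z)) ^+ 2 + C1 * (e * (t * V))) * n1 * n2 psi)); last first.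
  by rewrite /K /K' le_eqVlt; apply/orP; left; apply/eqP; ring.
apply: lerD.
  apply: (le_trans (hC2 G H lG lH)); rewrite ler_wpM2r// ler_wpM2l// ltW//.
apply: (le_trans (ip_CS mO lrho lp)); rewrite ler_wpM2r//.
Qed.

End linearized.

End state.

(** * Compactness *)

Section gram.
Context d (X : measurableType d) (R : realType)
  (mu : {measure set X -> \bar R}) (D : set X).
Hypotheses (mD : measurable D) (Dfin : (mu D < +oo)%E).
Local Notation L2 := (L2 mu D).
Local Notation n2 := (n2 mu D).
Local Notation ip := (ip mu D).
Implicit Types (f g v : X -> R).
Variables (T : (X -> R) -> (X -> R)) (C : R).
Hypotheses (LT : forall v, L2 v -> L2 (T v))
  (TD : forall c v1 v2, L2 v1 -> L2 v2 -> forall x, D x ->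
     T (fun x => c * v1 x + v2 x) x = c * T v1 x + T v2 x)
  (TC : forall v, L2 v -> forall x, D x -> `|T v x| <= C * n2 v).

Lemma operator_sum (I : Type) (s : seq I) (c : I -> R) (w : I -> X -> R) :
  (forall i, L2 (w i)) -> forall x, D x ->
  T (fun x => \sum_(i <- s) c i * w i x) x = \sum_(i <- s) c i * T (w i) x.
Proof.
move=> lw x Dx; elim: s => [|i s IH].
  rewrite big_nil; under eq_fun do rewrite big_nil.
  have := TD 1 (L2_0 mu D) (L2_0 mu D) Dx.
  under eq_fun do rewrite mulr0 addr0; rewrite mul1r => /eqP.
  by rewrite -subr_eq0 opprD addNKr oppr_eq0 => /eqP.
rewrite big_cons -IH -TD//; last by apply: (L2_sum mD) => j; exact: (L2Z mD).
by congr (T _ x); apply/funext => z; rewrite big_cons.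
Qed.

(** Duality: for fixed x take W = sum_i (T w_i)(x) w_i. Then the sum Q of squares is (T W)(x) <= C
    |W|, and near orthogonality gives |W|^2 <= Q (V^2 + dl N); one factor Q cancels. *)
Lemma gram_bound (N : nat) (V dl : R) (w : 'I_N -> X -> R) : 0 <= dl ->
  (forall i, L2 (w i)) -> (forall i, n2 (w i) <= V) ->
  (forall i j, i != j -> `|ip (w i) (w j)| <= dl) ->
  forall x, D x -> \sum_i T (w i) x ^+ 2 <= C ^+ 2 * (V ^+ 2 + dl * N%:R).
Proof.
move=> dl0 lw wV wd x Dx; pose c i := T (w i) x.
set Q := \sum_i _; have Q0 : 0 <= Q by apply: sumr_ge0 => i _; exact: sqr_ge0.
pose W y := \sum_i c i * w i y.
have lcw i : L2 (fun y => c i * w i y) by exact: (L2Z mD).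
have lW : L2 W by exact: (L2_sum mD).
have QW : Q = T W x.
  by rewrite (operator_sum _ _ lw Dx); apply: eq_bigr => i _; rewrite expr2.
have nW : n2 W ^+ 2 <= Q * (V ^+ 2 + dl * N%:R).
  (* The diagonal contributes V^2 Q; off the diagonal the product c_i c_j is split by Young's
     inequality, and summation gives dl N Q. *)
  have ij i j : c i * c j * ip (w i) (w j) <=
      (c i ^+ 2 + c j ^+ 2) / 2 * dl + (if i == j then c i ^+ 2 * V ^+ 2 else 0).
    have [<-|nij] := eqVneq i j.
      rewrite -n2_sq -expr2 ler_wpDl//; first by rewrite mulr_ge0// divr_ge0// addr_ge0// sqr_ge0.
      rewrite ler_wpM2l ?sqr_ge0// ler_sqr ?nnegrE ?n2_ge0//.
      exact: le_trans (n2_ge0 _ _ _) (wV i).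
    rewrite addr0; apply: (le_trans (ler_norm _)); rewrite normrM; apply: ler_pM => //.
      rewrite normrM ler_pdivlMr// -(real_normK (num_real (c i))) -(real_normK (num_real (c j))).
      by rewrite -subr_ge0; have := sqr_ge0 (`|c i| - `|c j|); rewrite sqrrB mulr_natr addrAC.
    exact: wd.
  have -> : n2 W ^+ 2 = \sum_i \sum_j c i * c j * ip (w i) (w j).
    rewrite n2_sq (ip_suml mD)//; apply: eq_bigr => i _.
    rewrite ipC (ip_suml mD)//; apply: eq_bigr => j _.
    by rewrite (ipZl mD)// ipC (ipZl mD)// mulrA [c j * _]mulrC.
  apply: (le_trans (ler_sum _ (fun i _ => ler_sum _ (fun j _ => ij i j)))).
  under eq_bigr do rewrite big_split/=.
  rewrite big_split/= mulrDr addrC; apply: lerD.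
    rewrite mulr_suml; apply: ler_sum => i _.
    by rewrite (bigD1 i)//= eqxx big1 ?addr0// => j /negbTE; rewrite eq_sym => ->.
  rewrite le_eqVlt; apply/orP; left; apply/eqP.
  under eq_bigr do rewrite -mulr_suml -mulr_suml big_split/= sumr_const card_ord.
  rewrite -mulr_suml -mulr_suml big_split/= sumr_const card_ord -/Q.
  rewrite (_ : \sum_(i < N) T (w i) x ^+ 2 *+ N = Q *+ N); last by rewrite -sumrMnl.
  by rewrite -mulr2n -[_ *+ 2]mulr_natr mulfK// -[Q *+ N]mulr_natr -mulrA [N%:R * _]mulrC.
have [Qz|Qn] := eqVneq Q 0.
  by rewrite Qz mulr_ge0 ?sqr_ge0// addr_ge0 ?sqr_ge0// mulr_ge0.
have Qp : 0 < Q by rewrite lt_neqAle eq_sym Qn.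
rewrite -(ler_pM2l Qp) mulrCA -expr2; apply: (@le_trans _ _ (C ^+ 2 * n2 W ^+ 2)); last first.
  by rewrite ler_wpM2l ?sqr_ge0.
rewrite -exprMn -(ger0_norm Q0) -[leRHS]real_normK ?num_real// ler_sqr ?nnegrE//.
rewrite QW; apply: (le_trans (TC lW Dx)); exact: ler_norm.
Qed.

(** If the images do not become small, members of the family with image norm at least e are selected
    one by one; weak convergence makes each new member almost orthogonal to the finitely many chosen
    before. Integrating [gram_bound] limits their number. *)
Lemma compact_limit (I : Type) (F : set_system I) {PF : ProperFilter F}
    (v : I -> X -> R) (V : R) :
  (\forall t \near F, L2 (v t) /\ n2 (v t) <= V) ->
  (forall g, L2 g -> ip (v t) g @[t --> F] --> (0 : R)) ->
  forall e, 0 < e -> \forall t \near F, n2 (T (v t)) <= e.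
Proof.
move=> bv wv e e0; have [//|nF] := pselect (\forall t \near F, n2 (T (v t)) <= e).
have sel (dl : R) N : 0 < dl -> exists w : 'I_N -> X -> R,
    (forall i, [/\ L2 (w i), n2 (w i) <= V & e <= n2 (T (w i))]) /\
    (forall i j, i != j -> `|ip (w i) (w j)| <= dl).
  move=> dl0; elim: N => [|N [w [w1 w2]]]; first by exists (fun _ _ => 0); split => -[].
  have nw : \forall t \near F, forall i, `|ip (v t) (w i)| <= dl.
    apply: filter_forall => i; have [li _ _] := w1 i.
    by have /cvgr0Pnorm_le/(_ _ dl0) := wv _ li.
  have [t [[lt tV] wt te]] : exists t, [/\ L2 (v t) /\ n2 (v t) <= V,
      (forall i, `|ip (v t) (w i)| <= dl) & e <= n2 (T (v t))].
    apply: contrapT => ne; apply: nF; near=> t.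
    rewrite leNgt; apply/negP => /ltW et; apply: ne; exists t; split => //; near: t => //.
  exists (fun i => if unlift ord0 i is Some j then w j else v t); split => [i|i j].
    by case: unliftP => [j _|_].
  case: unliftP => [i' ->|->]; case: unliftP => [j' ->|->]; rewrite ?eqxx//.
    by rewrite (inj_eq lift_inj); exact: w2.
  by rewrite ipC.
(* With tolerance 1/N for N functions the defect term dl N equals 1, so B bounds the sum of the
   squared norms independently of N. *)
pose B := C ^+ 2 * (V ^+ 2 + 1) * fine (mu D).
have [N hN] : exists N : nat, B < N.+1%:R * e ^+ 2.
  exists (Num.truncn (B / e ^+ 2)); rewrite -ltr_pdivrMr ?exprn_gt0//; exact: truncnS_gt.
have dl0 : 0 < N.+1%:R^-1 :> R by rewrite invr_gt0.
have [w [w1 w2]] := sel _ N.+1 dl0.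
have lTw i : L2 (T (w i)) by apply: LT; case: (w1 i).
have hQ : \sum_i n2 (T (w i)) ^+ 2 <= B.
  have -> : \sum_i n2 (T (w i)) ^+ 2 = \int[mu]_(x in D) (\sum_i T (w i) x ^+ 2).
    rewrite (Int_sum mD); first by apply: eq_bigr => i _; rewrite n2_sq; apply: eq_Int => x _; rewrite expr2.
    by move=> i; case: (lTw i).
  have lc := L1_cst mD Dfin (C ^+ 2 * (V ^+ 2 + 1)).
  rewrite /B -(Rintegral_cst mu mD); apply: (Int_le_ae mD) lc _.
    by apply: (L1_sum mD) => i; case: (lTw i).
  apply: aeD_all => x Dx; have := @gram_bound N.+1 V _ w (ltW dl0) _ _ w2 x Dx.
  by rewrite mulVf//; apply => i; case: (w1 i).
have : N.+1%:R * e ^+ 2 <= B.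
  apply: le_trans hQ; rewrite -[in leLHS](card_ord N.+1) mulr_natl -sumr_const.
  apply: ler_sum => i _; have [_ _ h] := w1 i.
  by rewrite ler_sqr ?nnegrE ?n2_ge0// ltW.
by rewrite leNgt hN.
Unshelve. all: by end_near.
Qed.

End gram.

(** * Uniform bounds and the exact linearization of the state equation *)

Section sup_estimates.
Context (R : realType) (n : nat) (Omega : set 'rV[R]_n).
Local Notation mu := (lebesgue_rV R n).
Local Notation fct := ('rV[R]_n -> R).
Local Notation L2 := (L2 mu Omega).
Local Notation n2 := (n2 mu Omega).
Local Notation aeO := (aeD mu Omega).
Local Notation pair := (H10pair Omega).
Hypotheses (oO : open Omega) (bO : bounded_set Omega) (n03 : (0 < n <= 3)%N).
Variables (a : 'I_n -> 'I_n -> fct) (lam : R).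
Hypothesis ella : elliptic Omega a lam.

Lemma sup_bound0 : exists2 C, 0 < C & forall y G h g (N : R), pair y G -> L2 g -> L2 h ->
    aeO (fun x => 0 <= h x * y x) -> weak_eq Omega a y G h g -> 0 < N -> n2 g <= N ->
    aeO (fun x => `|y x| <= C * N).
Proof.
have m0 : 0 <= fine (mu Omega) by rewrite fine_ge0.
(* Taking s = M >= 1, the measure of the domain is at most s^6 and the iteration can start at level
   0. *)
pose M := 1 + fine (mu Omega); have M1 : 1 <= M by rewrite lerDl.
have M0 : 0 < M by exact: lt_le_trans M1.
have [C C0 hC] := sup_bound oO bO n03 ella M; exists (C * M); first by rewrite mulr_gt0.
move=> y G h g N yG lg lh hy e N0 gN.
have := hC y G h g 0 M N yG lg lh hy e (lexx _) _ N0 gN; rewrite M0 lexx => /(_ isT).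
rewrite add0r; apply; right; apply: (@le_trans _ _ M); first by rewrite lerDr.
by rewrite -[leLHS]expr1 ler_weXn2l.
Qed.

(** Data that are only bounded suffice: the level e/2 costs half of e, s is chosen so that the
    iteration adds at most e/2, and r is the L2 norm for which Chebyshev permits this s. *)
Lemma sup_vanish (N e : R) : 0 < N -> 0 < e -> exists2 r, 0 < r &
  forall y G h g, pair y G -> L2 g -> L2 h ->
    aeO (fun x => 0 <= h x * y x) -> weak_eq Omega a y G h g -> n2 g <= N -> n2 y <= r ->
    aeO (fun x => `|y x| <= e).
Proof.
move=> N0 e0; have [C C0 hC] := sup_bound oO bO n03 ella 1.
have e2 : 0 < e / 2 by rewrite divr_gt0.
have CN : 0 < C * N by rewrite mulr_gt0.
pose s := Num.min 1 (e / 2 / (C * N)).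
have s01 : 0 < s <= 1 by rewrite lt_min ltr01 divr_gt0//= ge_min lexx.
have s0 : 0 < s by case/andP: s01.
exists (e / 2 * s ^+ 3); first by rewrite mulr_gt0// exprn_gt0.
move=> y G h g yG lg lh hy eq gN yr.
have := hC y G h g (e / 2) s N yG lg lh hy eq (ltW e2) s01 N0 gN.
have yr' : n2 y ^+ 2 <= (e / 2) ^+ 2 * s ^+ 6.
  rewrite (_ : s ^+ 6 = (s ^+ 3) ^+ 2); last by rewrite -exprM.
  by rewrite -exprMn ler_sqr ?nnegrE ?n2_ge0// mulr_ge0 ?exprn_ge0 ?(ltW e2) ?(ltW s0).
move=> /(_ (or_introl (conj e2 yr'))); apply: aeD_mp => x _ hx; apply: (le_trans hx).
rewrite [leRHS](splitr e) lerD2l mulrAC mulrC -ler_pdivlMr//.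
by rewrite ge_min lexx orbT.
Qed.

End sup_estimates.

Section linearization.
Context (R : realType) (n : nat) (Omega : set 'rV[R]_n).
Local Notation mu := (lebesgue_rV R n).
Local Notation fct := ('rV[R]_n -> R).
Local Notation L2 := (L2 mu Omega).
Local Notation L1 := (L1 mu Omega).
Local Notation n2 := (n2 mu Omega).
Local Notation ip := (ip mu Omega).
Local Notation aeO := (aeD mu Omega).
Local Notation pair := (H10pair Omega).
Hypotheses (oO : open Omega) (bO : bounded_set Omega) (n03 : (0 < n <= 3)%N).
Implicit Types (u v y z h g psi : fct) (G H : 'I_n -> fct).

Let mO : measurable Omega. Proof. exact: open_measurable_rV. Qed.
Let fO : (mu Omega < +oo)%E. Proof. exact: bounded_set_lty. Qed.

Variables (a : 'I_n -> 'I_n -> fct) (lam : R).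
Hypothesis ella : elliptic Omega a lam.
Variables (q : \bar R) (f : 'rV[R]_n -> R -> R) (S : fct -> fct).
Hypotheses (q1 : (1 <= q)%E) (hf : admissible_nonlinearity Omega q f).
Hypothesis hS : control_to_state Omega a f S.
Variables (u0 : fct) (T : fct -> fct).
Hypotheses (lu0 : L2 u0) (hT : frechet_L2_Y Omega S u0 T).

Definition statediff u x : R := S u x - S u0 x.
Definition taylor_remainder u x : R := f x (S u x) - f x (S u0 x) - fy f x (S u0 x) * statediff u x.

Lemma state_facts u : L2 u -> [/\ L2 (S u), measurable_fun Omega (S u) &
  exists2 M, 0 < M & forall x, Omega x -> `|S u x| <= M].
Proof.
move=> lu; have [Y _] := state oO hS lu; have [l _ _] := inY_pair oO bO Y.
by split => //; [exact: (L2_measurable l)|exact: (inY_bounded bO)].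
Qed.

Lemma eta_pair u : L2 u -> pair (statediff u) (fun i x => grad Omega (S u) i x - grad Omega (S u0) i x).
Proof.
move=> lu; have [Y _] := state oO hS lu; have [Y0 _] := state oO hS lu0.
exact: pairB (inY_pair oO bO Y) (inY_pair oO bO Y0).
Qed.

Lemma eta_L2 u : L2 u -> L2 (statediff u).
Proof. by move=> lu; have [] := eta_pair lu. Qed.

Lemma eta_bounded u : L2 u -> exists2 M, 0 < M & forall x, Omega x -> `|statediff u x| <= M.
Proof.
move=> lu; have [_ _ [M M0 hM]] := state_facts lu; have [_ _ [M' M'0 hM']] := state_facts lu0.
exists (M + M'); first exact: addr_gt0.
by move=> x Ox; rewrite (le_trans (ler_normB _ _))// lerD ?hM ?hM'.
Qed.

Lemma L2_linearized v : L2 v -> L2 (T v).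
Proof. by move=> lv; have [] := inY_pair oO bO (linearized_inY oO hT lv). Qed.

Lemma L2_coef0 h : L2 h -> L2 (fun x => fy f x (S u0 x) * h x).
Proof. by move=> lh; have [_ m [M _ hM]] := state_facts lu0; exact: (L2_coef oO hf m hM lh). Qed.

Lemma remainder_L2 u : L2 u -> L2 (taylor_remainder u).
Proof.
move=> lu; apply: (L2B mO); last exact/L2_coef0/eta_L2.
exact: (L2_state_difference oO bO hf hS lu0 lu).
Qed.

(** Both functions solve the linearized equation with right side u - u0 minus the remainder, and its
    solution is unique by [weak_eq_n2]. Being exact, the identity lets all remainders be estimated
    through the linear operator T. *)
Lemma state_linearization u : L2 u ->
  aeO (fun x => statediff u x = T (fun x => u x - u0 x - taylor_remainder u x) x).
Proof.
move=> lu; have lr := remainder_L2 lu.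
have lh : L2 (fun x => u x - u0 x - taylor_remainder u x) by exact: (L2B mO (L2B mO lu lu0)).
set h := (fun x => u x - u0 x - _) in lh *.
have lv : L2 (fun x => u x - u0 x) by exact: (L2B mO).
have pe := eta_pair lu; have le := eta_L2 lu; have lce := L2_coef0 le.
have [Me Me0 hMe] := eta_bounded lu.
have YT := linearized_inY oO hT lh; have [Mt Mt0 hMt] := inY_bounded bO YT.
have pT := inY_pair oO bO YT; have [lT _ _] := pT; have lcT := L2_coef0 lT.
have eqe : weak_eq Omega a (statediff u) (fun i x => grad Omega (S u) i x - grad Omega (S u0) i x)
    (fun x => fy f x (S u0 x) * statediff u x) h.
  move=> psi H pH pC; have [lp _ _] := pH.
  have := state_difference oO bO ella q1 hf hS lu0 lu pH pC.
  rewrite /h (ipBl mO lv lr lp) => <-.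
  rewrite -addrA; congr (_ + _); rewrite -(ipBl mO _ lr lp)//.
    by apply: eq_ip => // x _; rewrite /taylor_remainder opprB addrC subrK.
  exact: (L2_state_difference oO bO hf hS lu0 lu).
have eqT := linearized_eq oO bO ella q1 hf hS lu0 hT lh.
pose dd x := -1 * T h x + statediff u x.
have dM x : Omega x -> `|dd x| <= Mt + Me.
  by move=> Ox; rewrite (le_trans (ler_normD _ _))// lerD ?hMe// mulN1r normrN hMt.
have grow (y : fct) : exists C, aeO (fun x => `|dd x| <= C * (1 + `|y x|)).
  exists (Mt + Me); apply: aeD_all => x Ox; apply: (le_trans (dM x Ox)).
  by rewrite ler_peMr ?lerDl// addr_ge0 ?ltW.
have pd := H10pairD oO bO (-1) pT pe.
have eqd := weak_eqD oO bO ella (-1) pT pe lcT lce lh lh (grow _) (grow _) eqT eqe.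
have [C C0 hC] := weak_eq_n2 oO bO n03 ella.
have := hC _ _ _ _ pd (L2D mO (L2Z mO (-1) lcT) lce) (L2D mO (L2Z mO (-1) lh) lh) _ eqd.
move=> /(_ _)/wrap[|nd].
  apply: aeD_mp (fy_ge0 hf) => x _ hx.
  have -> : -1 * (fy f x (S u0 x) * T h x) + fy f x (S u0 x) * statediff u x = fy f x (S u0 x) * dd x.
    by rewrite /dd [RHS]mulrDr; congr (_ + _); exact: mulrCA.
  by rewrite -mulrA mulr_ge0// -expr2 sqr_ge0.
have [ld _ _] := pd; have : n2 dd = 0.
  apply/eqP; rewrite eq_le n2_ge0 andbT; apply: (le_trans nd).
  rewrite (@eq_n2 _ _ _ mu Omega _ (fun=> 0)) => [|x _]; last by rewrite mulN1r addNr.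
  by rewrite (n2_0 mu mO) mulr0.
by move=> /(n2_eq0 mO ld); apply: aeD_mp => x _ /eqP; rewrite /dd mulN1r addrC subr_eq0 => /eqP.
Qed.

End linearization.

Lemma aeD_and d (X : measurableType d) (R : realType) (mu : {measure set X -> \bar R})
    (D : set X) (P Q : X -> Prop) :
  aeD mu D P -> aeD mu D Q -> aeD mu D (fun x => P x /\ Q x).
Proof. exact: aeD_mp2. Qed.

Lemma adjoint_identity (R : realType) (E E0 p p0 c : R) :
  E - E0 + c = E + p - (E0 + p0) - p + p0 + c.
Proof. by ring. Qed.

Lemma quarter_bound (R : realType) (e x y : R) : x <= 2 * y -> 0 < e ->
  e / 4 * x + e / 4 * x <= e * y.
Proof.
move=> xy e0; have e4 : 0 <= e / 4 by lra.
by have := ler_wpM2l e4 xy; lra.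
Qed.

Lemma comparison_pointwise (R : realType) (et z df s p p0 C B e : R) :
  0 <= C -> 0 <= B -> 0 <= e ->
  `|df - s * et| <= e * `|et| -> `|p - p0| <= e -> `|p| <= B -> `|s| <= C -> `|p0| <= B ->
  `|et - df * p - (1 - s * p0) * z| <= (1 + C * B) * `|et - z| + e * (B + C) * `|et|.
Proof.
move=> C0 B0 e0 h1 h2 h3 h4 h5.
have -> : et - df * p - (1 - s * p0) * z =
  (et - z) - s * p0 * (et - z) - ((df - s * et) * p + s * et * (p - p0)) by ring.
apply: (le_trans (ler_normB _ _)); apply: lerD.
  apply: (le_trans (ler_normB _ _)); rewrite [(1 + _) * _]mulrDl mul1r lerD2l !normrM.
  by rewrite ler_wpM2r// ler_pM.
apply: (le_trans (ler_normD _ _)); rewrite [e * (B + C)]mulrDr [(e * B + _) * _]mulrDl.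
apply: lerD; rewrite !normrM.
  by rewrite mulrAC ler_pM// mulr_ge0.
by rewrite mulrAC [e * C]mulrC ler_wpM2r// ler_pM.
Qed.

(** * Asymptotics of states and adjoint states *)

Section asymptotics.
Context (R : realType) (n : nat) (Omega : set 'rV[R]_n).
Local Notation mu := (lebesgue_rV R n).
Local Notation fct := ('rV[R]_n -> R).
Local Notation L2 := (L2 mu Omega).
Local Notation L1 := (L1 mu Omega).
Local Notation n2 := (n2 mu Omega).
Local Notation ip := (ip mu Omega).
Local Notation aeO := (aeD mu Omega).
Local Notation pair := (H10pair Omega).
Hypotheses (oO : open Omega) (bO : bounded_set Omega) (n03 : (0 < n <= 3)%N).
Implicit Types (u v y z h g psi : fct) (G H : 'I_n -> fct).

Let mO : measurable Omega. Proof. exact: open_measurable_rV. Qed.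
Let fO : (mu Omega < +oo)%E. Proof. exact: bounded_set_lty. Qed.

Variables (a : 'I_n -> 'I_n -> fct) (lam : R).
Hypothesis ella : elliptic Omega a lam.
Variables (q : \bar R) (f : 'rV[R]_n -> R -> R) (S : fct -> fct).
Hypotheses (q1 : (1 <= q)%E) (hf : admissible_nonlinearity Omega q f).
Hypothesis hS : control_to_state Omega a f S.
Variables (u0 : fct) (T : fct -> fct).
Hypotheses (lu0 : L2 u0) (hT : frechet_L2_Y Omega S u0 T).
Variable V : R.
Hypothesis V0 : 0 < V.
Local Notation dv u := (fun x => u x - u0 x).
Local Notation statediff := (statediff S u0).
Local Notation taylor_remainder := (taylor_remainder f S u0).
Local Notation good u := (L2 u /\ n2 (dv u) <= V).

Let good0 : good u0.
Proof.
split=> //; rewrite (@eq_n2 _ _ _ mu Omega _ (fun=> 0)) ?(n2_0 mu mO) ?(ltW V0)//.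
by move=> x _; rewrite subrr.
Qed.

Lemma state_sup : exists2 M, 0 < M & forall u, good u ->
  aeO (fun x => `|S u x| <= M /\ `|statediff u x| <= M).
Proof.
have [C C0 hC] := sup_bound0 oO bO n03 ella.
have [ly0 _ [M0 M00 hM0]] := state_facts oO bO hS lu0.
exists (M0 + C * V); first by rewrite addr_gt0 ?mulr_gt0.
move=> u [lu uV]; have pe := eta_pair oO bO hS lu0 lu.
have ld := L2_state_difference oO bO hf hS lu0 lu.
have := hC _ _ _ _ V pe (L2B mO lu lu0) ld _ (state_difference oO bO ella q1 hf hS lu0 lu) V0 uV.
move=> /(_ _)/wrap[|h].
  by apply: aeD_mp (nonlinearity_monotone hf) => x _; apply.
apply: aeD_mp h => x Ox h; split; last by rewrite (le_trans h)// lerDr ltW.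
by rewrite -[S u x](subrK (S u0 x)) (le_trans (ler_normD _ _))// addrC lerD// hM0.
Qed.

Lemma pointwise_bounds : exists2 C, 0 < C & forall u, good u -> aeO (fun x =>
  [/\ `|statediff u x| <= C, `|fyy f x (S u0 x)| <= C,
      `|fy f x (S u x) - fy f x (S u0 x)| <= C * `|statediff u x| &
      `|taylor_remainder u x| <= C * `|statediff u x| ^+ 2]).
Proof.
have [M M0 hM] := state_sup; have [C C0 hC] := nonlinearity_lipschitz hf M.
exists (M + C); first exact: addr_gt0.
move=> u gu; apply: aeD_mp2 (hM u gu) (aeD_and (hM u0 good0) hC).
move=> x _ [h1 h2] [[h3 _] {}hC]; have [||_ c1 _ c2 c3] := hC (S u0 x) (S u x) => //.
split.
- by rewrite (le_trans h2)// lerDl ltW.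
- by rewrite (le_trans c1)// lerDr ltW.
- by rewrite (le_trans c2)// ler_wpM2r// lerDr ltW.
- by rewrite (le_trans c3)// ler_wpM2r ?exprn_ge0// lerDr ltW.
Qed.

Lemma n2_remainder : exists2 C, 0 < C & forall u, good u ->
  forall e, 0 <= e -> aeO (fun x => `|statediff u x| <= e) -> n2 (taylor_remainder u) <= C * e * n2 (statediff u).
Proof.
have [C C0 hC] := pointwise_bounds; exists C => // u gu e e0 he.
have lr := remainder_L2 oO bO hf hS lu0 gu.1; have le := eta_L2 oO bO hS lu0 gu.1.
rewrite -[C * e]ger0_norm ?mulr_ge0 ?(ltW C0)// -(n2Z mO)//; apply: (n2_le mO) => //.
  exact: (L2Z mO).
apply: aeD_mp2 he (hC u gu) => x _ h1 [_ _ _ h2].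
rewrite (le_trans h2)// [leRHS]normrM ger0_norm ?mulr_ge0 ?(ltW C0)//.
by rewrite expr2 mulrA ler_wpM2r// ler_wpM2l// ltW.
Qed.

Lemma linearization_error : exists2 C, 0 < C & forall u, good u ->
  n2 (fun x => statediff u x - T (dv u) x) <= C * n2 (taylor_remainder u).
Proof.
have [C C0 hC] := linearized_bound oO bO hT.
exists (C * n2 (fun=> 1) + 1); first by rewrite ltr_wpDl// mulr_ge0 ?n2_ge0// ltW.
move=> u [lu uV]; have lr := remainder_L2 oO bO hf hS lu0 lu.
have le := eta_L2 oO bO hS lu0 lu; have lv := L2B mO lu lu0.
have lTr := L2_linearized oO bO hT lr; have lTv := L2_linearized oO bO hT lv.
(* By linearity the error of the linearization is -T applied to the Taylor remainder. *)
apply: (@le_trans _ _ (n2 (T (taylor_remainder u)))).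
  apply: (n2_le mO) => //; first exact: (L2B mO).
  apply: aeD_mp (state_linearization oO bO n03 ella q1 hf hS lu0 hT lu) => x Ox ->.
  have := linearizedD oO hT (-1) lr lv (subset_closure Ox).
  rewrite (_ : (fun x => -1 * taylor_remainder u x + (u x - u0 x)) = (fun x => u x - u0 x - taylor_remainder u x)); last first.
    by apply/funext => z; rewrite mulN1r addrC.
  by move=> ->; rewrite addrK mulN1r normrN.
apply: (@le_trans _ _ (C * n2 (taylor_remainder u) * n2 (fun=> 1))).
  apply: (n2_bdd mO fO (L2_measurable lTr)); last by rewrite mulr_ge0 ?n2_ge0 ?ltW.
  by apply: aeD_all => x Ox; exact: hC.
by rewrite mulrAC ler_wpM2r ?n2_ge0// lerDl.
Qed.

Variables (yd : fct) (P : fct -> fct).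
Hypotheses (lyd : L2 yd) (hP : adjoint_state Omega a f yd S P).
Local Notation aT := (fun i j => a j i).
Local Notation dP u := (fun x => P u x - P u0 x).
Local Notation gradP u := (fun i x => grad Omega (P u) i x - grad Omega (P u0) i x).
Local Notation dfy u := (fun x => fy f x (S u x) - fy f x (S u0 x)).
Local Notation gdP u := (fun x => statediff u x - (fy f x (S u x) - fy f x (S u0 x)) * P u x).

Lemma adjoint_pair u : L2 u -> pair (P u) (grad Omega (P u)).
Proof. by move=> /(inL2P _ mO)/hP[hp _]; exact: inH10_H10pair. Qed.

Lemma adjoint_L2_coef u h : L2 u -> L2 h -> L2 (fun x => fy f x (S u x) * h x).
Proof.
move=> lu lh; have [_ m [M _ hM]] := state_facts oO bO hS lu.
exact: (L2_coef oO hf m hM lh).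
Qed.

Lemma adjoint_eq u psi H : L2 u -> pair psi H ->
  energy Omega aT (grad Omega (P u)) H + ip (fun x => fy f x (S u x) * P u x) psi =
  ip (fun x => S u x - yd x) psi.
Proof.
move=> lu pH; have lu' : inL Omega 2%:E u by exact/(inL2P _ mO).
exact: (weak_solution_pair oO bO (elliptic_transpose ella) (hP lu') pH).
Qed.

Lemma adjoint_sup : exists2 B, 0 < B & forall u, good u -> aeO (fun x => `|P u x| <= B).
Proof.
have [C C0 hC] := sup_bound0 oO bO n03 (elliptic_transpose ella).
have [M M0 hM] := state_sup.
pose N := M * n2 (fun=> 1) + n2 yd + 1.
have N0 : 0 < N by rewrite ltr_wpDl// addr_ge0 ?n2_ge0// mulr_ge0 ?n2_ge0// ltW.
exists (C * N); first by rewrite mulr_gt0.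
move=> u gu; have [lu _] := gu; have pp := adjoint_pair lu; have [lp _ _] := pp.
have [ly my _] := state_facts oO bO hS lu.
apply: (hC _ _ (fun x => fy f x (S u x) * P u x) (fun x => S u x - yd x) N pp) => //.
- exact: (L2B mO).
- exact: adjoint_L2_coef.
- by apply: aeD_mp (fy_ge0 hf) => x _ h; rewrite -mulrA mulr_ge0// -expr2 sqr_ge0.
- by move=> psi H pH _; exact: adjoint_eq.
- apply: (le_trans (n2B mO ly lyd)); rewrite /N -addrA lerD//; last by rewrite lerDl.
  apply: (n2_bdd mO fO my _ (ltW M0)).
  by apply: aeD_mp (hM u gu) => x _ [].
Qed.

Lemma dfy_bddM : exists2 C, 0 < C & forall u, good u ->
  L2 (gdP u) /\ n2 (gdP u) <= C * n2 (statediff u).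
Proof.
have [B B0 hB] := adjoint_sup; have [C C0 hC] := pointwise_bounds.
exists (1 + C * B); first by rewrite addr_gt0// mulr_gt0.
move=> u gu; have [lu _] := gu; have le := eta_L2 oO bO hS lu0 lu.
have [lp _ _] := adjoint_pair lu; have mp := L2_measurable lp.
have [_ my _] := state_facts oO bO hS lu; have [_ my0 _] := state_facts oO bO hS lu0.
have [_ mf _] := nonlinearity_measurable oO hf my.
have [_ mf0 _] := nonlinearity_measurable oO hf my0.
have mg : measurable_fun Omega (gdP u).
  apply: measurable_funB; first exact: (L2_measurable le).
  by apply: measurable_funM => //; exact: measurable_funB.
have bg : aeO (fun x => `|gdP u x| <= `|(1 + C * B) * statediff u x|).
  apply: aeD_mp2 (hB u gu) (hC u gu) => x _ h1 [_ _ h2 _].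
  have k0 : 0 <= 1 + C * B by rewrite addr_ge0// mulr_ge0// ltW.
  rewrite [leRHS]normrM (ger0_norm k0) [leRHS]mulrDl mul1r.
  by rewrite (le_trans (ler_normB _ _))// lerD2l normrM mulrAC ler_pM.
have lg := L2_le mO mg (L2Z mO (1 + C * B) le) bg; split => //.
have k0 : 0 <= 1 + C * B by rewrite addr_ge0// mulr_ge0// ltW.
rewrite -[1 + C * B](ger0_norm k0).
by rewrite -(n2Z mO)//; apply: (n2_le mO) => //; exact: (L2Z mO).
Qed.

(** The coefficient of the equation for [P u] is frozen at u0; what this changes is moved to the
    right side [gdP u]. The operator then becomes the adjoint of the linearized one. *)
Lemma dP_eq u psi H : good u -> pair psi H ->
  energy Omega aT (gradP u) H + ip (fun x => fy f x (S u0 x) * (P u x - P u0 x)) psi =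
  ip (gdP u) psi.
Proof.
move=> gu pH; have [lu _] := gu; have [K _ hK] := dfy_bddM; have [lg _] := hK u gu.
have [lp lGp _] := adjoint_pair lu; have [lp0 lGp0 _] := adjoint_pair lu0.
have [lpsi lH _] := pH; have lcp := adjoint_L2_coef lu lp.
have lcp0 := adjoint_L2_coef lu0 lp0; have lcd := adjoint_L2_coef lu0 (L2B mO lp lp0).
have [ly _ _] := state_facts oO bO hS lu; have [ly0 _ _] := state_facts oO bO hS lu0.
have e1 := adjoint_eq lu pH; have e0 := adjoint_eq lu0 pH.
rewrite (energyBl oO bO (elliptic_transpose ella))//.
have e2 : ip (gdP u) psi = ip (fun x => S u x - yd x) psi - ip (fun x => S u0 x - yd x) psi
   - ip (fun x => fy f x (S u x) * P u x) psi + ip (fun x => fy f x (S u0 x) * P u0 x) psi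
   + ip (fun x => fy f x (S u0 x) * (P u x - P u0 x)) psi.
  rewrite -(ipBl mO (L2B mO ly lyd) (L2B mO ly0 lyd) lpsi).
  rewrite -(ipBl mO (L2B mO (L2B mO ly lyd) (L2B mO ly0 lyd)) lcp lpsi).
  rewrite -(ipDl mO (L2B mO (L2B mO (L2B mO ly lyd) (L2B mO ly0 lyd)) lcp) lcp0 lpsi).
  rewrite -(ipDl mO (L2D mO (L2B mO (L2B mO (L2B mO ly lyd) (L2B mO ly0 lyd)) lcp) lcp0) lcd lpsi).
  by apply: eq_ip => // x _; rewrite /statediff; ring.
rewrite e2 -e1 -e0; exact: adjoint_identity.
Qed.

(** The equation for the difference of the adjoint states is tested with T v and the linearized
    equation with that difference, which is admissible because adjoint states are bounded; the forms
    are transposes of each other. *)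
Lemma adjoint_duality u : good u -> ip (dP u) (dv u) = ip (gdP u) (T (dv u)).
Proof.
move=> gu; have [lu _] := gu; have lv := L2B mO lu lu0.
have Yz := linearized_inY oO hT lv; have pz := inY_pair oO bO Yz.
have pp := pairB oO bO (adjoint_pair lu) (adjoint_pair lu0).
have [B B0 hB] := adjoint_sup.
rewrite -(dP_eq gu pz) (energy_transpose Omega a) ipC.
rewrite -(linearized_eq oO bO ella q1 hf hS lu0 hT lv pp).
  by congr (_ + _); apply: eq_Int => x _; rewrite -!mulrA [T _ _ * _]mulrC.
exists (B + B); apply: aeD_mp2 (hB u gu) (hB u0 good0) => x _ h1 h2.
rewrite (le_trans (ler_normB _ _))// (le_trans (lerD h1 h2))//.
by rewrite ler_peMr ?lerDl// addr_ge0// ltW.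
Qed.

Definition hessian v : R :=
  \int[mu]_(x in Omega) ((1 - fyy f x (S u0 x) * P u0 x) * (T v x * T v x)).

Lemma hessian_coef : exists2 C, 0 < C & 
  measurable_fun Omega (fun x => 1 - fyy f x (S u0 x) * P u0 x) /\
  aeO (fun x => `|1 - fyy f x (S u0 x) * P u0 x| <= C).
Proof.
have [B B0 hB] := adjoint_sup; have [C C0 hC] := pointwise_bounds.
have [lp _ _] := adjoint_pair lu0; have mp := L2_measurable lp.
have [_ my0 _] := state_facts oO bO hS lu0.
have [_ _ mf0] := nonlinearity_measurable oO hf my0.
exists (1 + C * B); first by rewrite addr_gt0// mulr_gt0.
split; first by apply: measurable_funB => //; exact: measurable_funM.
apply: aeD_mp2 (hB u0 good0) (hC u0 good0) => x _ h1 [_ h2 _ _].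
rewrite (le_trans (ler_normB _ _))// normr1 lerD2l normrM.
by apply: ler_pM.
Qed.

Lemma hessianE v : L2 v -> hessian v = ip (fun x => (1 - fyy f x (S u0 x) * P u0 x) * T v x) (T v).
Proof. by move=> lv; apply: eq_Int => x _; rewrite mulrA. Qed.

Lemma hessian_bound : exists2 C, 0 < C & forall v, L2 v -> `|hessian v| <= C * n2 (T v) ^+ 2.
Proof.
have [C C0 [mc hc]] := hessian_coef; exists C => // v lv; rewrite hessianE//.
have lz := L2_linearized oO bO hT lv; have lcz := L2_bddM mO mc hc lz.
apply: (le_trans (ip_CS mO lcz lz)); rewrite expr2 mulrA ler_wpM2r ?n2_ge0//.
exact: (n2_bddM mO (ltW C0) mc hc lz).
Qed.

Section family.
Context (I : Type) (F : set_system I) {PF : ProperFilter F}.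
Variable (u : I -> fct).
Hypotheses (gu : \forall t \near F, good (u t))
  (wu : forall g, L2 g -> ip (dv (u t)) g @[t --> F] --> (0 : R)).

Lemma linearized_vanish e : 0 < e -> \forall t \near F, n2 (T (dv (u t))) <= e.
Proof.
have [C C0 hC] := linearized_bound oO bO hT.
move=> e0; apply: (@compact_limit _ _ _ mu Omega mO fO T C (L2_linearized oO bO hT) _ hC _ F PF
  (fun t => dv (u t)) V _ wu e e0).
- move=> c v1 v2 l1 l2 x Ox; exact: (linearizedD oO hT c l1 l2 (subset_closure Ox)).
- by apply: filterS gu => t [lu uV]; split => //; exact: (L2B mO lu lu0).
Qed.

Section adjoint.
Variable T' : fct -> fct.
Hypothesis hT' : forall g, L2 g -> L2 (T' g) /\ forall v, L2 v -> ip (T v) g = ip v (T' g).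

(** |T' v|^2 = (T (T' v), v), and the functions T' v are again bounded and weakly null, so
    compactness of T applies to them. *)
Lemma adjoint_vanish e : 0 < e -> \forall t \near F, n2 (T' (dv (u t))) <= e.
Proof.
move=> e0; have [C C0 hC] := linearized_bound oO bO hT.
set n1 := n2 (fun=> 1); have n10 : 0 <= n1 by exact: n2_ge0.
have nT v : L2 v -> n2 (T v) <= C * n1 * n2 v.
  move=> lv; rewrite mulrAC; apply: (n2_bdd mO fO).
  - exact: (L2_measurable (L2_linearized oO bO hT lv)).
  - by apply: aeD_all => x Ox; exact: hC.
  - by rewrite mulr_ge0 ?n2_ge0// ltW.
have sq v : L2 v -> n2 (T' v) ^+ 2 <= n2 (T (T' v)) * n2 v.
  move=> lv; have [lv' h] := hT' lv.
  rewrite n2_sq -(h _ lv'); apply: le_trans (ler_norm _) (ip_CS mO _ lv).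
  exact: (L2_linearized oO bO hT).
have bT' v : L2 v -> n2 (T' v) <= C * n1 * n2 v.
  move=> lv; have [lv' _] := hT' lv; have [->|nz] := eqVneq (n2 (T' v)) 0.
    by rewrite !mulr_ge0 ?n2_ge0// ltW.
  have np : 0 < n2 (T' v) by rewrite lt_neqAle eq_sym nz n2_ge0.
  rewrite -(ler_pM2r np) -expr2 mulrAC; apply: (le_trans (sq v lv)).
  by rewrite ler_wpM2r ?n2_ge0//; exact: nT.
have e' : 0 < e ^+ 2 / V by rewrite divr_gt0// exprn_gt0.
have := @compact_limit _ _ _ mu Omega mO fO T C (L2_linearized oO bO hT) _ hC _ F PF
  (fun t => T' (dv (u t))) (C * n1 * V) _ _ _ e'.
move=> /(_ _)/wrap[|]; first by move=> c v1 v2 l1 l2 x Ox; exact: (linearizedD oO hT c l1 l2 (subset_closure Ox)).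
move=> /(_ _)/wrap[|].
  apply: filterS gu => t [lu uV]; have lv := L2B mO lu lu0; have [lv' _] := hT' lv.
  by split => //; apply: (le_trans (bT' _ lv)); rewrite ler_wpM2l// mulr_ge0// ltW.
move=> /(_ _)/wrap[g lg|].
  have lTg := L2_linearized oO bO hT lg; have := wu lTg.
  apply: cvg_trans; apply: near_eq_cvg; apply: filterS gu => t [lu _].
  have lv := L2B mO lu lu0; have [_ h] := hT' lv.
  by rewrite ipC (h _ lg) ipC.
apply: filterS2 gu => t [lu uV] h; have lv := L2B mO lu lu0.
rewrite -ler_sqr ?nnegrE ?n2_ge0 ?(ltW e0)//; apply: (le_trans (sq _ lv)).
apply: (@le_trans _ _ (e ^+ 2 / V * V)); last by rewrite divfK ?gt_eqF.
by apply: ler_pM => //; exact: n2_ge0.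
Qed.

(** Compactness cannot be applied to the nonlinear state map. Monotonicity bounds the energy of the
    difference y by (v, y); as y = T (v - r), this equals (T' v, v - r), where r is bounded and T' v
    tends to 0. *)
Lemma eta_vanish e : 0 < e -> \forall t \near F, n2 (statediff (u t)) <= e.
Proof.
move=> e0; have [C C0 hC] := n2_remainder; have [B B0 hB] := pointwise_bounds.
have [K K0 hK] := energy_poincare oO bO n03 ella.
set n1 := n2 (fun=> 1); have n10 : 0 <= n1 by exact: n2_ge0.
pose W := V + C * B * (B * n1); have W0 : 0 < W.
  by rewrite ltr_wpDr// !mulr_ge0 ?(ltW C0) ?(ltW B0).
have d0 : 0 < e ^+ 2 / (K * W) by rewrite divr_gt0 ?exprn_gt0 ?mulr_gt0.
apply: filterS2 gu (adjoint_vanish d0) => t gt hd; have [lu uV] := gt.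
have lv := L2B mO lu lu0; have le := eta_L2 oO bO hS lu0 lu.
have lr := remainder_L2 oO bO hf hS lu0 lu.
have eB : aeO (fun x => `|statediff (u t) x| <= B) by apply: aeD_mp (hB _ gt) => x _ [].
have nr : n2 (taylor_remainder (u t)) <= C * B * (B * n1).
  apply: (le_trans (hC _ gt B (ltW B0) eB)); rewrite ler_wpM2l ?mulr_ge0 ?(ltW C0) ?(ltW B0)//.
  exact: (n2_bdd mO fO (L2_measurable le) eB (ltW B0)).
have lh := L2B mO lv lr; have [lT'v hadj] := hT' lv.
have i1 : ip (dv (u t)) (statediff (u t)) <= W * (e ^+ 2 / (K * W)).
  have -> : ip (dv (u t)) (statediff (u t)) = ip (dv (u t)) (T (fun x => u t x - u0 x - taylor_remainder (u t) x)).
    apply: (ip_eq_ae mO) => //; [exact: (L2_linearized oO bO hT)|exact: aeD_all|].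
    exact: (state_linearization oO bO n03 ella q1 hf hS lu0 hT lu).
  rewrite ipC (hadj _ lh); apply: (le_trans (ler_norm _)).
  apply: (le_trans (ip_CS mO lh lT'v)); apply: ler_pM; rewrite ?n2_ge0//.
  by apply: (le_trans (n2B mO lv lr)); rewrite lerD.
have pe := eta_pair oO bO hS lu0 lu.
have en := weak_eq_energy oO pe (L2_state_difference oO bO hf hS lu0 lu) _
  (state_difference oO bO ella q1 hf hS lu0 lu).
have {}en : energy Omega a (fun i x => grad Omega (S (u t)) i x - grad Omega (S u0) i x)
   (fun i x => grad Omega (S (u t)) i x - grad Omega (S u0) i x) <= ip (dv (u t)) (statediff (u t)).
  by apply: en; apply: aeD_mp (nonlinearity_monotone hf) => x _; apply.
rewrite -ler_sqr ?nnegrE ?n2_ge0 ?(ltW e0)//; apply: (le_trans (hK _ _ pe)).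
apply: (@le_trans _ _ (K * (W * (e ^+ 2 / (K * W))))).
  by rewrite ler_wpM2l ?(ltW K0)// (le_trans en).
by rewrite mulrA mulrC divfK// mulf_neq0// gt_eqF.
Qed.

Lemma eta_sup_vanish e : 0 < e -> \forall t \near F, aeO (fun x => `|statediff (u t) x| <= e).
Proof.
move=> e0; have [r r0 hr] := sup_vanish oO bO n03 ella V0 e0.
apply: filterS2 gu (eta_vanish r0) => t [lu uV] he.
have pe := eta_pair oO bO hS lu0 lu.
apply: (hr _ _ _ _ pe (L2B mO lu lu0) (L2_state_difference oO bO hf hS lu0 lu) _
  (state_difference oO bO ella q1 hf hS lu0 lu) uV he).
by apply: aeD_mp (nonlinearity_monotone hf) => x _; apply.
Qed.

(** The remainder is quadratic in y, and one factor y is uniformly small. *)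
Lemma zeta_vanish e : 0 < e -> \forall t \near F,
  n2 (fun x => statediff (u t) x - T (dv (u t)) x) <= e * n2 (statediff (u t)).
Proof.
move=> e0; have [C C0 hC] := n2_remainder; have [B B0 hB] := linearization_error.
have d0 : 0 < e / (B * C) by rewrite divr_gt0 ?mulr_gt0.
apply: filterS2 gu (eta_sup_vanish d0) => t gt he.
apply: (le_trans (hB _ gt)).
apply: (le_trans (ler_wpM2l (ltW B0) (hC _ gt _ (ltW d0) he))).
by rewrite !mulrA [B * C * e / _]mulrAC divff ?mul1r// mulf_neq0// gt_eqF.
Qed.

(** Since y - z is at most half of y in norm, errors measured by y can be expressed by z. *)
Lemma eta_le : \forall t \near F, n2 (statediff (u t)) <= 2 * n2 (T (dv (u t))).
Proof.
have h2 : 0 < 2^-1 :> R by [].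
apply: filterS2 gu (zeta_vanish h2) => t [lu uV] h.
have lv := L2B mO lu lu0; have le := eta_L2 oO bO hS lu0 lu.
have lz := L2_linearized oO bO hT lv.
have : n2 (statediff (u t)) <= n2 (fun x => statediff (u t) x - T (dv (u t)) x) + n2 (T (dv (u t))).
  rewrite [leLHS](@eq_n2 _ _ _ mu Omega _ (fun x => (statediff (u t) x - T (dv (u t)) x) + T (dv (u t)) x)).
    exact: (n2D mO (L2B mO le lz) lz).
  by move=> x _; rewrite subrK.
move: h; lra.
Qed.

Lemma dP_sup_vanish e : 0 < e -> \forall t \near F, aeO (fun x => `|P (u t) x - P u0 x| <= e).
Proof.
move=> e0; have [C C0 hC] := sup_bound0 oO bO n03 (elliptic_transpose ella).
have [K K0 hK] := dfy_bddM; have d0 : 0 < e / C / K by rewrite !divr_gt0.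
have N0 : 0 < e / C by rewrite divr_gt0.
apply: filterS2 gu (eta_vanish d0) => t gt he; have [lu _] := gt; have [lg ng] := hK _ gt.
have pp := pairB oO bO (adjoint_pair lu) (adjoint_pair lu0); have [lpp _ _] := pp.
have gN : n2 (gdP (u t)) <= e / C.
  apply: (le_trans ng); rewrite mulrC -ler_pdivlMr//.
have := hC _ _ (fun x => fy f x (S u0 x) * (P (u t) x - P u0 x)) _ _ pp lg _ _ _ N0 gN.
rewrite mulrC divfK ?gt_eqF//; apply.
- exact: (adjoint_L2_coef lu0 lpp).
- by apply: aeD_mp (fy_ge0 hf) => x _ h; rewrite -mulrA mulr_ge0// -expr2 sqr_ge0.
- by move=> psi H pH _; exact: dP_eq.
Qed.

(* Let [z = T (u - u0)], [y] the difference of the states and [zeta = y - z]. The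
   integrands of (dP, u - u0) and of the second derivative, both paired with z,
   differ by zeta - (df' - f'' y) P(u) - f'' y dP - f'' P(u0) zeta. *)
Lemma hessian_comparison e : 0 < e -> \forall t \near F,
  `|ip (dP (u t)) (dv (u t)) - hessian (dv (u t))| <= e * n2 (T (dv (u t))) ^+ 2.
Proof.
move=> e0; have [M M0 hM] := state_sup; have [C C0 hC] := pointwise_bounds.
have [B B0 hB] := adjoint_sup.
pose k := 1 + C * B; have k0 : 0 < k by rewrite addr_gt0// mulr_gt0.
have BC : 0 < B + C by rewrite addr_gt0.
(* Each of the two groups of error terms contributes e/4 times |y|, and |y| <= 2 |z|. *)
pose e1 := e / 4 / (B + C); have e10 : 0 < e1 by rewrite !divr_gt0.
pose e2 := e / 4 / k; have e20 : 0 < e2 by rewrite !divr_gt0.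
have [r r0 hr] := fy_difference hf M0 e10.
have [Kg Kg0 hKg] := dfy_bddM; have [Ch Ch0 [mc hc]] := hessian_coef.
near=> t.
have gt : good (u t) by near: t.
have [lu _] := gt; have lv := L2B mO lu lu0; have lz := L2_linearized oO bO hT lv.
have le := eta_L2 oO bO hS lu0 lu; have lzeta := L2B mO le lz.
have [lg _] := hKg _ gt; have lcz := L2_bddM mO mc hc lz.
have hz : n2 (fun x => statediff (u t) x - T (dv (u t)) x) <= e2 * n2 (statediff (u t)).
  by near: t; exact: zeta_vanish.
have he : aeO (fun x => `|statediff (u t) x| <= r) by near: t; exact: eta_sup_vanish.
have hp : aeO (fun x => `|P (u t) x - P u0 x| <= e1) by near: t; exact: dP_sup_vanish.
have h2 : n2 (statediff (u t)) <= 2 * n2 (T (dv (u t))) by near: t; exact: eta_le.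
rewrite (adjoint_duality gt) (hessianE lv) -(ipBl mO lg lcz lz).
have lD := L2B mO lg lcz; apply: (le_trans (ip_CS mO lD lz)).
rewrite expr2 mulrA ler_wpM2r ?n2_ge0//.
have m0 : 0 <= e1 * (B + C) by rewrite mulr_ge0 ?ltW.
have la1 := L2Z mO k (L2_norm mO lzeta).
have la2 := L2Z mO (e1 * (B + C)) (L2_norm mO le).
apply: (@le_trans _ _ (n2 (fun x => k * `|statediff (u t) x - T (dv (u t)) x| + e1 * (B + C) * `|statediff (u t) x|))).
  apply: (n2_le mO) => //; first exact: (L2D mO).
  have hh := aeD_and (aeD_and (hM _ gt) (hM _ good0)) (aeD_and he hr).
  have hh' := aeD_and (aeD_and hp (hB _ gt)) (aeD_and (hC _ gt) (hB _ good0)).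
  apply: aeD_mp2 hh hh' => x _ [[[s1 _] [s2 _]] [he' hr']] [[hp' b1] [[_ c1 _ _] b2]].
  rewrite [leRHS]ger0_norm; last by apply: addr_ge0; apply: mulr_ge0 => //; exact: ltW.
  have hd := hr' _ _ s2 s1 he'.
  exact: (@comparison_pointwise _ (statediff (u t) x) (T (dv (u t)) x) _ _ _ _ _ _ _
    (ltW C0) (ltW B0) (ltW e10) hd hp' b1 c1 b2).
apply: (le_trans (n2D mO la1 la2)); rewrite !(n2Z mO) ?n2_abs; try exact: (L2_norm mO).
rewrite (gtr0_norm k0) (ger0_norm m0).
have -> : e1 * (B + C) = e / 4 by rewrite divfK// gt_eqF.
apply: (@le_trans _ _ (e / 4 * n2 (statediff (u t)) + e / 4 * n2 (statediff (u t)))).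
  rewrite lerD2r; apply: (le_trans (ler_wpM2l (ltW k0) hz)).
  by rewrite mulrA [k * _]mulrC divfK// gt_eqF.
by move: h2 e0; clear; exact: quarter_bound.
Unshelve. all: by end_near.
Qed.

End adjoint.
End family.
End asymptotics.

(** * Optimality conditions *)

Section pointwise.
Context (R : realType).
Implicit Types (b c p l ua ub al : R).

(* directional derivative of the absolute value at [b] *)
Definition dabs b c : R := if b == 0 then `|c| else Num.sg b * c.

(** Convexity of the absolute value. Used at both end points, it yields the monotonicity of j'. *)
Lemma dabs_le b c : dabs b (c - b) <= `|c| - `|b|.
Proof.
rewrite /dabs; have [->|b0] := eqVneq b 0; first by rewrite subr0 normr0 subr0.
have hc := ler_norm c; have hc' := ler_norm (- c); rewrite normrN in hc'.
have [b1|b1|/eqP] := ltgtP b 0; last by rewrite (negbTE b0).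
  by rewrite ltr0_sg// (ltr0_norm b1); lra.
by rewrite gtr0_sg// (gtr0_norm b1); lra.
Qed.

Lemma dabs_norm b c : `|dabs b c| <= `|c|.
Proof.
rewrite /dabs; have [_|b0] := eqVneq b 0; first by rewrite normr_id.
by rewrite normrM normr_sg b0 mul1r.
Qed.

(** If b is nonzero, then l = sg b, testing with 0 gives |p| >= be with p of the opposite sign, and
    testing with the bounds forces u to the good side of b unless |p| = be; equality holds. If b = 0
    and |p| <= be, the claim is the triangle inequality; if |p| > be, the bounds force u to have the
    sign of p. *)
Lemma pointwise_growth (p be l b u ua ub : R) : 0 < be -> ua <= 0 <= ub -> ua <= u <= ub ->
  ua <= b <= ub -> `|l| <= 1 -> `|b| <= l * b ->
  0 <= (p + be * l) * (ua - b) -> 0 <= (p + be * l) * (ub - b) ->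
  0 <= (p + be * l) * (0 - b) ->
  `| `|p| - be| * `|u - b| <= p * (u - b) + be * dabs b (u - b).
Proof.
move=> be0 /andP[a0 b0] /andP[au ub_] /andP[ab bb] l1 lb ha hb h0.
rewrite /dabs; have [bz|bn] := eqVneq b 0.
  move: bz ha hb ab bb lb h0 => -> ha hb _ _ _ _; rewrite !subr0 in ha hb *.
  have /andP[l1' l1''] : -1 <= l <= 1 by rewrite -ler_norml.
  have [pb|bp] := leP `|p| be.
    rewrite distrC ger0_norm ?subr_ge0// mulrBl.
    by have := ler_norm (- (p * u)); rewrite normrN normrM; lra.
  rewrite ger0_norm ?subr_ge0 ?(ltW bp)//.
  have [p0|p0] := leP 0 p.
    have lD : 0 < p + be * l by rewrite ger0_norm// in bp; nra.
    have ua0 : 0 <= ua by rewrite -(pmulr_rge0 _ lD).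
    have u0 : 0 <= u by exact: le_trans au.
    rewrite !ger0_norm//; nra.
  have lD : p + be * l < 0 by rewrite ltr0_norm// in bp; nra.
  have ub0 : ub <= 0 by rewrite -(nmulr_rge0 _ lD).
  have u0 : u <= 0 by exact: le_trans ub0.
  rewrite !ler0_norm ?(ltW p0)//; nra.
have /orP[bpos|bneg] : (0 < b) || (b < 0) by rewrite -neq_lt eq_sym.
  have l_1 : l = 1.
    apply/eqP; rewrite eq_le (le_trans (ler_norm l))//=.
    by rewrite -(ler_pM2r bpos) mul1r -{1}(gtr0_norm bpos).
  move: ha hb h0; rewrite l_1 mulr1 gtr0_sg// mul1r => ha hb h0.
  have D0 : p + be <= 0 by nra.
  have p0 : p <= 0 by nra.
  rewrite (ler0_norm p0) ger0_norm; last by lra.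
  rewrite -mulrDl -opprD; have [->|Dn] := eqVneq (p + be) 0; first by rewrite oppr0 !mul0r.
  have Dl : p + be < 0 by rewrite lt_neqAle Dn.
  have ub1 : ub - b <= 0 by rewrite -(nmulr_rge0 _ Dl).
  by rewrite ler0_norm ?mulrNN//; lra.
have l_1 : l = -1.
  have := ler_norm (- l); rewrite normrN => ln; rewrite (ltr0_norm bneg) in lb; nra.
move: ha hb h0; rewrite l_1 ltr0_sg// => ha hb h0.
have D0 : 0 <= p - be by nra.
have p0 : 0 <= p by nra.
rewrite (ger0_norm p0) ger0_norm//.
rewrite mulN1r mulrN -mulrBl; have [->|Dn] := eqVneq (p - be) 0; first by rewrite !mul0r.
have Dl : 0 < p - be by rewrite lt_neqAle eq_sym Dn.
have ua1 : 0 <= ua - b by rewrite -(pmulr_rge0 _ Dl); move: ha; rewrite mulrN1.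
by rewrite ger0_norm//; lra.
Qed.

End pointwise.

Section patching.
Context d (X : measurableType d) (R : realType)
  (mu : {measure set X -> \bar R}) (D : set X).
Hypothesis mD : measurable D.
Implicit Types (f g h v w : X -> R).

(** Localizes integral inequalities: a competitor that is changed only where the integrand h is
    negative turns an inequality for all competitors into this hypothesis. *)
Lemma ae_ge0_min h : L1 mu D h -> 0 <= \int[mu]_(x in D) Num.min (h x) 0 ->
  aeD mu D (fun x => 0 <= h x).
Proof.
move=> lh i0.
have mm : measurable_fun D (fun x => Num.min (h x) 0).
  by apply: measurable_minr; [exact: (L1_measurable lh)|exact: measurable_cst].
have lm : L1 mu D (fun x => Num.min (h x) 0).
  apply: (L1_le mD mm (L1_norm lh)); apply: aeD_all => x _.
  by have [h0|h0] := ltP (h x) 0; rewrite ?normr0.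
have lN := L1N mD lm.
have : aeD mu D (fun x => - Num.min (h x) 0 = 0).
  apply: (Int_eq0_ae mD lN).
    by apply: aeD_all => x _; rewrite oppr_ge0 ge_min lexx orbT.
  have -> : \int[mu]_(x in D) - Num.min (h x) 0 = - \int[mu]_(x in D) Num.min (h x) 0.
    rewrite -mulN1r -RintegralZl//; apply: eq_Int => x _; by rewrite mulN1r.
  by rewrite oppr_le0.
by apply: aeD_mp => x _ /eqP; rewrite oppr_eq0; have [h0 /eqP h1|//] := ltP (h x) 0; rewrite h1 ltxx in h0.
Qed.

Lemma measurable_neg_patch h v w : measurable_fun D h -> measurable_fun D v ->
  measurable_fun D w -> measurable_fun D (fun x => if h x < 0 then v x else w x).
Proof.
move=> mh mv mw; apply: measurable_fun_if => //.
- by apply: measurable_fun_ltr => //; exact: measurable_cst.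
- by apply: measurable_funS mv => //; exact: subIsetl.
- by apply: measurable_funS mw => //; exact: subIsetl.
Qed.

Lemma measurable_sg h : measurable_fun D h -> measurable_fun D (fun x => Num.sg (h x)).
Proof.
move=> mh; rewrite (_ : (fun x => _) = (fun x => if h x < 0 then -1 else if - h x < 0 then 1 else 0)).
  by apply: measurable_neg_patch => //; apply: measurable_neg_patch => //; exact: measurableT_comp.
apply/funext => x; rewrite oppr_lt0; have [h0|h0|->] := ltgtP (h x) 0.
- exact: ltr0_sg.
- exact: gtr0_sg.
- exact: sgr0.
Qed.

Lemma L2_neg_patch h v w : measurable_fun D h -> L2 mu D v -> L2 mu D w ->
  L2 mu D (fun x => if h x < 0 then v x else w x).
Proof.
move=> mh lv lw.
have mp := measurable_neg_patch mh (L2_measurable lv) (L2_measurable lw).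
apply: (L2_le mD mp (L2D mD (L2_norm mD lv) (L2_norm mD lw))).
apply: aeD_all => x _; rewrite [leRHS]ger0_norm ?addr_ge0//.
by case: ifP => _; rewrite ?lerDl ?lerDr.
Qed.

End patching.

Section first_order.
Context (R : realType) (n : nat) (Omega : set 'rV[R]_n).
Local Notation mu := (lebesgue_rV R n).
Local Notation fct := ('rV[R]_n -> R).
Local Notation L2 := (L2 mu Omega).
Local Notation L1 := (L1 mu Omega).
Local Notation n2 := (n2 mu Omega).
Local Notation ip := (ip mu Omega).
Local Notation aeO := (aeD mu Omega).
Hypotheses (oO : open Omega) (bO : bounded_set Omega).
Implicit Types (u v w p : fct).

Let mO : measurable Omega. Proof. exact: open_measurable_rV. Qed.
Let fO : (mu Omega < +oo)%E. Proof. exact: bounded_set_lty. Qed.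

Lemma jL1E u : measurable_fun Omega u -> jL1 Omega u = \int[mu]_(x in Omega) `|u x|.
Proof. exact: normL1E. Qed.

Lemma measurable_dabs u v : measurable_fun Omega u -> measurable_fun Omega v ->
  measurable_fun Omega (fun x => dabs (u x) (v x)).
Proof.
move=> m1 m2; apply: measurable_fun_if => //.
- by apply: measurable_fun_eqr => //; exact: measurable_cst.
- by apply: measurable_funS (measurableT_comp (@normr_measurable R setT) m2) => //; exact: subIsetl.
- have ms : measurable_fun Omega (fun x => Num.sg (u x) * v x).
    by apply: measurable_funM => //; exact: measurable_sg.
  by apply: measurable_funS ms => //; exact: subIsetl.
Qed.

Lemma L1_dabs u v : measurable_fun Omega u -> L1 v -> L1 (fun x => dabs (u x) (v x)).
Proof.
move=> m1 l1; apply: (L1_le mO _ (L1_norm l1)).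
  by apply: measurable_dabs => //; exact: (L1_measurable l1).
by apply: aeD_all => x _; exact: dabs_norm.
Qed.

Lemma jL1'E u v : measurable_fun Omega u -> L1 v ->
  jL1' Omega u v = \int[mu]_(x in Omega) dabs (u x) (v x).
Proof.
move=> m1 lv; have ld := L1_dabs m1 lv.
have me : measurable (Omega `&` [set x | u x = 0]).
  by rewrite (_ : [set x | u x = 0] = u @^-1` [set 0]); [exact: m1|].
have mne : measurable (Omega `&` [set x | u x != 0]).
  rewrite (_ : [set x | u x != 0] = u @^-1` (~` [set 0])); first by apply: m1 => //; exact: measurableC.
  by apply/seteqP; split => x /= /eqP.
rewrite [in RHS](_ : Omega = (Omega `&` [set x | u x != 0]) `|` (Omega `&` [set x | u x = 0])); last first.
  rewrite -setIUr (_ : _ `|` _ = setT) ?setIT//; apply/seteqP; split => // x _ /=.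
  by have [|] := eqVneq (u x) 0; [right|left].
rewrite Rintegral_setU//.
- by congr (_ + _); apply: eq_Int => x [_ /=]; rewrite /dabs; [move=> /negbTE ->|move=> ->; rewrite eqxx].
- apply: integrableS ld => //; first exact: measurableU.
  by move=> x [[]|[]].
- by apply/disj_setPS => x [[_ /= +] [_ /= h]]; rewrite h eqxx.
Qed.

Lemma subdiff_pointwise u lm : L2 u -> subdiff_jL1 Omega u lm ->
  aeO (fun x => `|lm x| <= 1 /\ `|u x| <= lm x * u x).
Proof.
move=> lu [/(inL2P _ mO) ll hs].
have key w : L2 w -> aeO (fun x => 0 <= `|w x| - `|u x| - lm x * (w x - u x)).
  move=> lw; pose h x := `|w x| - `|u x| - lm x * (w x - u x).
  have lh : L1 h.
    apply: (L1B mO); first by apply: (L1B mO); exact: (L2_L1 mO fO (L2_norm mO _)).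
    exact: (L2M mO ll (L2B mO lw lu)).
  apply: (ae_ge0_min mO lh); pose v x := if h x < 0 then w x else u x.
  have lv : L2 v by exact: (L2_neg_patch mO (L1_measurable lh) lw lu).
  have := hs v ((inL2P _ mO).2 lv).
  rewrite (jL1E (L2_measurable lu)) (jL1E (L2_measurable lv)).
  rewrite dotL2E -lerBrDl -subr_ge0.
  have l1 := L2_L1 mO fO (L2_norm mO lv); have l2 := L2_L1 mO fO (L2_norm mO lu).
  have l3 := L2M mO ll (L2B mO lv lu).
  rewrite -RintegralB// -RintegralB//; last exact: (L1B mO l1 l2).
  move=> hh; apply: (le_trans hh); rewrite le_eqVlt; apply/orP; left; apply/eqP.
  apply: eq_Int => x _; rewrite /v /=; case: ifP => hx.
    by rewrite -/(h x) min_l// ltW.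
  by rewrite !subrr mulr0 subr0 min_r// leNgt hx.
(* The competitor 0 gives |u| <= lm u; the competitor u + sg lm gives |lm| <= |u + sg lm| - |u| <=
   1. *)
have ls : L2 (fun x => u x + Num.sg (lm x)).
  apply: (L2D mO lu); apply: (L2_bdd mO fO (c := 1)).
    exact: (measurable_sg mO (L2_measurable ll)).
  by apply: aeD_all => x _; rewrite normr_sg; case: (_ != _); rewrite ?ler01.
apply: aeD_mp2 (key _ (L2_0 mu Omega)) (key _ ls) => x _.
rewrite normr0 !sub0r subr_ge0 mulrN => h1 h2; split; last by lra.
move: h2; rewrite [_ + _ - u x]addrAC subrr add0r mulrC -normrEsg => h2.
have : `|u x + Num.sg (lm x)| <= `|u x| + 1.
  by rewrite (le_trans (ler_normD _ _))// lerD2l normr_sg; case: (_ != _); rewrite ?ler01.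
lra.
Qed.

End first_order.

Lemma projection_variational (R : realType) (ua ub h u b : R) : ua <= u <= ub ->
  b = Num.max ua (Num.min h ub) -> 0 <= (b - h) * (u - b).
Proof.
move=> /andP[au ub1] ->; have aub := le_trans au ub1.
have [hb|bh] := leP h ub.
  have [ah|ha] := leP ua h; first by rewrite subrr mul0r.
  by rewrite mulr_ge0// subr_ge0// ltW.
by rewrite max_r// mulr_le0// subr_le0// ltW.
Qed.

Lemma stationarity_arith (R : realType) (D1 D2 be p p0 al b n : R) : D1 + D2 <= 0 -> 0 < be ->
  0 <= - p - al * (b + n) + be * D1 -> p - p0 + (p0 + be * D2) + al * n <= - al * b.
Proof. by move=> h b0 h1; have := ler_wpM2l (ltW b0) h; rewrite mulr0; lra. Qed.

(** * Admissible controls: growth of the linearized objective and the source condition *)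

Section controls.
Context (R : realType) (n : nat) (Omega : set 'rV[R]_n).
Local Notation mu := (lebesgue_rV R n).
Local Notation fct := ('rV[R]_n -> R).
Local Notation L2 := (L2 mu Omega).
Local Notation L1 := (L1 mu Omega).
Local Notation n2 := (n2 mu Omega).
Local Notation ip := (ip mu Omega).
Local Notation aeO := (aeD mu Omega).
Hypotheses (oO : open Omega) (bO : bounded_set Omega).
Implicit Types (u v w p h : fct).

Let mO : measurable Omega. Proof. exact: open_measurable_rV. Qed.
Let fO : (mu Omega < +oo)%E. Proof. exact: bounded_set_lty. Qed.

Variables (ua ub : fct) (beta : R).
Hypotheses (hua : inL Omega +oo%E ua) (hub : inL Omega +oo%E ub).
Hypothesis uab : aeO (fun x => ua x <= 0 <= ub x).
Hypothesis beta0 : 0 < beta.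
Local Notation Uad := (Uad Omega ua ub).

Lemma Uad_bounded : exists2 K, 0 < K & forall u, Uad u -> L2 u /\ aeO (fun x => `|u x| <= K).
Proof.
have [ma [Ka Ka0 hKa]] := inLoo_bounded oO hua; have [mb [Kb Kb0 hKb]] := inLoo_bounded oO hub.
exists (Ka + Kb); first exact: addr_gt0.
move=> u [/(inL2P _ mO) lu hu]; split => //.
apply: aeD_mp2 (aeD_and hKa hKb) (hu : aeO _) => x _ [ha hb] /andP[h1 h2].
by move: ha hb; rewrite !ler_norml => /andP[a1 a2] /andP[b1 b2]; apply/andP; split; lra.
Qed.

Lemma Uad_L2 u : Uad u -> L2 u.
Proof. by move=> [/(inL2P _ mO)]. Qed.

Lemma Uad_ae u : Uad u -> aeO (fun x => ua x <= u x <= ub x).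
Proof. by move=> []. Qed.

Lemma Uad_intro u : L2 u -> aeO (fun x => ua x <= u x <= ub x) -> Uad u.
Proof. by move=> lu hu; split => //; exact/inL2P. Qed.

Lemma Uad_special : [/\ Uad ua, Uad ub & Uad (fun=> 0)].
Proof.
have [ma [Ka Ka0 hKa]] := inLoo_bounded oO hua; have [mb [Kb Kb0 hKb]] := inLoo_bounded oO hub.
split; apply: Uad_intro; try exact: (L2_bdd mO fO ma hKa); try exact: (L2_bdd mO fO mb hKb);
  try exact: L2_0; by apply: aeD_mp uab => x _ /andP[h1 h2]; rewrite ?lexx ?h1 ?h2 ?(le_trans h1 h2).
Qed.

Lemma Uad_neg_patch h u v : measurable_fun Omega h -> Uad u -> Uad v ->
  Uad (fun x => if h x < 0 then u x else v x).
Proof.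
move=> mh Uu Uv; apply: Uad_intro; first exact: (L2_neg_patch mO mh (Uad_L2 Uu) (Uad_L2 Uv)).
by apply: aeD_mp2 (Uad_ae Uu) (Uad_ae Uv) => x _; case: ifP.
Qed.

Lemma FO_pointwise p ubar u : L2 p -> Uad ubar -> Uad u ->
  (forall u, Uad u -> 0 <= ip p (fun x => u x - ubar x)) ->
  aeO (fun x => 0 <= p x * (u x - ubar x)).
Proof.
move=> lp Ub Uu h; pose g x := p x * (u x - ubar x).
have lg : L1 g by exact: (L2M mO lp (L2B mO (Uad_L2 Uu) (Uad_L2 Ub))).
apply: (ae_ge0_min mO lg).
apply: (le_trans (h _ (Uad_neg_patch (L1_measurable lg) Uu Ub))).
rewrite le_eqVlt; apply/orP; left; apply/eqP; apply: eq_Int => x _.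
case: ifP => hx; first by rewrite -/(g x) min_l// ltW.
by rewrite subrr mulr0 -/(g x) min_r// leNgt hx.
Qed.

Variables (P : fct -> fct) (ubar : fct).
Hypotheses (Ub : Uad ubar) (lp : L2 (P ubar)) (hFO : FO Omega ua ub beta P ubar).
Local Notation dv u := (fun x => u x - ubar x).

Lemma FO_growth u : Uad u ->
  aeO (fun x => `| `|P ubar x| - beta| * `|u x - ubar x| <=
     P ubar x * (u x - ubar x) + beta * dabs (ubar x) (u x - ubar x)).
Proof.
move=> Uu; have [lm hlm hge] := hFO.
have ll : L2 lm by have [/(inL2P _ mO)] := hlm.
have lq : L2 (fun x => P ubar x + beta * lm x) by exact: (L2D mO lp (L2Z mO beta ll)).
have FOp := FO_pointwise lq Ub _ hge.
have [Ua' Ub' U0] := Uad_special.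
have h1 := aeD_and (FOp _ Ua') (FOp _ Ub').
have h2 := aeD_and (FOp _ U0) (subdiff_pointwise oO bO (Uad_L2 Ub) hlm).
have h3 := aeD_and uab (aeD_and (Uad_ae Uu) (Uad_ae Ub)).
apply: aeD_mp2 (aeD_and h1 h2) h3 => x _ [[a1 a2] [a3 [a4 a5]]] [b1 [b2 b3]].
exact: (pointwise_growth beta0 b1 b2 b3 a4 a5 a1 a2 a3).
Qed.

Definition growth u : R := ip (P ubar) (dv u) + beta * jL1' Omega ubar (dv u).

Lemma growthE u : Uad u -> 
  L1 (fun x => P ubar x * (u x - ubar x) + beta * dabs (ubar x) (u x - ubar x)) /\
  growth u = \int[mu]_(x in Omega) (P ubar x * (u x - ubar x) + beta * dabs (ubar x) (u x - ubar x)).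
Proof.
move=> Uu; have lv := L2B mO (Uad_L2 Uu) (Uad_L2 Ub).
have mb := L2_measurable (Uad_L2 Ub).
have ld := L1_dabs oO mb (L2_L1 mO fO lv); have l1 := L2M mO lp lv.
have l2 := L1Z mO beta ld; split; first exact: (L1D mO l1 l2).
by rewrite RintegralD// RintegralZl// /growth (jL1'E oO mb (L2_L1 mO fO lv)).
Qed.

Lemma stationarity_bound alpha u : L2 (P u) ->
  stationary_point Omega ua ub beta P alpha u ->
  ip (fun x => P u x - P ubar x) (dv u) + growth u + alpha * n2 (dv u) ^+ 2 <=
  - alpha * ip ubar (dv u).
Proof.
move=> lpu [Uu hst]; have lu := Uad_L2 Uu; have lb := Uad_L2 Ub.
have lv := L2B mO lu lb; have lv' := L2B mO lb lu.
have mb := L2_measurable lb; have mu1 := L2_measurable lu.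
have d1 := L1_dabs oO mb (L2_L1 mO fO lv); have d2 := L1_dabs oO mu1 (L2_L1 mO fO lv').
have := hst ubar Ub; rewrite (jL1'E oO mu1 (L2_L1 mO fO lv')).
have lau := L2Z mO alpha lu.
have -> : dotL2 Omega (P u \+ alpha \*o u) (ubar \- u) = - ip (P u) (dv u) - alpha * ip u (dv u).
  rewrite -(ipZl mO alpha lu lv) -(ipNl mO lpu lv) -(ipBl mO (L2N mO lpu) lau lv).
  by apply: eq_Int => x _ /=; ring.
(* Convexity at both points: the two increments of the absolute value cancel. *)
have mono : \int[mu]_(x in Omega) dabs (u x) (ubar x - u x) +
    \int[mu]_(x in Omega) dabs (ubar x) (u x - ubar x) <= 0.
  rewrite -RintegralD//; have l0 := L1_cst mO fO (0 : R).
  have := Int_le_ae mO (L1D mO d2 d1) l0; rewrite Rintegral_cst// mul0r; apply.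
  apply: aeD_all => x _; apply: (le_trans (lerD (dabs_le (u x) (ubar x)) (dabs_le (ubar x) (u x)))).
  by rewrite addrA subrK subrr.
have -> : ip u (dv u) = ip ubar (dv u) + n2 (dv u) ^+ 2.
  by rewrite n2_sq -(ipDl mO lb lv lv); apply: eq_ip => // x _; rewrite addrC subrK.
rewrite (ipBl mO lpu lp lv) /growth (jL1'E oO mb (L2_L1 mO fO lv)).
move: mono beta0; clear; exact: stationarity_arith.
Qed.

Section active_set.
Variables (I : set 'rV[R]_n) (w : fct) (kappa c : R) (T T' : fct -> fct).
Hypotheses (mI : measurable I) (IO : I `<=` Omega) (lw : L2 w).
Hypotheses (LT : forall v, L2 v -> L2 (T v))
  (hT' : forall g, L2 g -> L2 (T' g) /\ forall v, L2 v -> ip (T v) g = ip v (T' g)).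
Local Notation A := (Omega `\` I).
Local Notation LA u := (\int[mu]_(x in A) `|u x - ubar x|).

Let mA : measurable A. Proof. exact: measurableD. Qed.

Lemma Int_subset (B : set 'rV[R]_n) (g : fct) : B `<=` Omega ->
  \int[mu]_(x in B) g x = \int[mu]_(x in Omega) (\1_B x * g x).
Proof.
move=> BO; rewrite Rintegral_mkcond [RHS]Rintegral_mkcond; apply: eq_Int => x _.
rewrite /patch indicE; have [xB|xB] := boolP (x \in B).
  by rewrite mem_set ?mul1r//; apply: BO; exact: set_mem.
by case: ifP; rewrite ?mul0r.
Qed.

Lemma indic_L1 (B : set 'rV[R]_n) (g : fct) : measurable B -> L1 g -> L1 (fun x => \1_B x * g x).
Proof.
move=> mB lg; apply: (L1_bddM mO (c := 1)) lg; first exact: measurable_indic.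
by apply: aeD_all => x _; rewrite indicE; case: (_ \in _); rewrite ?normr1 ?normr0.
Qed.

Hypotheses (hproj : \forall x \ae mu, I x -> ubar x = projUad ua ub (T' w) x)
  (hoo : inL Omega +oo%E (T' w)).

(** W is kept apart from K because its vanishing is what raises d to kappa. When A is the whole
    domain, boundedness of ubar alone gives the bound with W = 0. *)
Lemma source_bound : exists W K : R, [/\ 0 <= W, 0 <= K,
  (forall x, Omega x -> w x = 0) \/ A = Omega -> W = 0 &
  forall u, Uad u -> - ip ubar (dv u) <= W * n2 (T (dv u)) + K * LA u].
Proof.
have [K K0 hK] := Uad_bounded; have [lb bK] := hK _ Ub.
have [mh [Kh Kh0 hKh]] := inLoo_bounded oO hoo.
have [lh hadj] := hT' lw.
have [AO|nAO] := pselect (A = Omega).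
  exists 0, K; split => // [|u Uu]; first exact: ltW.
  have lv := L2B mO (Uad_L2 Uu) lb; have l1 := L2_L1 mO fO (L2_norm mO lv).
  rewrite mul0r add0r AO -RintegralZl// -(ipNl mO lb lv).
  apply: (Int_le_ae mO); [exact: (L2M mO (L2N mO lb) lv)|exact: (L1Z mO K l1)|].
  apply: aeD_mp bK => x _ hx; apply: (le_trans (ler_norm _)).
  by rewrite normrM normrN ler_wpM2r.
exists (n2 w), (K + Kh); split; rewrite ?n2_ge0 ?addr_ge0 ?ltW//.
  case=> [w0|//]; rewrite (@eq_n2 _ _ _ mu Omega w (fun=> 0))//.
  exact: (n2_0 mu mO).
move=> u Uu; have lv := L2B mO (Uad_L2 Uu) lb; have l1 := L2_L1 mO fO (L2_norm mO lv).
have lA := indic_L1 mA l1; have lhv := L2M mO (L2N mO lh) lv.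
have hpr : aeO (fun x => I x -> ubar x = projUad ua ub (T' w) x).
  by apply: filterS hproj => x h _.
(* On I the variational inequality of the projection replaces ubar by T' w; on A both functions are
   bounded, and the exchange costs a multiple of the L1 norm on A. *)
have e1 : - ip ubar (dv u) <= - ip (T' w) (dv u) + (K + Kh) * LA u.
  rewrite (Int_subset _ (@subDsetl _ _ _)) -!(ipNl mO)// -RintegralZl// -RintegralD//; last exact: (L1Z mO _ lA).
  apply: (Int_le_ae mO).
  - exact: (L2M mO (L2N mO lb) lv).
  - exact: (L1D mO lhv (L1Z mO _ lA)).
  apply: aeD_mp2 (aeD_and bK hKh) (aeD_and hpr (Uad_ae Uu)) => x Ox [h1 h2] [h3 h4].
  rewrite indicE; have [xA|xA] := boolP (x \in A).
    rewrite mul1r; have hh : `|T' w x - ubar x| <= K + Kh.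
      by rewrite (le_trans (ler_normB _ _))// addrC lerD.
    have := ler_norm ((T' w x - ubar x) * (u x - ubar x)); rewrite normrM.
    by have := ler_wpM2r (normr_ge0 (u x - ubar x)) hh; lra.
  have xI : I x by apply: contrapT => nI; move/negP: xA; apply; apply/mem_set.
  have := projection_variational h4 (h3 xI).
  by rewrite mul0r mulr0 addr0; rewrite mulrBl; lra.
apply: (le_trans e1); rewrite lerD2r; apply: (le_trans (ler_norm _)).
rewrite normrN ipC -(hadj _ lv) mulrC; exact: (ip_CS mO (LT lv) lw).
Qed.

Hypotheses (c0 : 0 < c) (Ip : [set x | Omega x /\ `|P ubar x| = beta] `<=` I)
  (hmeas : forall e, 0 < e ->
     (mu [set x | A x /\ (0 < `| `|P ubar x| - beta | < e)%R] <= (c * e `^ kappa)%:E)%E).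

(** On A the weight | |p| - beta | is at least e off the set E, because points of A with weight zero
    would belong to I. On E, |u - ubar| <= 2K and the measure is at most c e^kappa, whence M = 2 K
    c. *)
Lemma growth_lower : exists2 M, 0 <= M & forall u, Uad u -> 0 <= growth u /\
  forall e, 0 < e -> e * LA u - M * (e `^ kappa * e) <= growth u.
Proof.
have [K K0 hK] := Uad_bounded; exists (2 * K * c); first by rewrite !mulr_ge0// ltW.
move=> u Uu; have [lg ->] := growthE Uu; have [lb bK] := hK _ Ub; have [lu bu] := hK _ Uu.
have hg := FO_growth Uu; split.
  apply: (Int_ge0_ae mO lg); apply: aeD_mp hg => x _; apply: le_trans; exact: mulr_ge0.
move=> e e0; set E := [set x | A x /\ (0 < `| `|P ubar x| - beta | < e)%R].
have mE : measurable E.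
  have mq : measurable_fun A (fun x => `| `|P ubar x| - beta|).
    apply: measurable_funS (_ : measurable_fun Omega _); [by []|exact: subDsetl|].
    apply: measurableT_comp => //; apply: measurable_funB => //.
    by apply: measurableT_comp => //; exact: (L2_measurable lp).
  rewrite (_ : E = A `&` (fun x => `| `|P ubar x| - beta|) @^-1` `]0, e[%classic); first exact: mq.
  by apply/seteqP; split => x /=; rewrite in_itv/=.
have EO : E `<=` Omega by move=> x [[]].
have lv := L2B mO lu lb; have l1 := L2_L1 mO fO (L2_norm mO lv).
have lA := indic_L1 mA l1; have lE := indic_L1 mE (L1_cst mO fO 1).
have fE : fine (mu E) <= c * e `^ kappa.
  have h := hmeas e0; rewrite -lee_fin fineK// ge0_fin_numE//; exact: le_lt_trans h (ltry _).
have iE : \int[mu]_(x in Omega) (\1_E x * 1) = fine (mu E).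
  by rewrite -Int_subset// Rintegral_cst// mul1r.
apply: (@le_trans _ _ (e * LA u - 2 * K * e * \int[mu]_(x in Omega) (\1_E x * 1))).
  rewrite lerD2l lerN2 iE; have k0 : 0 <= 2 * K * e by rewrite !mulr_ge0// ltW.
  by have := ler_wpM2l k0 fE; move: (_ `^ _) => t; lra.
rewrite (Int_subset _ (@subDsetl _ _ _)) -!RintegralZl// -RintegralB//.
- apply: (Int_le_ae mO _ lg); first exact: (L1B mO (L1Z mO _ lA) (L1Z mO _ lE)).
  apply: aeD_mp2 (aeD_and bK bu) hg => x Ox [h1 h2]; apply: le_trans.
  rewrite mulr1 !indicE.
  have [xA|xA] := boolP (x \in A); last first.
    rewrite mul0r mulr0 sub0r (le_trans (_ : _ <= 0)) ?mulr_ge0// oppr_le0 !mulr_ge0// ltW//.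
  rewrite mul1r; have [xE|xE] := boolP (x \in E).
    rewrite mulr1; apply: (@le_trans _ _ 0); last exact: mulr_ge0.
    have : `|u x - ubar x| <= 2 * K.
      by rewrite (le_trans (ler_normB _ _))// mulr2n mulrDl mul1r lerD.
    by move=> /(ler_wpM2l (ltW e0)); lra.
  rewrite mulr0 subr0 ler_wpM2r// leNgt; apply/negP => hlt.
  move/negP: xE; apply; apply/mem_set; split; first exact: set_mem.
  rewrite hlt andbT normr_gt0 subr_eq0; apply/eqP => pb.
  by have [_] := set_mem xA; apply; apply: Ip.
- exact: (L1Z mO _ lA).
- exact: (L1Z mO _ lE).
Qed.

End active_set.

End controls.

(** * Convergence rates *)

Section rates.
Context (R : realType).
Implicit Types (X G H LA Z N al : R).

(** The threshold on Z makes (C + delta) Z^2 <= tau Z / 2; outside of the cone this is less than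
    G/2, which pays for the possibly negative second derivative, for the comparison error and for
    the term in Z^2 to be gained. *)
Lemma cone_dichotomy (X G H Z C tau delta : R) : 0 < C -> 0 < delta -> 0 < tau ->
  0 <= G -> 0 <= Z -> `|X - H| <= delta / 2 * Z ^+ 2 -> `|H| <= C * Z ^+ 2 ->
  (G <= tau * Z -> delta * Z ^+ 2 <= H) -> Z <= tau / (2 * (C + delta)) ->
  G / 2 + delta / 2 * Z ^+ 2 <= X + G.
Proof.
move=> C0 d0 t0 G0 Z0; rewrite !ler_norml => /andP[h1 _] /andP[h2 _] hc hZ.
have [/hc h|hG] := leP G (tau * Z); first by lra.
have cd : 0 < 2 * (C + delta) by lra.
move: hZ; rewrite ler_pdivlMr// => hZ.
have := ler_wpM2r Z0 hZ; rewrite !expr2 in h1 h2 *; nra.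
Qed.

Lemma energy_rate (X G LA Z N al kappa delta W K M : R) : 0 < al -> 0 < delta ->
  0 <= W -> 0 <= K -> 0 <= M -> 0 <= LA -> 0 <= Z ->
  X + G + al * N ^+ 2 <= al * (W * Z + K * LA) ->
  G / 2 + delta / 2 * Z ^+ 2 <= X + G ->
  (forall e, 0 < e -> e * LA - M * (e `^ kappa * e) <= G) ->
  0 < kappa ->
  delta / 4 * Z ^+ 2 + G / 4 + al * N ^+ 2 <=
  W ^+ 2 / delta * al ^+ 2 + M * (4 * (K + 1)) `^ (kappa + 1) * al `^ (kappa + 1).
Proof.
move=> al0 d0 W0 K0 M0 LA0 Z0 h1 h2 h3 k0.
pose k := 4 * (K + 1); have kp : 0 < k by rewrite /k; lra.
have e0 : 0 < k * al by rewrite mulr_gt0.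
have := h3 _ e0; set s := (k * al) `^ kappa * (k * al).
have -> : M * k `^ (kappa + 1) * al `^ (kappa + 1) = M * s.
  rewrite -mulrA -powRM ?(ltW kp) ?(ltW al0)// /s powRD ?powRr1 ?(ltW e0)//.
  by apply/implyP => _; rewrite gt_eqF.
have s0 : 0 <= M * s by rewrite mulr_ge0// mulr_ge0 ?powR_ge0// ltW.
move=> h4; have h5 : al * K * LA <= k * al * LA / 4.
  have := mulr_ge0 (ltW al0) LA0; rewrite /k; nra.
have h6 : al * (W * Z) <= delta / 4 * Z ^+ 2 + W ^+ 2 / delta * al ^+ 2.
  rewrite -(ler_pM2l d0) -subr_ge0.
  have -> : delta * (delta / 4 * Z ^+ 2 + W ^+ 2 / delta * al ^+ 2) - delta * (al * (W * Z)) =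
     (delta / 2 * Z - al * W) ^+ 2 by field; rewrite gt_eqF.
  exact: sqr_ge0.
lra.
Qed.

Lemma powR_half_sq (a r : R) : (a `^ (r / 2)) ^+ 2 = a `^ r.
Proof. by rewrite -powR_mulrn ?powR_ge0// -powRrM divfK. Qed.

Lemma sq_rate (x Q a r : R) : 0 <= x -> 0 <= Q -> x ^+ 2 <= Q * a `^ r ->
  `|x| <= (Num.sqrt Q + 1) * `|a `^ (r / 2)|.
Proof.
move=> x0 Q0 h; have p0 : 0 <= a `^ (r / 2) by exact: powR_ge0.
rewrite !ger0_norm//; apply: (@le_trans _ _ (Num.sqrt Q * a `^ (r / 2))).
  by rewrite -ler_sqr ?nnegrE// ?mulr_ge0 ?sqrtr_ge0// exprMn sqr_sqrtr// powR_half_sq.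
by rewrite ler_wpM2r// lerDl.
Qed.

(** This e makes e^(kappa + 1) equal to al^(d + 1), so the measure term has the order of the bound
    on G before the division by e. *)
Lemma active_rate (LA G M Q kappa d al : R) : 0 < al -> 0 < kappa -> 0 <= LA ->
  (forall e, 0 < e -> e * LA - M * (e `^ kappa * e) <= G) -> G <= Q * al `^ (d + 1) ->
  LA <= (Q + M) * al `^ (kappa * (d + 1) / (kappa + 1)).
Proof.
move=> al0 k0 LA0 h hG; pose e := al `^ ((d + 1) / (kappa + 1)).
have e0 : 0 < e by exact: powR_gt0.
have k1 : kappa + 1 != 0 by rewrite gt_eqF// addr_gt0.
have aln (b : bool) : b ==> (al != 0) by rewrite gt_eqF ?implybT.
have ek : e `^ kappa * e = al `^ (d + 1).
  rewrite /e -powRrM -powRD//; congr (_ `^ _); by field.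
have ea : e * al `^ (kappa * (d + 1) / (kappa + 1)) = al `^ (d + 1).
  by rewrite /e -powRD//; congr (_ `^ _); by field.
rewrite -(ler_pM2l e0) mulrCA ea mulrDl -lerBlDr.
by apply: le_trans hG; rewrite -ek; exact: h.
Qed.

(** For al <= 1 the exponent 2 of the source term dominates d + 1 only when d <= 1; for W = 0 the
    exponent kappa + 1 alone decides. *)
Lemma powR_rate (W delta M' al kappa d : R) : 0 < al <= 1 -> 0 < delta -> 0 <= M' ->
  d <= kappa -> (W = 0 \/ d <= 1) ->
  W ^+ 2 / delta * al ^+ 2 + M' * al `^ (kappa + 1) <= (W ^+ 2 / delta + M') * al `^ (d + 1).
Proof.
move=> al1 d0 M0 dk hW; rewrite mulrDl; apply: lerD.
  case: hW => [->|dl1]; first by rewrite expr0n/= !mul0r.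
  rewrite ler_wpM2l ?divr_ge0 ?sqr_ge0 ?(ltW d0)//.
  have al0 : 0 <= al by case/andP: al1 => /ltW.
  by rewrite -powR_mulrn//; apply: ger_powR => //; lra.
by rewrite ler_wpM2l//; apply: ger_powR => //; lra.
Qed.

End rates.

Theorem theorem6p4 (R : realType) (n : nat) (Omega : set 'rV[R]_n)
    (a : 'I_n -> 'I_n -> 'rV[R]_n -> R) (lambdaA : R)
    (f : 'rV[R]_n -> R -> R) (q : \bar R)
    (yd ua ub : 'rV[R]_n -> R) (beta : R)
    (S P : ('rV[R]_n -> R) -> ('rV[R]_n -> R))
    (S' S'adj : ('rV[R]_n -> R) -> ('rV[R]_n -> R) -> ('rV[R]_n -> R))
    (ubar : 'rV[R]_n -> R) (I : set 'rV[R]_n) (w : 'rV[R]_n -> R) (kappa : R)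
    (u : R -> 'rV[R]_n -> R) :
  (0 < n <= 3)%N -> bounded_lipschitz_domain Omega ->
  elliptic Omega a lambdaA ->
  ((n%:R / 2)%:E < q)%E -> (1 <= q)%E ->
  admissible_nonlinearity Omega q f ->
  inL Omega 2%:E yd -> inL Omega q yd ->
  inL Omega +oo%E ua -> inL Omega +oo%E ub ->
  (\forall x \ae lebesgue_rV R n, Omega x -> ua x <= 0 <= ub x) ->
  0 < beta ->
  control_to_state Omega a f S ->
  (forall v, inL Omega 2%:E v -> frechet_L2_Y Omega S v (S' v)) ->
  (forall v, inL Omega 2%:E v -> adjoint_L2 Omega (S' v) (S'adj v)) ->
  adjoint_state Omega a f yd S P ->
  local_solution Omega yd ua ub beta S ubar ->
  FO Omega ua ub beta P ubar ->
  SSC2 Omega f ua ub beta S S' P ubar ->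
  ASC2 Omega ua ub beta P S'adj ubar I w kappa ->
  (forall alpha, 0 < alpha ->
     stationary_point Omega ua ub beta P alpha (u alpha)) ->
  weak_cvg_L2 Omega (0^'+) u ubar ->
  let A := Omega `\` I in
  convergence_rates Omega S' ubar A u kappa (Num.min kappa 1) /\
  ((forall x, Omega x -> w x = 0) \/ A = Omega ->
     convergence_rates Omega S' ubar A u kappa kappa).
Proof.
move=> n03 [oO _ _ bO _] ella _ q1 hf lyd' _ hua hub uab beta0 hS hT hadj hP [Ub _] hFO hSSC.
move=> [[mI IO Yw k0] Ip hproj [c c0 hmeas] hoo] hst hw A.
have mO : measurable Omega by exact: open_measurable_rV.
have fO : (lebesgue_rV R n Omega < +oo)%E by exact: bounded_set_lty.
pose mu := lebesgue_rV R n.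
have lb : L2 mu Omega ubar by exact: (Uad_L2 oO Ub).
have lyd : L2 mu Omega yd by exact/(inL2P _ mO).
have fT := hT _ ((inL2P _ mO).2 lb); pose T := S' ubar.
have LT v (lv : L2 mu Omega v) : L2 mu Omega (T v) by exact: (L2_linearized oO bO fT lv).
have adj g : L2 mu Omega g -> L2 mu Omega (S'adj ubar g) /\
    forall v, L2 mu Omega v -> ip mu Omega (T v) g = ip mu Omega v (S'adj ubar g).
  move=> /(inL2P _ mO) lg; have [la ha] := hadj _ ((inL2P _ mO).2 lb) g lg.
  by split; [exact/inL2P|move=> v /(inL2P _ mO); exact: ha].
have LP v (lv : L2 mu Omega v) : L2 mu Omega (P v) by have [] := adjoint_pair oO bO hP lv.
have lp := LP _ lb; have [lw _ _] := inY_pair oO bO Yw.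
have [K K0 hK] := Uad_bounded oO hua hub.
set n1 := n2 mu Omega (fun=> 1).
(* [Uad] is bounded in L^infty, which bounds the whole family in L2 and makes the constants of the
   asymptotics uniform; + 1 keeps V positive. *)
pose V := 2 * K * n1 + 1; have V0 : 0 < V by rewrite ltr_wpDl// !mulr_ge0 ?n2_ge0 ?ltW.
have good v : Uad Omega ua ub v -> n2 mu Omega (fun x => v x - ubar x) <= V.
  move=> /hK[lv bv]; have [_ bb] := hK _ Ub.
  apply: (@le_trans _ _ (2 * K * n1)); last by rewrite lerDl.
  apply: (n2_bdd mO fO (L2_measurable (L2B mO lv lb))); last by rewrite mulr_ge0 ?ltW.
  apply: aeD_mp2 bv bb => x _ h1 h2; rewrite (le_trans (ler_normB _ _))//.
  by rewrite mulr_natl mulr2n lerD.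
have gu : \forall t \near 0^'+, L2 mu Omega (u t) /\ n2 mu Omega (fun x => u t x - ubar x) <= V.
  near=> t; have t0 : 0 < t by near: t; exact: nbhs_right_gt.
  by have [Uu _] := hst _ t0; split; [exact: (Uad_L2 oO Uu)|exact: good].
have wu g : L2 mu Omega g -> ip mu Omega (fun x => u t x - ubar x) g @[t --> 0^'+] --> (0 : R).
  move=> lg; have h := hw g ((inL2P _ mO).2 lg).
  have hh : dotL2 Omega (u t) g - dotL2 Omega ubar g @[t --> 0^'+] --> (0 : R).
    rewrite -[X in _ --> X](subrr (dotL2 Omega ubar g)); exact: (cvgB h (cvg_cst _)).
  move: hh; apply: cvg_trans; apply: near_eq_cvg; apply: filterS gu => t [lu _].
  by rewrite (ipBl mO lu lb lg).
have [W [K1 [W0 K10 Wz hW]]] := source_bound oO bO hua hub Ub mI lw LT adj hproj hoo.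
have [M M0 hM] := growth_lower oO bO hua hub uab beta0 Ub lp hFO mI c0 Ip hmeas.
have [C C0 hC] := hessian_bound oO bO n03 ella q1 hf hS lb fT V0 lyd hP.
have [delta [tau [d0 tau0 hcone]]] := hSSC.
pose Z t := n2 mu Omega (T (fun x => u t x - ubar x)).
pose N t := n2 mu Omega (fun x => u t x - ubar x).
pose LA t := \int[mu]_(x in A) `|u t x - ubar x|.
pose G t := growth Omega beta P ubar (u t).
have LA0 t : 0 <= LA t by apply: Rintegral_ge0.
have rz : 0 < tau / (2 * (C + delta)) by rewrite divr_gt0// mulr_gt0// addr_gt0.
pose M' := M * (4 * (K1 + 1)) `^ (kappa + 1).
have M'0 : 0 <= M' by rewrite mulr_ge0// powR_ge0.
have d2 : 0 < delta / 2 by rewrite divr_gt0.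
have PF : ProperFilter ((0 : R)^'+) := _.
have hcmp := hessian_comparison oO bO n03 ella q1 hf hS lb fT V0 lyd hP gu wu adj d2.
have hvan := linearized_vanish oO bO lb fT gu wu rz.

have core : \forall t \near 0^'+, [/\ 0 < t <= 1, Uad Omega ua ub (u t) &
    delta / 4 * Z t ^+ 2 + G t / 4 + t * N t ^+ 2 <=
    W ^+ 2 / delta * t ^+ 2 + M' * t `^ (kappa + 1)].
  near=> t; have t0 : 0 < t by near: t; exact: nbhs_right_gt.
  have t1 : t <= 1 by near: t; exact: nbhs_right_le.
  have st := hst _ t0; have [Uu _] := st.
  have lu := Uad_L2 oO Uu; have lv := L2B mO lu lb.
  split=> //; first by rewrite t0.
  have [G0 hG] := hM _ Uu.
  have hc1 : `|ip mu Omega (fun x => P (u t) x - P ubar x) (fun x => u t x - ubar x) -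
      hessian Omega f S ubar T P (fun x => u t x - ubar x)| <= delta / 2 * Z t ^+ 2.
    by near: t; exact: hcmp.
  have hz1 : Z t <= tau / (2 * (C + delta)) by near: t; exact: hvan.
  set X := ip mu Omega (fun x => P (u t) x - P ubar x) (fun x => u t x - ubar x).
  have st1 := stationarity_bound oO bO beta0 Ub lp (LP _ lu) st.
  apply: (@energy_rate _ X _ (LA t)) => //; first exact: n2_ge0.
    apply: (le_trans st1); rewrite mulNr -mulrN ler_wpM2l ?(ltW t0)//; exact: hW.
  apply: (@cone_dichotomy _ X _ (hessian Omega f S ubar T P (fun x => u t x - ubar x)) _ C tau delta) => //.
  - exact: n2_ge0.
  - exact: hC.
  (* A small growth term places the difference of the controls in the critical cone: the sign
     conditions hold because both controls respect the same bounds. *)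
  - move=> hg; have := hcone (u t \- ubar); rewrite (normL2E mO (LT _ lv)); apply; split.
    + exact/inL2P.
    + by apply: filterS2 Uu.2 Ub.2 => x /= h1 h2 Ox; move/andP: (h1 Ox) => [u1 u2]; split => e; rewrite ?subr_ge0 ?subr_le0 e.
    + by rewrite (normL2E mO (LT _ lv)).
(* One argument for both claims: the alternative W = 0 is what admits d = kappa > 1. *)
have rates d : d <= kappa -> W = 0 \/ d <= 1 -> convergence_rates Omega S' ubar A u kappa d.
  move=> dk dW; set Q := W ^+ 2 / delta + M'.
  have Q0 : 0 <= Q by rewrite addr_ge0// divr_ge0 ?sqr_ge0// ltW.
  have all3 : \forall t \near 0^'+, [/\ 0 < t <= 1, Uad Omega ua ub (u t),
      Z t ^+ 2 <= 4 * Q / delta * t `^ (d + 1), G t <= 4 * Q * t `^ (d + 1) &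
      N t ^+ 2 <= Q * t `^ d].
    apply: filterS core => t [t01 Uu h]; have t0 : 0 < t by case/andP: t01.
    have [G0 _] := hM _ Uu.
    have hp := powR_rate t01 d0 M'0 dk dW.
    have := le_trans h hp; rewrite -/Q => {}h.
    have tp : 0 <= t `^ (d + 1) by exact: powR_ge0.
    have Z2 : 0 <= delta / 4 * Z t ^+ 2 by rewrite mulr_ge0 ?sqr_ge0// divr_ge0// ltW.
    have N2 : 0 <= t * N t ^+ 2 by rewrite mulr_ge0 ?sqr_ge0// ltW.
    have G2 : 0 <= G t by exact: G0.
    split => //.
    - rewrite -(ler_pM2l (divr_gt0 d0 (ltr0n _ 4))).
      rewrite (_ : delta / 4 * (4 * Q / delta * t `^ (d + 1)) = Q * t `^ (d + 1)); first lra.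
      by field; rewrite gt_eqF.
    - lra.
    (* The factor t in front of N^2 costs one power of t, hence d/2 and not (d + 1)/2 for the
       controls. *)
    - rewrite -(ler_pM2l t0) [leRHS]mulrCA.
      have -> : t * t `^ d = t `^ (d + 1).
        have tn : (1 + d == 0) ==> (t != 0) by rewrite (gt_eqF t0) implybT.
        by rewrite addrC (powRD tn) powRr1// ltW.
      lra.
  split; apply/eqO_exP.
  - exists (Num.sqrt (4 * Q / delta) + 1); first by rewrite ltr_wpDl ?sqrtr_ge0.
    apply: filterS all3 => t [_ Uu h _ _].
    rewrite (normL2E mO (LT _ (L2B mO (Uad_L2 oO Uu) lb))).
    by apply: sq_rate h; rewrite ?n2_ge0// divr_ge0 ?mulr_ge0// ltW.
  - exists (4 * Q + M + 1); first by rewrite ltr_wpDl// addr_ge0// mulr_ge0.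
    apply: filterS all3 => t [/andP[t0 _] Uu _ h _]; have [_ hG] := hM _ Uu.
    have mA : measurable A by exact: measurableD.
    have mv : measurable_fun A (fun x => u t x - ubar x).
      apply: measurable_funS (L2_measurable (L2B mO (Uad_L2 oO Uu) lb)) => //; exact: subDsetl.
    rewrite (normL1E mA mv) ger0_norm ?LA0// [X in _ * X]ger0_norm ?powR_ge0//.
    apply: (le_trans (active_rate t0 k0 (LA0 t) hG h)).
    by rewrite ler_wpM2r ?powR_ge0// lerDl.
  - exists (Num.sqrt Q + 1); first by rewrite ltr_wpDl ?sqrtr_ge0.
    apply: filterS all3 => t [_ Uu _ _ h].
    rewrite (normL2E mO (L2B mO (Uad_L2 oO Uu) lb)).
    by apply: sq_rate h; rewrite ?n2_ge0.
split.
  by apply: rates; [rewrite ge_min lexx|right; rewrite ge_min lexx orbT].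
by move=> /Wz W00; apply: rates => //; left.
Unshelve. all: by end_near.
Qed.
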